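(* Let $\rho>0$. If $(\tilde q_n)_{n\in\mathbb{N}}$ is a sequence of natural numbers satisfying $\tilde q_1\geq \rho+1$ and $$\tilde q_{n+1}\ \geq\ 2^n\cdot 64\pi^2\cdot n^2\cdot \tilde q_n^{14}\cdot \exp\Big(4\pi\cdot n\cdot \tilde q_n^{6}\cdot \exp\big(2\pi\cdot \tilde q_n^{4}\cdot(1+n\cdot \tilde q_n)\big)\Big)\qquad\text{for all } n\in\mathbb{N},$$ then there exists a weak mixing diffeomorphism in $\mathrm{Diff}^{\omega}_{\rho}(\mathbb{T}^2)$ that is uniformly rigid along the sequence $(\tilde q_n)_{n\in\mathbb{N}}$.
   Context: Natural numbers are positive integers. $\mathbb{T}^2=\mathbb{R}^2/\mathbb{Z}^2$ with Lebesgue (Haar) probability measure $\mu$ and its standard metric $d$. Diffeomorphisms called weak mixing or uniformly rigid are measure-preserving for $\mu$. Weak mixing: $T$ preserves $\mu$ and for all measurable $A,B$, $\frac1N\sum_{n=1}^N|\mu(T^nA\cap B)-\mu(A)\mu(B)|\to 0$ as $N\to\infty$. Uniformly rigid along an increasing sequence $(n_m)_{m\in\mathbb{N}}$ of natural numbers: $d_u(T^{n_m},\mathrm{id})\to 0$ as $m\to\infty$, where $d_u(S,T)=\sup_x d(S(x),T(x))+\sup_x d(S^{-1}(x),T^{-1}(x))$. For $\rho>0$ let $A^\rho=\{(\theta,r)\in\mathbb{C}^2: |\mathrm{Im}\,\theta|<\rho,\ |\mathrm{Im}\,r|<\rho\}$. $C^\omega_\rho(\mathbb{T}^2)$ is the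 set of real-analytic $\mathbb{Z}^2$-periodic functions $f:\mathbb{R}^2\to\mathbb{R}$ that extend holomorphically to $A^\rho$ with $\|f\|_\rho:=\sup_{A^\rho}|f|<\infty$. $\mathrm{Diff}^\omega_\rho(\mathbb{T}^2)$ is the set of real-analytic diffeomorphisms of $\mathbb{T}^2$ homotopic to the identity having a lift $F(\theta,r)=(\theta+f_1(\theta,r),\,r+f_2(\theta,r))$ with $f_1,f_2\in C^\omega_\rho(\mathbb{T}^2)$. *)

(* Defs.v *)
Set Warnings "-notation-incompatible-prefix,-notation-overridden,-ambiguous-paths,-redundant-canonical-projection".
From HB Require Import structures.
From mathcomp Require Import all_boot all_order all_algebra generic_quotient.
From mathcomp Require Import all_classical all_reals all_analysis.
From mathcomp Require Import complex.

Set Implicit Arguments.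
Unset Strict Implicit.
Unset Printing Implicit Defensive.

Import Order.TTheory GRing.Theory Num.Theory.
Import numFieldNormedType.Exports.

Local Open Scope classical_set_scope.
Local Open Scope ring_scope.
Local Open Scope quotient_scope.

Section Torus.
Variable R : realType.

Definition same_mod_Z2 (x y : R * R) : bool :=
  (x.1 - y.1 \is a Num.int) && (x.2 - y.2 \is a Num.int).

Lemma same_mod_Z2_equiv : equiv_class_of same_mod_Z2.
Proof.
split=> [x|x y|y x z]; rewrite /same_mod_Z2.
- by rewrite !subrr !rpred0.
- by rewrite -(opprB x.1) -(opprB x.2) !rpredN.
- move=> /andP[h1 h2] /andP[h3 h4].
  apply/andP; split; first by rewrite -(subrKA y.1) rpredD.
  by rewrite -(subrKA y.2) rpredD.
Qed.

Canonical same_mod_Z2_equivRel := EquivRelPack same_mod_Z2_equiv.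
Canonical same_mod_Z2_encModRel := defaultEncModRel same_mod_Z2.

Definition torus : Type := quotient_topology {eq_quot same_mod_Z2}.

HB.instance Definition _ :=
  Quotient.copy torus (quotient_topology {eq_quot same_mod_Z2}).
HB.instance Definition _ :=
  Topological.copy torus (quotient_topology {eq_quot same_mod_Z2}).
HB.instance Definition _ := isPointed.Build torus (\pi_torus (0, 0)).

Definition toT (x : R * R) : torus := \pi_torus x.

Definition euclid_dist (x y : R * R) : R :=
  Num.sqrt ((x.1 - y.1) ^+ 2 + (x.2 - y.2) ^+ 2).

Definition torus_dist (p q : torus) : R :=
  inf [set t | exists x y, [/\ toT x = p, toT y = q & t = euclid_dist x y]].

(* The Borel sigma-algebra. *)
Definition torus_measurable : set (set torus) := <<s @open torus >>.

(* The unit square is a fundamental domain, so this is Haar measure of mass 1. *)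
Definition unit_square : set (R * R) :=
  [set x | 0 <= x.1 < 1 /\ 0 <= x.2 < 1].

Definition torus_mu (A : set torus) : \bar R :=
  (@lebesgue_measure R \x @lebesgue_measure R)%E (unit_square `&` toT @^-1` A).

Definition measure_preserving (T : torus -> torus) : Prop :=
  forall A, torus_measurable A ->
    torus_measurable (T @^-1` A) /\ torus_mu (T @^-1` A) = torus_mu A.

(* torus_mu is finite on measurable sets, so fine loses no information. *)
Definition weak_mixing (T : torus -> torus) : Prop :=
  measure_preserving T /\
  forall A B, torus_measurable A -> torus_measurable B ->
    (fun N : nat => N%:R^-1 * \sum_(1 <= n < N.+1)
       `| fine (torus_mu ((iter n T @` A) `&` B))
          - fine (torus_mu A) * fine (torus_mu B) |) @ \oo --> (0 : R).

(* Meant for bijections S and T, whose inverses are pinv setT S and pinv setT T. *)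
Definition dist_u (S T : torus -> torus) : R :=
  sup (range (fun x => torus_dist (S x) (T x))) +
  sup (range (fun x => torus_dist (pinv setT S x) (pinv setT T x))).

(* Sequences are indexed by the positive integers; the value at 0 is unused. *)
Definition uniformly_rigid (T : torus -> torus) (n_ : nat -> nat) : Prop :=
  [/\ measure_preserving T,
      forall m, (0 < m)%N -> (0 < n_ m)%N /\ (n_ m < n_ m.+1)%N &
      (fun m => dist_u (iter (n_ m) T) id) @ \oo --> (0 : R)].

(* f is near p the sum of an absolutely convergent double power series, whose
   terms are grouped by total degree. *)
Definition real_analytic_at (f : R * R -> R) (p : R * R) : Prop :=
  exists (r : R) (a : nat -> nat -> R), 0 < r /\
    forall x : R * R, `|x.1 - p.1| < r -> `|x.2 - p.2| < r ->
      let t i j := a i j * (x.1 - p.1) ^+ i * (x.2 - p.2) ^+ j in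
      cvgn (series (fun n => \sum_(i < n.+1) `|t i (n - i)%N|)) /\
      series (fun n => \sum_(i < n.+1) t i (n - i)%N) @ \oo --> f x.

Definition real_analytic (f : R * R -> R) : Prop :=
  forall p, real_analytic_at f p.

Definition Z2_periodic (f : R * R -> R) : Prop :=
  forall (x : R * R) (k l : int), f (x.1 + k%:~R, x.2 + l%:~R) = f x.

(* Real-analyticity in the charts of the torus given by local inverses of toT. *)
Definition torus_analytic (g : torus -> torus) : Prop :=
  forall p : R * R, exists G : R * R -> R * R,
    [/\ real_analytic_at (fun x => (G x).1) p,
        real_analytic_at (fun x => (G x).2) p &
        \forall x \near p, toT (G x) = g (toT x)].

Definition analytic_diffeo (f : torus -> torus) : Prop :=
  exists g : torus -> torus,
    [/\ cancel f g, cancel g f, torus_analytic f & torus_analytic g].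

Definition homotopic (f g : torus -> torus) : Prop :=
  exists H : R * torus -> torus,
    [/\ {within `[0, 1]%classic `*` setT, continuous H},
        forall x, H (0, x) = f x & forall x, H (1, x) = g x].

Definition strip (rho : R) : set (R[i]^o * R[i]^o) :=
  [set z | `|complex.Im z.1| < rho /\ `|complex.Im z.2| < rho].

(* R[i]^o is R[i] as a normed space over itself, so differentiable means complex
   (Frechet) differentiable, i.e. F is holomorphic on the open set strip rho. *)
Definition C_omega (rho : R) (f : R * R -> R) : Prop :=
  [/\ real_analytic f, Z2_periodic f &
      exists F : R[i]^o * R[i]^o -> R[i]^o,
        [/\ forall z, strip rho z -> differentiable F z,
            forall x : R * R, F (x.1%:C%C, x.2%:C%C) = (f x)%:C%C &
            exists M : R, forall z, strip rho z -> `|F z| <= M%:C%C]].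

Definition Diff_omega (rho : R) (f : torus -> torus) : Prop :=
  [/\ analytic_diffeo f,
      homotopic f id &
      exists f1 f2 : R * R -> R,
        [/\ C_omega rho f1, C_omega rho f2 &
            forall x : R * R, f (toT x) = toT (x.1 + f1 x, x.2 + f2 x)]].

End Torus.

(* Main.v *)
(* The diffeomorphism is an Anosov-Katok limit. Let h_n be the vertical shear
   r -> r + q_n cos (2 pi q_n theta) followed by the horizontal shear
   theta -> theta + q_n r, let H_n = h_1 o ... o h_n, and let R_t be the rotation
   theta -> theta + t. The angles alpha_n are multiples of 1 / q_n with
   0 < alpha_(n+1) - alpha_n <= 1 / q_(n+1). Since h_n commutes with the rotation by
   alpha_n, the maps f_n = H_n R_(alpha_(n+1)) H_n^-1 and f_(n-1) differ only through
   alpha_(n+1) - alpha_n, and q_(n+1) is so large compared with the Lipschitz constants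
   of H_n on a complex strip that f_n converges there. The limit f is analytic, and its
   iterate of order q_(n+1) is close to that of f_n, which is an integer translation:
   this is uniform rigidity.

   For mixing, choose m_n <= q_(n+1) so that m_n q_n (alpha_(n+1) - alpha_n) lies in
   [1/4, 1/2]. Then f^(m_n) is close to f_n^(m_n) = H_(n-1) P_n H_(n-1)^-1 where, in
   coordinates adapted to the horizontal shear, P_n displaces points by an oscillation
   of frequency q_n and amplitude at least q_n along a closed curve of slope q_n.
   Averaging successively over these scales decorrelates Lipschitz functions composed
   with H_(n-1). Hence mu (f^(-m_n) A & B) -> mu A * mu B for open sets, then for
   Borel sets; by the argument of Blum and Hanson, sums of the nearly pairwise
   independent events f^(-m_j) A have small variance, which yields weak mixing. *)
Require Import Defs.
Set Warnings "-notation-incompatible-prefix,-notation-overridden,-ambiguous-paths".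
From HB Require Import structures.
From mathcomp Require Import all_boot all_order all_algebra.
From mathcomp Require Import all_classical all_reals all_analysis.
From mathcomp Require Import cyclic separable cyclotomic complex measurable_realfun ring lra zify.
Import Order.TTheory GRing.Theory Num.Theory.
Import numFieldNormedType.Exports.
Local Open Scope classical_set_scope.
Local Open Scope ring_scope.
Local Open Scope complex_scope.

Set Implicit Arguments.
Unset Strict Implicit.
Unset Printing Implicit Defensive.

(** The obstacle is the cosine in the vertical shears: its size grows exponentially with the
    imaginary part, so the complexified [H_n] has no Lipschitz constant on the whole plane. It is
    controlled only near the backward orbits of points of one fixed strip; the n-th point of such an
    orbit stays in the strip of half-width q_(n+1). Each step costs one exponential for the width of
    the image strip and one for the Lipschitz constant there, which is the shape of the growth
    condition. The q_n are prescribed, with no divisibility between them. As a positive difference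
    of multiples of 1 / q_n and 1 / q_(n+1), a step of the angles is at least 1 / (q_n q_(n+1)), and
    this keeps the mixing time below q_(n+1). Holomorphic functions of two variables enter as
    uniform limits of polynomials on polydiscs. A discrete Cauchy estimate for the coefficients
    gives a Taylor expansion with remainder, from which complex differentiability and real
    analyticity are both read off. Mixing is proved on real points only, where [H_n] is globally
    Lipschitz. *)

Local Notation nc := ComplexField.Normc.normc.
Local Notation Re := (@complex.Re _).
Local Notation Im := (@complex.Im _).

(** * Complex exponential and cosine *)

Section Modulus.
Variable R : realType.
Implicit Types z w : R[i].

(** The norm of [R[i]] takes its values in [R[i]]; [nc] is the same number as an element of [R],
    where all estimates are carried out. *)
Lemma ncE z : `|z| = (nc z)%:C.
Proof. by []. Qed.

Lemma nc_ge0 z : 0 <= nc z.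
Proof. by case: z => a b; rewrite sqrtr_ge0. Qed.

Lemma ncD z w : nc (z + w) <= nc z + nc w.
Proof. exact: le_normcD. Qed.

Lemma ncM z w : nc (z * w) = nc z * nc w.
Proof. exact: ComplexField.Normc.normcM. Qed.

Lemma ncN z : nc (- z) = nc z.
Proof. exact: normcN. Qed.

Lemma ncB z w : nc (z - w) <= nc z + nc w.
Proof. by rewrite (le_trans (ncD _ _))// ncN. Qed.

Lemma ncBC z w : nc (z - w) = nc (w - z).
Proof. by rewrite -ncN opprB. Qed.

Lemma nc_tri u z w : nc (z - w) <= nc (z - u) + nc (u - w).
Proof. by rewrite -[z - w](subrKA u) ncD. Qed.

Lemma nc0 : nc (0 : R[i]) = 0.
Proof. exact: ComplexField.Normc.normc0. Qed.

Lemma nc1 : nc (1 : R[i]) = 1.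
Proof. exact: ComplexField.Normc.normc1. Qed.

Lemma ncX z n : nc (z ^+ n) = nc z ^+ n.
Proof. by elim: n => [|n ih]; rewrite ?expr0 ?nc1// !exprS ncM ih. Qed.

Lemma ncR (x : R) : nc x%:C = `|x|.
Proof. by rewrite /= expr0n/= addr0 sqrtr_sqr. Qed.

Lemma ncRB (x y : R) : nc (x%:C - y%:C) = `|x - y|.
Proof. by rewrite -rmorphB ncR. Qed.

Lemma ncRM (x : R) z : nc (x%:C * z) = `|x| * nc z.
Proof. by rewrite ncM ncR. Qed.

Lemma nc_natr n : nc (n%:R : R[i]) = n%:R.
Proof. by rewrite -(rmorph_nat (real_complex R)) ncR ger0_norm. Qed.

Lemma ncV z : nc z^-1 = (nc z)^-1.
Proof. exact: ComplexField.Normc.normcV. Qed.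

Lemma nc_sum (I : Type) (r : seq I) (P : pred I) (f : I -> R[i]) :
  nc (\sum_(i <- r | P i) f i) <= \sum_(i <- r | P i) nc (f i).
Proof.
apply: (big_rec2 (fun x y => nc x <= y)); first by rewrite nc0.
by move=> i y x _ xy; rewrite (le_trans (ncD _ _))// lerD.
Qed.

Lemma ReD z w : Re (z + w) = Re z + Re w.
Proof. by case: z w => [a b] [c d]. Qed.

Lemma ImD z w : Im (z + w) = Im z + Im w.
Proof. by case: z w => [a b] [c d]. Qed.

Lemma ReN z : Re (- z) = - Re z.
Proof. by case: z. Qed.

Lemma ImN z : Im (- z) = - Im z.
Proof. by case: z. Qed.

Lemma ReMr (x : R) z : Re (x%:C * z) = x * Re z.
Proof. by case: z => a b /=; rewrite mul0r subr0. Qed.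

Lemma ImMr (x : R) z : Im (x%:C * z) = x * Im z.
Proof. by case: z => a b /=; rewrite mul0r addr0. Qed.

Lemma Re_sum (I : Type) (r : seq I) (P : pred I) (f : I -> R[i]) :
  Re (\sum_(i <- r | P i) f i) = \sum_(i <- r | P i) Re (f i).
Proof. exact: (big_morph (@complex.Re R) ReD). Qed.

Lemma nc_ge_Re z : `|Re z| <= nc z.
Proof. by have := normc_ge_Re z; rewrite ncE lecR. Qed.

Lemma nc_ge_Im z : `|Im z| <= nc z.
Proof.
case: z => a b /=; rewrite -sqrtr_sqr ler_sqrt ?addr_ge0 ?sqr_ge0//.
by rewrite lerDr sqr_ge0.
Qed.

Lemma nc_le_ReIm z : nc z <= `|Re z| + `|Im z|.
Proof.
rewrite {1}(complexE z) (le_trans (ncD _ _))// ncM !ncR lerD2l.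
by rewrite /= expr0n expr1n add0r sqrtr1 mul1r.
Qed.

End Modulus.

(** * Regrouping finite sums *)

Section Triangle.

(** Regrouping by total degree, as in a Cauchy product; it serves the exponential series and the
    double power series below. *)
Lemma sum_triangle (V : nmodType) (g : nat -> nat -> V) n :
  \sum_(m < n) \sum_(i < m.+1) g i (m - i)%N
  = \sum_(j < n) \sum_(k < n | (j + k < n)%N) g j k.
Proof.
transitivity (\sum_(m < n) \sum_(i < n | (i < m.+1)%N) g i (m - i)%N).
  apply: eq_bigr => m _.
  by rewrite (big_ord_widen n (fun i => g i (m - i)%N)).
rewrite (exchange_big_dep xpredT)//=; apply: eq_bigr => j _.
transitivity (\sum_(j <= m < n) g j (m - j)%N); first by rewrite big_geq_mkord.
rewrite -{1}[j : nat]add0n big_addn big_mkord.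
rewrite (big_ord_widen n (fun k => g j (k + j - j)%N)) ?leq_subr//.
by apply: eq_big => [k|k _]; rewrite ?addnK// ltn_subRL.
Qed.

Lemma sum_ord_sub (V : zmodType) (f : nat -> V) N n : (N <= n)%N ->
  \sum_(k < n) f k - \sum_(k < N) f k = \sum_(N <= k < n) f k.
Proof.
move=> Nn; rewrite -!(big_mkord xpredT f) [X in X - _](big_cat_nat (leq0n N) Nn)/=.
by rewrite addrAC subrr add0r.
Qed.

End Triangle.

Section ComplexExp.
Variable R : realType.
Implicit Types z w : R[i].

Definition expC z : R[i] := (expR (Re z))%:C * (cos (Im z) +i* sin (Im z)).

Lemma expCD z w : expC (z + w) = expC z * expC w.
Proof.
rewrite /expC ReD ImD expRD rmorphM/= mulrACA; congr (_ * _).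
by rewrite cosD sinD; simpc; congr (_ +i* _); ring.
Qed.

Lemma nc_expC z : nc (expC z) = expR (Re z).
Proof.
rewrite /expC ncM ncR ger0_norm ?expR_ge0//=.
by rewrite cos2Dsin2 sqrtr1 mulr1.
Qed.

Definition expS n z : R[i] := \sum_(k < n) (k`!%:R)^-1 * z ^+ k.
Definition expSr n (x : R) : R := \sum_(k < n) (k`!%:R)^-1 * x ^+ k.

Lemma expSr_cvg (x : R) : expSr ^~ x @ \oo --> expR x.
Proof.
have -> : expSr ^~ x = series (exp_coeff x).
  apply/funext => n; rewrite /expSr /series/= big_mkord.
  by apply: eq_bigr => i _; rewrite exp_coeffE.
exact: is_cvg_series_exp_coeff.
Qed.

Lemma expS_real n (x : R) : expS n x%:C = (expSr n x)%:C.
Proof.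
rewrite /expS /expSr rmorph_sum; apply: eq_bigr => k _ /=.
by rewrite [RHS]rmorphM/= rmorphXn fmorphV rmorph_nat.
Qed.

(** What is left of the product are the terms of total degree at least [n]. Their coefficients are
    positive, so the remainder is dominated by the same remainder for the moduli ([nc_expS_split]),
    and that one vanishes in the limit because the real exponential is multiplicative. *)
Lemma expS_split n (z w : R[i]) : expS n z * expS n w - expS n (z + w) =
  \sum_(j < n) \sum_(k < n | ~~ (j + k < n)%N)
     ((j`!%:R)^-1 * z ^+ j) * ((k`!%:R)^-1 * w ^+ k).
Proof.
pose g j k := ((j`!%:R)^-1 * z ^+ j) * ((k`!%:R)^-1 * w ^+ k).
have -> : expS n (z + w) = \sum_(m < n) \sum_(i < m.+1) g i (m - i)%N.
  apply: eq_bigr => m _; rewrite addrC exprDn mulr_sumr; apply: eq_bigr => i _.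
  have im : (i <= m)%N by rewrite -ltnS.
  rewrite /g -mulr_natl -(bin_fact im) !natrM.
  have h k : (k`!%:R : R[i]) != 0 by rewrite pnatr_eq0 -lt0n fact_gt0.
  have hb : ('C(m, i)%:R : R[i]) != 0 by rewrite pnatr_eq0 -lt0n bin_gt0.
  by field; rewrite !h hb.
rewrite sum_triangle /expS mulr_suml -sumrB; apply: eq_bigr => j _.
rewrite mulr_sumr (bigID (fun k : 'I_n => (j + k < n)%N))/=.
by rewrite addrC addrK.
Qed.

Lemma expSr_split n (x y : R) : expSr n x * expSr n y - expSr n (x + y) =
  \sum_(j < n) \sum_(k < n | ~~ (j + k < n)%N)
     ((j`!%:R)^-1 * x ^+ j) * ((k`!%:R)^-1 * y ^+ k).
Proof.
apply: (@complexI R); rewrite rmorphB rmorphM/= -!expS_real rmorphD/= expS_split.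
rewrite rmorph_sum; apply: eq_bigr => j _; rewrite rmorph_sum.
by apply: eq_bigr => k _; rewrite !(rmorphM, rmorphXn, fmorphV, rmorph_nat).
Qed.

Lemma nc_expS_split n (z w : R[i]) : nc (expS n z * expS n w - expS n (z + w))
  <= expSr n (nc z) * expSr n (nc w) - expSr n (nc z + nc w).
Proof.
rewrite expS_split expSr_split (le_trans (nc_sum _ _ _))// ler_sum// => j _.
rewrite (le_trans (nc_sum _ _ _))// ler_sum// => k _.
by rewrite !ncM !ncV !nc_natr !ncX.
Qed.

(** On the imaginary axis the partial sums are term by term those of the cosine and sine series; the
    powers of ['i] are read off from the parity and the half of the exponent. *)
Lemma expS_i n (y : R) :
  expS n (0 +i* y) = series (cos_coeff y) n +i* series (sin_coeff y) n.
Proof.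
rewrite /expS /series/= !big_mkord.
elim: n => [|n ih]; first by rewrite !big_ord0.
rewrite !big_ord_recr/= {}ih.
suff -> : (n`!%:R)^-1 * (0 +i* y) ^+ n = cos_coeff y n +i* sin_coeff y n by simpc.
have -> : (0 +i* y) = y%:C * 'i :> R[i] by simpc.
rewrite exprMn -!rmorphXn -(rmorph_nat (real_complex R)) -fmorphV mulrA -rmorphM/=.
have -> : 'i%C ^+ n = ((~~ odd n)%:R * (-1) ^ n./2) +i* ((odd n)%:R * (-1) ^ n./2) :> R[i].
  rewrite -{1}(odd_double_half n) exprD -mul2n exprM sqr_i -exprnP.
  have -> : (-1 : R[i]) ^+ n./2 = ((-1) ^+ n./2)%:C by rewrite rmorphXn rmorphN1.
  by case: (odd n) => /=; rewrite ?expr1 ?expr0; simpc.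
simpc; rewrite /cos_coeff /sin_coeff/=; congr (_ +i* _).
  by rewrite -!exprnP; ring.
case: (boolP (odd n)) => on; last by rewrite !mul0r mulr0.
have -> : n.-1./2 = n./2 by case: n on => //= n /negbTE on; rewrite uphalf_half on.
by rewrite -!exprnP; ring.
Qed.

Lemma series_cos_cvg (x : R) : series (cos_coeff x) @ \oo --> cos x.
Proof. by rewrite cosE -cos_coeffE; exact: is_cvg_series_cos_coeff. Qed.

Lemma series_sin_cvg (x : R) : series (sin_coeff x) @ \oo --> sin x.
Proof. by have := @is_cvg_series_sin_coeff R x; rewrite sinE sin_coeffE. Qed.

(** The real and the imaginary part of [z] are treated by the known real series; [nc_expS_split]
    compares the product of the two partial sums with the partial sum at [z]. *)
Lemma expS_cvg z : nc (expS n z - expC z) @[n --> \oo] --> 0.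
Proof.
pose x := (Re z)%:C; pose y := 0 +i* Im z.
have zE : z = x + y by rewrite /x /y; case: (z) => a b /=; simpc.
pose p n := expSr n (Re z); pose c n : R := series (cos_coeff (Im z)) n.
pose s n : R := series (sin_coeff (Im z)) n.
have pc : p n @[n --> \oo] --> expR (Re z) by exact: expSr_cvg.
have cc : c n @[n --> \oo] --> cos (Im z) by exact: series_cos_cvg.
have sc : s n @[n --> \oo] --> sin (Im z) by exact: series_sin_cvg.
pose d n := expSr n (nc x) * expSr n (nc y) - expSr n (nc x + nc y).
have dc : d n @[n --> \oo] --> 0.
  rewrite -(subrr (expR (nc x + nc y))) {1}expRD.
  by apply: cvgB; [apply: cvgM|]; exact: expSr_cvg.
pose r n := d n + (`|p n * c n - expR (Re z) * cos (Im z)| +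
                   `|p n * s n - expR (Re z) * sin (Im z)|).
have rc : r n @[n --> \oo] --> 0.
  rewrite -[0]addr0; apply: cvgD => //; rewrite -[X in _ --> X]addr0.
  apply: cvgD; rewrite -(@normr0 _ R); apply: cvg_norm.
    by rewrite -(subrr (expR (Re z) * cos (Im z))); apply: cvgB; [exact: cvgM|exact: cvg_cst].
  by rewrite -(subrr (expR (Re z) * sin (Im z))); apply: cvgB; [exact: cvgM|exact: cvg_cst].
apply: (@squeeze_cvgr _ _ _ _ (fun=> 0) r) => //; last exact: cvg_cst.
near=> n; rewrite nc_ge0/= /r (le_trans (nc_tri (expS n x * expS n y) _ _))//.
rewrite lerD//; first by rewrite ncBC; have := nc_expS_split n x y; rewrite -zE.
rewrite expS_real expS_i (le_trans (nc_le_ReIm _))// /expC ReD ImD ReN ImN.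
by rewrite !ReMr !ImMr.
Unshelve. all: by end_near. Qed.

Lemma expS_tail (M : R) N z : nc z <= M ->
  nc (expC z - expS N z) <= expR M - expSr N M.
Proof.
move=> zM.
have mono n : (N <= n)%N -> nc (expS n z - expS N z) <= expSr n M - expSr N M.
  move=> Nn; rewrite /expS /expSr.
  rewrite (sum_ord_sub (fun k => (k`!%:R)^-1 * z ^+ k) Nn).
  rewrite (sum_ord_sub (fun k => (k`!%:R)^-1 * M ^+ k) Nn).
  rewrite (le_trans (nc_sum _ _ _))// ler_sum// => k _.
  rewrite ncM ncV nc_natr ncX ler_wpM2l ?invr_ge0 ?ler0n// lerXn2r// nnegrE ?nc_ge0//.
  exact: le_trans (nc_ge0 _) zM.
have lim : nc (expS n z - expC z) + (expSr n M - expSr N M) @[n --> \oo] -->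
    0 + (expR M - expSr N M).
  by apply: cvgD; [exact: expS_cvg|apply: cvgB; [exact: expSr_cvg|exact: cvg_cst]].
rewrite -[leRHS]add0r -(cvg_lim _ lim)//; apply: limr_ge; first by apply: cvgP lim.
near=> n; rewrite (le_trans (nc_tri (expS n z) _ _))// lerD//; first by rewrite ncBC.
by apply: mono; near: n; exact: nbhs_infty_ge.
Unshelve. all: by end_near. Qed.

Lemma expS_unif (M e : R) : 0 < e -> exists N, forall z, nc z <= M ->
  nc (expC z - expS N z) <= e.
Proof.
move=> e0; have /cvgrPdist_le/(_ e e0)[N _ hN] := expSr_cvg (x := M).
exists N => z zM; rewrite (le_trans (expS_tail N zM))//.
by rewrite (le_trans (ler_norm _))//; apply: hN => /=.
Qed.

Lemma nc_expCB1 z : nc (expC z - 1) <= expR (nc z) - 1.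
Proof.
by have := @expS_tail (nc z) 1 z (lexx _); rewrite /expS /expSr !big_ord1 !expr0 fact0 !invr1 !mulr1.
Qed.

(** The constant 4 comes from points more than 1/2 apart, where the crude bound 2 exp m suffices.
    For closer points [expC w] factors out and exp u - 1 <= 2 u, a consequence of (1 - u) exp u <=
    1. *)
Lemma expC_lip (m : R) z w : Re z <= m -> Re w <= m ->
  nc (expC z - expC w) <= 4 * expR m * nc (z - w).
Proof.
move=> zm wm; have em : 0 <= expR m by exact: expR_ge0.
have [d|d] := leP (nc (z - w)) (1/2); last first.
  rewrite (le_trans (ncB _ _))// !nc_expC.
  have h1 : expR (Re z) <= expR m by rewrite ler_expR.
  have h2 : expR (Re w) <= expR m by rewrite ler_expR.
  by nra.
have -> : expC z - expC w = expC w * (expC (z - w) - 1).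
  by rewrite mulrBr mulr1 -expCD (addrC w) subrK.
rewrite ncM nc_expC.
have h1 : expR (Re w) <= expR m by rewrite ler_expR.
have h2 := nc_expCB1 (z - w).
have n0 := nc_ge0 (z - w); set u := nc (z - w) in d h2 n0 *.
have h3 := expR_ge1Dx (- u); rewrite expRN in h3.
have E0 := expR_gt0 u.
have h4 : (1 - u) * expR u <= 1.
  by rewrite -ler_pdivlMr// mul1r.
have h5 : expR u - 1 <= 2 * u by nra.
have : nc (expC (z - w) - 1) <= 2 * u by exact: le_trans h5.
have : 0 <= nc (expC (z - w) - 1) by exact: nc_ge0.
have : 0 <= expR (Re w) by exact: expR_ge0.
by nra.
Qed.

Definition cosC z : R[i] := 2^-1 * (expC ('i * z) + expC (- 'i * z)).

Lemma ReiM z : Re ('i * z) = - Im z.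
Proof. by case: z => a b /=; rewrite mul0r mul1r sub0r. Qed.

Lemma ReNiM z : Re (- 'i * z) = Im z.
Proof. by rewrite mulNr ReN ReiM opprK. Qed.

Lemma nc2V : nc (2^-1 : R[i]) = 2^-1.
Proof. by rewrite ncV nc_natr. Qed.

Lemma expC_i (y : R) : expC (0 +i* y) = cos y +i* sin y.
Proof. by rewrite /expC/= expR0 mul1r. Qed.

Lemma cosC_real (x : R) : cosC x%:C = (cos x)%:C.
Proof.
rewrite /cosC.
have -> : 'i * x%:C = 0 +i* x by simpc.
have -> : - 'i * x%:C = 0 +i* (- x) by simpc.
rewrite !expC_i cosN sinN.
have -> : (cos x +i* sin x) + (cos x +i* - sin x) = 2 * (cos x)%:C.
  by rewrite mulr_natl mulr2n; simpc.
by rewrite mulKf// pnatr_eq0.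
Qed.

Lemma nc_cosC z : nc (cosC z) <= expR `|Im z|.
Proof.
rewrite /cosC ncM nc2V.
have := ncD (expC ('i * z)) (expC (- 'i * z)); rewrite !nc_expC ReiM ReNiM.
have : expR (- Im z) <= expR `|Im z| by rewrite ler_expR ler_normr lexx orbT.
have : expR (Im z) <= expR `|Im z| by rewrite ler_expR ler_norm.
by lra.
Qed.

Lemma nc_i : nc ('i : R[i]) = 1.
Proof. by rewrite /= expr0n expr1n add0r sqrtr1. Qed.

Lemma cosC_lip (m : R) z w : `|Im z| <= m -> `|Im w| <= m ->
  nc (cosC z - cosC w) <= 4 * expR m * nc (z - w).
Proof.
move=> zm wm.
have h1 : nc (expC ('i * z) - expC ('i * w)) <= 4 * expR m * nc (z - w).
  have -> : nc (z - w) = nc ('i * z - 'i * w) by rewrite -mulrBr ncM nc_i mul1r.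
  by apply: expC_lip; rewrite ReiM; apply: le_trans (ler_norm _) _; rewrite normrN.
have h2 : nc (expC (- 'i * z) - expC (- 'i * w)) <= 4 * expR m * nc (z - w).
  have -> : nc (z - w) = nc (- 'i * z - - 'i * w) by rewrite -mulrBr ncM ncN nc_i mul1r.
  by apply: expC_lip; rewrite ReNiM; apply: le_trans (ler_norm _) _.
rewrite /cosC -mulrBr ncM nc2V opprD addrACA.
have := ncD (expC ('i * z) - expC ('i * w)) (expC (- 'i * z) - expC (- 'i * w)).
by lra.
Qed.

Lemma cos_sin_2piz (k : int) :
  cos (2 * pi * k%:~R) = 1 :> R /\ sin (2 * pi * k%:~R) = 0 :> R.
Proof.
have h n : cos (2 * pi * n%:R) = 1 :> R /\ sin (2 * pi * n%:R) = 0 :> R.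
  have -> : 2 * pi * n%:R = 0 + (pi *+ 2) *+ n :> R by rewrite add0r mulr_natr mulr_natl.
  by rewrite (periodicn (@cosD2pi R)) (periodicn (@sinD2pi R)) cos0 sin0.
case: k => n; first exact: h.
by rewrite NegzE mulrNz mulrN cosN sinN; have [-> ->] := h n.+1; rewrite oppr0.
Qed.

Lemma cosC_2piz z (k : int) : cosC (z + (2 * pi * k%:~R)%:C) = cosC z.
Proof.
rewrite /cosC !(mulrDr _ z) !expCD.
suff h (j : int) : expC ('i * (2 * pi * j%:~R)%:C) = 1.
  rewrite h mulr1; congr (_ * (_ + _)).
  suff -> : - 'i * (2 * pi * k%:~R)%:C = 'i * (2 * pi * (- k)%:~R)%:C :> R[i].
    by rewrite h mulr1.
  by rewrite mulNr -mulrN -rmorphN/= mulrNz mulrN.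
have [h1 h2] := cos_sin_2piz j.
have -> : 'i * (2 * pi * j%:~R)%:C = 0 +i* (2 * pi * j%:~R) :> R[i] by simpc.
by rewrite expC_i h1 h2.
Qed.

(** Uniformity on discs is what makes the uniform limits of polynomials stable under composition
    with the cosine. *)
Lemma cosC_poly (M e : R) : 0 < e ->
  exists p : {poly R[i]}, forall z, nc z <= M -> nc (cosC z - p.[z]) <= e.
Proof.
move=> e0; have [N hN] := expS_unif M e0.
exists (2^-1 *: \sum_(k < N) ((k`!%:R)^-1 * ('i ^+ k + (- 'i) ^+ k)) *: 'X^k) => z zM.
rewrite hornerZ horner_sum /cosC -mulrBr ncM nc2V.
have -> : \sum_(i < N) (((i`!%:R)^-1 * ('i ^+ i + (- 'i) ^+ i)) *: 'X^i).[z] =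
    expS N ('i * z) + expS N (- 'i * z).
  rewrite /expS -big_split; apply: eq_bigr => k _ /=.
  by rewrite hornerZ hornerXn !exprMn; ring.
rewrite opprD addrACA.
have h1 := hN ('i * z); rewrite ncM nc_i mul1r in h1.
have h2 := hN (- 'i * z); rewrite ncM ncN nc_i mul1r in h2.
have := ncD (expC ('i * z) - expS N ('i * z)) (expC (- 'i * z) - expS N (- 'i * z)).
by have := h1 zM; have := h2 zM; lra.
Qed.

End ComplexExp.

(** * Uniform limits of polynomials in two complex variables *)

Section Limits.
Variable R : realType.
Implicit Types e : R.

Lemma half_small e : 0 < e -> exists n, (1 / 2) ^+ n <= e.
Proof.
move=> e0; have /cvgrPdist_le/(_ e e0)[n _ hn] : (fun n => (1 / 2 : R) ^+ n) @ \oo --> (0 : R).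
  by apply: cvg_expr; rewrite ger0_norm; lra.
exists n; have := hn n (leqnn n); rewrite /= sub0r normrN ger0_norm// exprn_ge0.
Qed.

Lemma half_smallM (k e : R) : 0 < k -> 0 < e -> exists n, k * (1 / 2) ^+ n <= e.
Proof.
move=> k0 e0; have [n hn] := half_small (divr_gt0 e0 k0); exists n.
by rewrite mulrC -ler_pdivlMr.
Qed.

Lemma half_gt0 n : 0 < (1 / 2 : R) ^+ n.
Proof. by rewrite exprn_gt0//; lra. Qed.

Lemma geom_sum (t : R) N n : 0 <= t <= 1 / 2 -> (N <= n)%N ->
  \sum_(N <= m < n) t ^+ m <= 2 * (t ^+ N - t ^+ n).
Proof.
move=> /andP[t0 t1] /subnK <-; elim: (n - N)%N => [|k ih].
  by rewrite add0n big_geq// subrr mulr0.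
rewrite addSn big_nat_recr ?leq_addl//=.
have := exprn_ge0 (k + N) t0; rewrite exprS; move: ih.
set s := \sum_(_ <= _ < _) _; set u := t ^+ (k + N); set v := t ^+ N => ih u0.
have : 0 <= u * (1 - 2 * t) by rewrite mulr_ge0//; lra.
by nra.
Qed.

(** Telescoping, stated for an abstract triangle inequality so that it applies to real sequences and
    to sequences of points of the plane. *)
Lemma chain_le (d : nat -> nat -> R) (n m : nat) :
  (forall i, 0 = d i i) ->
  (forall i j k, d i k <= d i j + d j k) ->
  (forall i, (n <= i)%N -> d i i.+1 <= (1 / 2) ^+ i) -> (n <= m)%N ->
  d n m <= 2 * (1 / 2) ^+ n.
Proof.
move=> d0 dt ds nm; apply: (@le_trans _ _ (\sum_(n <= i < m) (1 / 2) ^+ i)).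
  move: nm => /subnK <-; elim: (m - n)%N => [|k ih]; first by rewrite add0n -d0 big_geq.
  rewrite addSn big_nat_recr ?leq_addl//= (le_trans (dt _ (k + n)%N _))//.
  by rewrite lerD// ds// leq_addl.
rewrite (le_trans (geom_sum _ nm))//; first by lra.
by rewrite ler_wpM2l// gerBl ltW// half_gt0.
Qed.

Lemma rlimit (u : nat -> R) :
  (forall n, `|u n.+1 - u n| <= (1 / 2) ^+ n) ->
  forall n, `|u n - limn u| <= 2 * (1 / 2) ^+ n.
Proof.
move=> h.
have key n m : (n <= m)%N -> `|u n - u m| <= 2 * (1 / 2) ^+ n.
  move=> nm; apply: (@chain_le (fun i j => `|u i - u j|)) => // [i|i j k|i _].
  - by rewrite subrr normr0.
  - by rewrite (le_trans _ (ler_normD _ _))// subrKA.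
  - by rewrite distrC.
have cu : cvgn u.
  apply: cauchy_cvg; apply: cauchy_exP => e e0.
  have [n hn] := half_small (divr_gt0 e0 (ltr0Sn R 3)).
  exists (u n); exists n => // m /= nm; rewrite /ball/=.
  by apply: (le_lt_trans (key n m nm)); lra.
move=> n; have lim : `|u n - u m| @[m --> \oo] --> `|u n - limn u|.
  by apply: cvg_norm; apply: cvgB; [exact: cvg_cst|].
rewrite -(cvg_lim _ lim)//; apply: limr_le; first by apply: cvgP lim.
by near=> m; apply: key; near: m; exact: nbhs_infty_ge.
Unshelve. all: by end_near. Qed.

(** Taken coordinatewise, so that the completeness of [R] applies; it is a total function and means
    something only under a convergence hypothesis such as that of [climit]. *)
Definition limC (u : nat -> R[i]) : R[i] := limn (Re \o u) +i* limn (Im \o u).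

Lemma climit (u : nat -> R[i]) :
  (forall n, nc (u n.+1 - u n) <= (1 / 2) ^+ n) ->
  forall n, nc (u n - limC u) <= 4 * (1 / 2) ^+ n.
Proof.
move=> h n.
have hr : forall n, `|(Re \o u) n.+1 - (Re \o u) n| <= (1 / 2) ^+ n.
  by move=> k; rewrite (le_trans _ (h k))//= -ReN -ReD nc_ge_Re.
have hi : forall n, `|(Im \o u) n.+1 - (Im \o u) n| <= (1 / 2) ^+ n.
  by move=> k; rewrite (le_trans _ (h k))//= -ImN -ImD nc_ge_Im.
rewrite (le_trans (nc_le_ReIm _))// ReD ImD ReN ImN.
have := rlimit hr n; have := rlimit hi n => /=; lra.
Qed.

End Limits.

(** * Taylor expansion of uniform limits of polynomials *)

Section PolyApprox.
Variable R : realType.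
Local Notation C := R[i].
Implicit Types (P Q : {poly {poly C}}) (p : {poly C}) (x y : C) (z : C * C).

(** In characteristic 0 the polynomial X^n - 1 is separable, so it has n distinct roots in the
    algebraically closed field [R[i]], and one of them is primitive. *)
Lemma prim_root_complex n : (n > 0)%N -> exists w : C, n.-primitive_root w.
Proof.
pose p : {poly C} := 'X^n - 1; have [r Dp] := closed_field_poly_normal p.
move=> n_gt0; rewrite (monicP _) ?monicXnsubC // scale1r in Dp.
have rn1 : all (root p) r by apply/allP=> z; rewrite -root_prod_XsubC -Dp.
have sz_r : (n < (size r).+1)%N.
  by rewrite -(size_prod_XsubC r id) -Dp size_XnsubC.
have [|z] := hasP (has_prim_root n_gt0 rn1 _ sz_r); last by exists z.
by rewrite -separable_prod_XsubC -Dp separable_Xn_sub_1 // pnatr_eq0 -lt0n.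
Qed.

(* Averaging p over the n-th roots of unity, n > size p, isolates one coefficient. *)
Lemma cauchy_coef1 p (M : R) i :
  (forall x, nc x = 1 -> nc p.[x] <= M) -> nc p`_i <= M.
Proof.
move=> h; pose N := (size p + i).+1.
have [w wN] := @prim_root_complex N isT.
have wN1 : w ^+ N = 1 := prim_expr_order wN.
have ncw k : nc (w ^+ k) = 1.
  apply/eqP; rewrite -(@pexpr_eq1 _ _ N)// ?nc_ge0// -ncX -exprM mulnC exprM wN1 expr1n.
  by rewrite nc1.
(* Since [w ^+ N = 1], the exponent [N - i] plays the role of [- i]; the other coefficients are
   multiplied by geometric sums over a nontrivial root of unity, which vanish. *)
have E : N%:R * p`_i = \sum_(k < N) p.[w ^+ k] * w ^+ (k * (N - i)).
  have wide k : p.[w ^+ k] * w ^+ (k * (N - i)) =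
      \sum_(j < N) p`_j * (w ^+ (j + (N - i))) ^+ k.
    rewrite (@horner_coef_wide _ N)//; last by rewrite /N -addnS leq_addr.
    rewrite mulr_suml; apply: eq_bigr => j _; rewrite -mulrA -!exprM -exprD.
    by rewrite mulnDl (mulnC k) (mulnC k).
  under eq_bigr do rewrite wide.
  rewrite exchange_big/=.
  have iN : (i < N)%N by rewrite /N ltnS leq_addl.
  rewrite (bigD1 (Ordinal iN))//= [X in _ + X]big1 => [|j ji].
    rewrite addr0 subnKC ?(ltnW iN)// wN1; under eq_bigr do rewrite expr1n mulr1.
    by rewrite sumr_const card_ord mulr_natl.
  rewrite -mulr_sumr; apply/eqP; rewrite mulf_eq0; apply/orP; right.
  set v := w ^+ _; have v1 : v != 1.
    rewrite /v -(prim_order_dvd wN); apply: contra ji => d.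
    apply/eqP/val_inj => /=; have jN := ltn_ord j.
    by case/dvdnP: d => -[|[|c]]; rewrite ?mulSn; lia.
  have := subrX1 v N; rewrite /v -exprM mulnC exprM wN1 expr1n subrr => /esym/eqP.
  by rewrite mulf_eq0 subr_eq0 -/v (negbTE v1).
have N0 : 0 < N%:R :> R by rewrite ltr0n.
rewrite -(ler_pM2l N0) -{1}(nc_natr R N) -ncM E (le_trans (nc_sum _ _ _))//.
rewrite -[N in leRHS]card_ord -sumr_const mulr_suml ler_sum// => k _.
by rewrite ncM ncw mulr1 mul1r h// ncw.
Qed.

(** The outer variable of [P] is the second coordinate: P[_j]_i is the coefficient of x^i y^j. *)
Definition ev P x y : C := P.[y%:P].[x].

Lemma evE P x y : ev P x y = \sum_(j < size P) (P`_j).[x] * y ^+ j.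
Proof.
rewrite /ev (horner_coef P) horner_sum; apply: eq_bigr => j _.
by rewrite hornerM -polyC_exp hornerC.
Qed.

Lemma cauchy_coef2 P (M : R) i j :
  (forall x y, nc x <= 1 -> nc y <= 1 -> nc (ev P x y) <= M) -> nc P`_j`_i <= M.
Proof.
move=> h; apply: cauchy_coef1 => x x1.
have -> : (P`_j).[x] = (map_poly (horner_eval x) P)`_j.
  by rewrite coef_map.
apply: cauchy_coef1 => y y1.
have -> : (map_poly (horner_eval x) P).[y] = ev P x y.
  by rewrite /ev -{1}[y](hornerC y x) -/(horner_eval x _) horner_map.
by rewrite h ?x1 ?y1.
Qed.

Definition hsum (a : nat -> nat -> C) N x y :=
  \sum_(n < N) \sum_(i < n.+1) a i (n - i)%N * x ^+ i * y ^+ (n - i).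

Lemma ev_hsum P : exists D, forall n x y, (D <= n)%N ->
  ev P x y = hsum (fun i j => P`_j`_i) n x y.
Proof.
(* [K] bounds the degrees in both variables, so a monomial of total degree at least [K + K] has
   coefficient 0. *)
pose K := maxn (size P) (\max_(j < size P) size (P`_j)%R).
have KP j i : (K <= j)%N || (K <= i)%N -> P`_j`_i = 0.
  have [sj|sj] := leqP (size P) j; first by rewrite [P`_j]nth_default// coef0.
  rewrite leqNgt (leq_trans sj) ?leq_maxl//= => Ki; apply: nth_default.
  apply: leq_trans Ki; apply: leq_trans (leq_maxr _ _).
  exact: (leq_bigmax (Ordinal sj)).
exists (K + K)%N => n x y Kn.
rewrite /hsum (sum_triangle (fun i j => P`_j`_i * x ^+ i * y ^+ j)).
transitivity (\sum_(j < n) \sum_(i < n) P`_j`_i * x ^+ i * y ^+ j).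
  rewrite evE (big_ord_widen_cond n predT (fun j => (P`_j).[x] * y ^+ j)); last first.
    by rewrite (leq_trans _ Kn)// (leq_trans _ (leq_addr _ _))// leq_maxl.
  rewrite big_mkcond; apply: eq_bigr => j _ /=.
  rewrite -mulr_suml -horner_coef_wide; last first.
    have [sj|sj] := leqP (size P) j; first by rewrite [P`_j]nth_default// size_poly0.
    rewrite (leq_trans _ Kn)// (leq_trans _ (leq_addr _ _))//.
    by rewrite (leq_trans _ (leq_maxr _ _))// (leq_bigmax (Ordinal sj)).
  by case: ltnP => // sj; rewrite [P`_j]nth_default// horner0 mul0r.
rewrite exchange_big/=; apply: eq_bigr => i _.
rewrite [RHS]big_mkcond; apply: eq_bigr => j _.
case: ltnP => // ij; rewrite KP ?mul0r//.
by have := leq_trans Kn ij; case: (leqP K j) => //= jK; case: (leqP K i) => // iK; lia.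
Qed.

Lemma natr_le_exp2 n : (n.+1)%:R <= 2 ^+ n :> R.
Proof. by rewrite -natrX ler_nat ltn_expl. Qed.

(** Degree m contributes m + 1 <= 2^m terms of size at most M h^m, so the tail is geometric of ratio
    2 h <= 1/2. *)
Lemma hsum_tail P (M h : R) N x y : (forall i j, nc P`_j`_i <= M) ->
  0 <= h <= 1 / 4 -> nc x <= h -> nc y <= h ->
  nc (ev P x y - hsum (fun i j => P`_j`_i) N x y) <= 2 * M * (2 * h) ^+ N.
Proof.
move=> PM /andP[h0 h4] xh yh; have [D hD] := ev_hsum P.
have M0 : 0 <= M := le_trans (nc_ge0 _) (PM 0%N 0%N).
rewrite (hD (D + N)%N)// ?leq_addr//.
rewrite /hsum (sum_ord_sub (fun n => \sum_(i < n.+1) P`_(n - i)`_i * x ^+ i * y ^+ (n - i)) (leq_addl D N)).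
rewrite (le_trans (nc_sum _ _ _))//.
apply: (@le_trans _ _ (\sum_(N <= m < D + N) M * (2 * h) ^+ m)).
  apply: ler_sum => m _; rewrite (le_trans (nc_sum _ _ _))//.
  apply: (@le_trans _ _ (\sum_(i < m.+1) M * h ^+ m)).
    apply: ler_sum => i _; rewrite !ncM !ncX -mulrA.
    rewrite ler_pM ?mulr_ge0 ?exprn_ge0 ?nc_ge0// -[in leRHS](subnKC (_ : i <= m)%N).
      by rewrite exprD ler_pM ?exprn_ge0 ?nc_ge0// lerXn2r// nnegrE ?nc_ge0.
    by rewrite -ltnS.
  rewrite sumr_const card_ord -mulrnAr ler_wpM2l// exprMn -mulr_natl.
  by rewrite ler_wpM2r ?exprn_ge0// natr_le_exp2.
rewrite -mulr_sumr -mulrA mulrCA ler_wpM2l// (le_trans (geom_sum _ (leq_addl _ _)))//.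
  by lra.
by rewrite ler_wpM2l// gerBl exprn_ge0//; lra.
Qed.

Definition disc (z0 z : C * C) := nc (z.1 - z0.1) <= 1 /\ nc (z.2 - z0.2) <= 1.

(* The closure, for uniform convergence on a polydisc, of the polynomials. *)
Definition approximable (z0 : C * C) (f : C * C -> C) :=
  forall e : R, 0 < e -> exists P, forall z, disc z0 z ->
    nc (f z - ev P (z.1 - z0.1) (z.2 - z0.2)) <= e.

Lemma ev_bound P : exists M : R, forall x y, nc x <= 1 -> nc y <= 1 -> nc (ev P x y) <= M.
Proof.
exists (\sum_(j < size P) \sum_(i < size P`_j) nc P`_j`_i) => x y x1 y1.
rewrite evE (le_trans (nc_sum _ _ _))// ler_sum// => j _.
rewrite ncM ncX -[leRHS]mulr1 ler_pM ?exprn_ge0 ?nc_ge0//; last by rewrite exprn_ile1 ?nc_ge0.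
rewrite horner_coef (le_trans (nc_sum _ _ _))// ler_sum// => i _.
by rewrite ncM ncX -[leRHS]mulr1 ler_pM ?exprn_ge0 ?nc_ge0// exprn_ile1 ?nc_ge0.
Qed.

Lemma approx_bound z0 f : approximable z0 f ->
  exists M : R, 0 <= M /\ forall z, disc z0 z -> nc (f z) <= M.
Proof.
move=> /(_ 1 ltr01)[P hP]; have [M hM] := ev_bound P.
exists (1 + M); split=> [|z [z1 z2]].
  by rewrite addr_ge0// (le_trans (nc_ge0 _) (hM 0 0 _ _))// nc0.
rewrite -[f z](subrK (ev P (z.1 - z0.1) (z.2 - z0.2))) (le_trans (ncD _ _))//.
by rewrite lerD// ?hP// hM.
Qed.

Lemma approx_ext z0 f g : (forall z, f z = g z) -> approximable z0 f -> approximable z0 g.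
Proof. by move=> /funext ->. Qed.

Lemma approx_cst z0 c : approximable z0 (fun=> c).
Proof.
move=> e e0; exists (c%:P%:P) => z _.
by rewrite /ev !hornerC subrr nc0 ltW.
Qed.

Lemma approx_fst z0 : approximable z0 fst.
Proof.
move=> e e0; exists (('X + z0.1%:P)%:P) => z _.
by rewrite /ev !hornerE subrK subrr nc0 ltW.
Qed.

Lemma approx_snd z0 : approximable z0 snd.
Proof.
move=> e e0; exists ('X + z0.2%:P%:P) => z _.
by rewrite /ev !hornerE/= subrK subrr nc0 ltW.
Qed.

Lemma approxD z0 f g : approximable z0 f -> approximable z0 g ->
  approximable z0 (fun z => f z + g z).
Proof.
move=> hf hg e e0; have e2 : 0 < e / 2 by lra.
have [P hP] := hf _ e2; have [Q hQ] := hg _ e2.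
exists (P + Q) => z dz; have {hP} := hP z dz; have {hQ} := hQ z dz.
rewrite /ev !hornerD; set p := P.[_].[_]; set q := Q.[_].[_] => h1 h2.
by rewrite opprD addrACA (le_trans (ncD _ _))//; lra.
Qed.

Lemma approxM z0 f g : approximable z0 f -> approximable z0 g ->
  approximable z0 (fun z => f z * g z).
Proof.
move=> hf hg e e0.
have [M [M0 hM]] := approx_bound hf; have [N [N0 hN]] := approx_bound hg.
have K0 : 0 < M + N + 1 by lra.
(* The error of the product is at most M d + d (N + d), and d <= 1 linearizes it. *)
pose d := Num.min 1 (e / (M + N + 1) / 2).
have d0 : 0 < d by rewrite lt_min ltr01 !divr_gt0.
have d1 : d <= 1 by rewrite ge_min lexx.
have de : 2 * (M + N + 1) * d <= e.
  have : d <= e / (M + N + 1) / 2 by rewrite ge_min lexx orbT.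
  rewrite -ler_pdivlMl ?mulr_gt0// => /le_trans; apply.
  by rewrite invfM; set t := (_ + 1)^-1; lra.
have [P hP] := hf _ d0; have [Q hQ] := hg _ d0.
exists (P * Q) => z dz; have {hP} := hP z dz; have {hQ} := hQ z dz.
have := hM z dz; have := hN z dz.
rewrite /ev !hornerM; set p := P.[_].[_]; set q := Q.[_].[_] => h1 h2 h3 h4.
have -> : f z * g z - p * q = f z * (g z - q) + (f z - p) * (g z - (g z - q)) by ring.
rewrite (le_trans (ncD _ _))// !ncM.
have h5 : nc (g z - (g z - q)) <= N + d by rewrite (le_trans (ncB _ _))// lerD.
have := nc_ge0 (f z); have := nc_ge0 (f z - p); have := nc_ge0 (g z - q).
have := nc_ge0 (g z - (g z - q)).
move: h1 h2 h3 h4 h5 => h1 h2 h3 h4 h5 a0 a1 a2 a3.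
have t1 : nc (f z) * nc (g z - q) <= M * d by rewrite ler_pM.
have t2 : nc (f z - p) * nc (g z - (g z - q)) <= d * (N + d) by rewrite ler_pM.
by nra.
Qed.

Lemma approx_unif z0 f :
  (forall e : R, 0 < e -> exists2 g, approximable z0 g &
     forall z, disc z0 z -> nc (f z - g z) <= e) -> approximable z0 f.
Proof.
move=> h e e0; have e2 : 0 < e / 2 by lra.
have [g hg fg] := h _ e2; have [P hP] := hg _ e2.
exists P => z dz; rewrite (le_trans (nc_tri (g z) _ _))//.
by have := hP z dz; have := fg z dz; lra.
Qed.

Lemma approx_poly z0 f p : approximable z0 f -> approximable z0 (fun z => p.[f z]).
Proof.
move=> hf; elim/poly_ind: p => [|p c ih].
  by apply: approx_ext (approx_cst z0 0) => z; rewrite horner0.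
apply: (@approx_ext _ (fun z => p.[f z] * f z + c)) => [z|]; first by rewrite hornerMXaddC.
by apply: approxD; [exact: approxM|exact: approx_cst].
Qed.

Lemma approx_cos z0 f : approximable z0 f -> approximable z0 (fun z => cosC (f z)).
Proof.
move=> hf; apply: approx_unif => e e0; have [M [M0 hM]] := approx_bound hf.
have [p hp] := cosC_poly M e0; exists (fun z => p.[f z]); first exact: approx_poly.
by move=> z dz; apply: hp; exact: hM.
Qed.

(** The coefficients of polynomials that are 2^-n close to [f] form Cauchy sequences by
    [cauchy_coef2], and their limits [a] are the Taylor coefficients. The remainder estimate is
    inherited from [hsum_tail]; taken at N = 1, at N = 2 and at every N, it gives below continuity,
    complex differentiability and real analyticity. *)
Lemma approx_series z0 f : approximable z0 f -> exists (a : nat -> nat -> C) (M : R),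
  (forall i j, nc (a i j) <= M) /\
  forall N (h : R) x y, 0 <= h <= 1 / 4 -> nc x <= h -> nc y <= h ->
    nc (f (z0.1 + x, z0.2 + y) - hsum a N x y) <= M * (2 * h) ^+ N.
Proof.
move=> hf; have [B [B0 hB]] := approx_bound hf.
have e0 n : 0 < (1 / 2 : R) ^+ n / 4 by rewrite divr_gt0// half_gt0.
have /choice[P hP] : forall n, exists P, forall z, disc z0 z ->
    nc (f z - ev P (z.1 - z0.1) (z.2 - z0.2)) <= (1 / 2 : R) ^+ n / 4.
  by move=> n; exact: hf.
have hP' n x y : nc x <= 1 -> nc y <= 1 ->
    nc (f (z0.1 + x, z0.2 + y) - ev (P n) x y) <= (1 / 2 : R) ^+ n / 4.
  move=> x1 y1; have := hP n (z0.1 + x, z0.2 + y).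
  by rewrite /disc/= ![_ + _ - _]addrAC !subrr !add0r; apply; split.
have dP n i j : nc ((P n.+1)`_j`_i - (P n)`_j`_i) <= (1 / 2) ^+ n.
  rewrite -!coefB; apply: cauchy_coef2 => x y x1 y1.
  rewrite /ev !hornerD !hornerN -/(ev _ _ _) -/(ev _ _ _).
  rewrite (le_trans (nc_tri (f (z0.1 + x, z0.2 + y)) _ _))//.
  have := hP' n x y x1 y1; have := hP' n.+1 x y x1 y1; rewrite ncBC exprS.
  have := half_gt0 R n; lra.
pose a i j := limC (fun n => (P n)`_j`_i).
have ha n i j : nc ((P n)`_j`_i - a i j) <= 4 * (1 / 2) ^+ n.
  exact: (@climit R (fun n => (P n)`_j`_i)).
have PB n i j : nc (P n)`_j`_i <= B + 1.
  apply: cauchy_coef2 => u v u1 v1.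
  rewrite -[ev _ _ _](subrK (f (z0.1 + u, z0.2 + v))) (le_trans (ncD _ _))// addrC lerD//.
    by apply: hB; rewrite /disc/= ![_ + _ - _]addrAC !subrr !add0r.
  rewrite ncBC (le_trans (hP' n u v u1 v1))//.
  have : (1 / 2 : R) ^+ n <= 1 by rewrite exprn_ile1//; lra.
  by lra.
exists a, (2 * (B + 1) + 4); split=> [i j|N h x y h4 xh yh].
  have := PB 0%N i j; have := ha 0%N i j; rewrite ncBC expr0.
  have := ncD (a i j - (P 0%N)`_j`_i) (P 0%N)`_j`_i; rewrite subrK; lra.
apply: (@le_trans _ _ (2 * (B + 1) * (2 * h) ^+ N)); last first.
  by rewrite ler_wpM2r ?lerDl// exprn_ge0//; lra.
apply/ler_addgt0Pr => e e_gt0.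
have h4' := andP h4; case: h4' => h0 h1.
have [x1 y1] : nc x <= 1 /\ nc y <= 1 by split; lra.
(* For fixed [N], [N * N.+1] bounds the number of terms of [hsum], each of them off by at most 4
   (1/2)^n; the term 1 accounts for the distance from [f] to [P n]. *)
pose K : R := 1 + 4 * (N * N.+1)%:R.
have K0 : 0 < K by rewrite /K ltr_pwDl// mulr_ge0.
have [n hn] := half_small (divr_gt0 e_gt0 K0).
have {}hn : (1 / 2) ^+ n * K <= e by rewrite -ler_pdivlMr.
rewrite (le_trans (nc_tri (ev (P n) x y) _ _))//.
have s1 := hP' n x y x1 y1.
have s2 : nc (ev (P n) x y - hsum (fun i j => (P n)`_j`_i) N x y) <= 2 * (B + 1) * (2 * h) ^+ N.
  exact: hsum_tail.
have s3 : nc (hsum (fun i j => (P n)`_j`_i) N x y - hsum a N x y) <= 4 * (N * N.+1)%:R * (1 / 2) ^+ n.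
  rewrite /hsum -sumrB (le_trans (nc_sum _ _ _))//.
  apply: (@le_trans _ _ (\sum_(m < N) \sum_(i < N.+1) 4 * (1 / 2) ^+ n)); last first.
    by rewrite !sumr_const !card_ord -mulrnA -[leLHS]mulr_natl mulnC; lra.
  apply: ler_sum => m _; rewrite -sumrB (le_trans (nc_sum _ _ _))//.
  rewrite (big_ord_widen N.+1 (fun i => nc ((P n)`_(m - i)`_i * x ^+ i * y ^+ (m - i) - a i (m - i)%N * x ^+ i * y ^+ (m - i)))); last first.
    by rewrite ltnS ltnW.
  rewrite big_mkcond; apply: ler_sum => i _; case: ifP => _; last first.
    by rewrite mulr_ge0// ltW// half_gt0.
  rewrite -!mulrA -mulrBl !ncM !ncX -[leRHS]mulr1 ler_pM ?mulr_ge0 ?exprn_ge0 ?nc_ge0//.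
  by rewrite -[leRHS]mulr1 ler_pM ?exprn_ge0 ?nc_ge0// exprn_ile1 ?nc_ge0.
rewrite (le_trans (lerD s1 (le_trans (nc_tri _ _ _) (lerD s2 s3))))//.
have := half_gt0 R n; move: hn; rewrite /K mulrDr; lra.
Qed.

End PolyApprox.

(** * The conjugated rotations *)

Section Shears.
Variables (K : comNzRingType) (b : nat -> K) (phi : nat -> K -> K).
Implicit Types (z : K * K) (t x : K).

(* hf n is h_n and hb n its inverse; K is R for the maps themselves and R[i]
   for their holomorphic extensions. *)
Definition hf n z := (z.1 + b n * (z.2 + phi n z.1), z.2 + phi n z.1).
Definition hb n z := (z.1 - b n * z.2, z.2 - phi n (z.1 - b n * z.2)).
Definition tr t z := (z.1 + t, z.2).

Lemma hfK n : cancel (hf n) (hb n).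
Proof. by case=> x y; rewrite /hb /hf/= !addrK. Qed.

Lemma hbK n : cancel (hb n) (hf n).
Proof. by case=> x y; rewrite /hb /hf/= !subrK. Qed.

Fixpoint Hf n z := if n is m.+1 then Hf m (hf m.+1 z) else z.
Fixpoint Hb n z := if n is m.+1 then hb m.+1 (Hb m z) else z.

Lemma HfK n : cancel (Hf n) (Hb n).
Proof. by elim: n => //= n ih z; rewrite ih hfK. Qed.

Lemma HbK n : cancel (Hb n) (Hf n).
Proof. by elim: n => //= n ih z; rewrite hbK ih. Qed.

Definition conj n t z := Hf n (tr t (Hb n z)).

Lemma trD s t z : tr s (tr t z) = tr (t + s) z.
Proof. by rewrite /tr/= addrA. Qed.

Lemma tr0 z : tr 0 z = z.
Proof. by case: z => x y; rewrite /tr/= addr0. Qed.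

Lemma conjD n s t z : conj n s (conj n t z) = conj n (t + s) z.
Proof. by rewrite /conj HfK trD. Qed.

Lemma conj0 n z : conj n 0 z = z.
Proof. by rewrite /conj tr0 HbK. Qed.

Lemma conjK n t z : conj n (- t) (conj n t z) = z.
Proof. by rewrite conjD subrr conj0. Qed.

Lemma hf_tr n t z : (forall x, phi n (x + t) = phi n x) -> hf n (tr t z) = tr t (hf n z).
Proof. by move=> h; rewrite /hf /tr/= h addrAC. Qed.

Lemma conj_step n t z : (forall x, phi n.+1 (x + t) = phi n.+1 x) ->
  conj n.+1 t z = conj n t z.
Proof. by move=> h; rewrite /conj/= hf_tr// hbK. Qed.

End Shears.

Definition growth (R : realType) (q : nat -> nat) := forall n : nat, (0 < n)%N ->
  2 ^+ n * 64 * trigo.pi ^+ 2 * n%:R ^+ 2 * (q n)%:R ^+ 14 *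
     expR (4 * trigo.pi * n%:R * (q n)%:R ^+ 6 *
       expR (2 * trigo.pi * (q n)%:R ^+ 4 * (1 + n%:R * (q n)%:R)))
   <= (q n.+1)%:R :> R.

(** * Strips, Lipschitz constants and angles of the conjugated rotations *)

Section AbC.
Variables (R : realType) (q : nat -> nat).
Hypothesis q_gt1 : forall n, (0 < n)%N -> (1 < q n)%N.
Hypothesis q_growth : growth R q.
Implicit Types (x y : R * R) (z w : R[i] * R[i]) (n : nat) (j : int).

Local Notation Q n := ((q n)%:R : R).

Lemma Q_ge2 n : (0 < n)%N -> 2 <= Q n.
Proof. by move=> /q_gt1; rewrite -(ler_nat R). Qed.

Lemma Q_ge0 n : 0 <= Q n.
Proof. by rewrite ler0n. Qed.

(* hb n maps the strip |Im| <= q_n into the strip |Im| <= width n, and hf n is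
   lip n-Lipschitz for the sum norm on the strip |Im| <= width n + 1. *)
Definition width n : R :=
  Q n * (1 + Q n) + Q n * expR (2 * pi * Q n * (Q n * (1 + Q n))).

Definition lip n : R :=
  (1 + Q n) * (1 + 8 * pi * Q n ^+ 2 * expR (2 * pi * Q n * (width n + 1))).

Lemma pi2 : 2 <= pi :> R.
Proof. exact: pi_ge2. Qed.

Lemma width_ge0 n : 0 <= width n.
Proof.
by rewrite addr_ge0 ?mulr_ge0 ?expR_ge0 ?addr_ge0 ?Q_ge0.
Qed.

Lemma widthD1_ge1 n : 1 <= width n + 1.
Proof. by have := width_ge0 n; lra. Qed.

Lemma lip_ge1 n : 1 <= lip n.
Proof.
rewrite /lip; have := Q_ge0 n.
have : 0 <= 8 * pi * Q n ^+ 2 * expR (2 * pi * Q n * (width n + 1)).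
  by rewrite !mulr_ge0 ?pi_ge0 ?exprn_ge0 ?expR_ge0 ?Q_ge0.
set a := 8 * _ * _ * _; set u := Q n; nra.
Qed.

(** Apart from [q_gt1], the growth hypothesis is used only through this inequality. Its inner
    exponential dominates the one in [width n], its outer exponential the one in [lip n], and the
    remaining factors are compared as polynomials. *)
Lemma lip_growth n : (0 < n)%N -> lip n * (2 ^+ n * Q n ^+ 2) <= Q n.+1.
Proof.
move=> n0; apply: le_trans (q_growth n0).
have q2 := Q_ge2 n0; have p2 := pi2; rewrite /lip /width.
have n1 : 1 <= n%:R :> R by rewrite ler1n.
move: (pi) p2 (Q n) q2 (n%:R) n1 => p p2 u q2 m m1.
have t0 : 0 < 2 ^+ n :> R by rewrite exprn_gt0.
set E1 := expR (2 * p * u ^+ 4 * (1 + m * u)).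
have u2 : 4 <= u ^+ 2 by rewrite expr2; nra.
have mu : u <= m * u by rewrite ler_peMl//; lra.
have u4 : 1 + m * u <= u ^+ 2 * (1 + m * u) by rewrite ler_peMl//; lra.
have h1 : expR (2 * p * u * (u * (1 + u))) <= E1.
  rewrite ler_expR.
  have -> : 2 * p * u * (u * (1 + u)) = (2 * p * u ^+ 2) * (1 + u) by ring.
  have -> : 2 * p * u ^+ 4 * (1 + m * u) = (2 * p * u ^+ 2) * (u ^+ 2 * (1 + m * u)) by ring.
  rewrite ler_wpM2l//; last by nra.
  by rewrite mulr_ge0//; lra.
have E1_ge1 : 1 <= E1.
  rewrite -expR0 ler_expR; apply: mulr_ge0; last by nra.
  by rewrite mulr_ge0 ?exprn_ge0//; lra.
have u5 : (1 + u) ^+ 2 <= 2 * u ^+ 5.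
  have u3 : 8 <= u ^+ 3 by rewrite exprS; nra.
  have -> : 2 * u ^+ 5 = u ^+ 2 * (2 * u ^+ 3) by ring.
  by rewrite !expr2; nra.
(* The left-hand side is [width n + 1]. *)
have h2 : u * (1 + u) + u * expR (2 * p * u * (u * (1 + u))) + 1 <= 2 * u ^+ 5 * E1.
  apply: (@le_trans _ _ ((1 + u) ^+ 2 * E1)); last by rewrite ler_wpM2r//; lra.
  have : u * expR (2 * p * u * (u * (1 + u))) <= u * E1 by rewrite ler_wpM2l//; lra.
  have : (1 + u + u * u) * 1 <= (1 + u + u * u) * E1 by rewrite ler_wpM2l//; nra.
  by rewrite expr2; nra.
set X := expR _; set Y := expR (4 * _ * _ * _ * _).
have XY : X <= Y.
  rewrite ler_expR; apply: (@le_trans _ _ (2 * p * u * (2 * u ^+ 5 * E1))).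
    by rewrite ler_wpM2l// !mulr_ge0//; lra.
  have -> : 4 * p * m * u ^+ 6 * E1 = m * (2 * p * u * (2 * u ^+ 5 * E1)) by ring.
  by rewrite ler_peMl// !mulr_ge0 ?exprn_ge0//; lra.
have X1 : 1 <= X.
  rewrite -expR0 ler_expR !mulr_ge0 ?addr_ge0 ?mulr_ge0 ?expR_ge0//; lra.
have Y1 : 1 <= Y := le_trans X1 XY.
have pu : 8 <= 8 * p * u ^+ 2 by nra.
have s1 : 1 + 8 * p * u ^+ 2 * X <= 16 * p * u ^+ 2 * Y by nra.
have s2 : (1 + u) * (1 + 8 * p * u ^+ 2 * X) <= (2 * u) * (16 * p * u ^+ 2 * Y).
  apply: ler_pM => //; [lra| |lra].
  by rewrite addr_ge0// mulr_ge0//; lra.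
have u14 : u ^+ 5 <= u ^+ 14 by rewrite ler_weXn2l//; lra.
apply: (@le_trans _ _ ((2 * u) * (16 * p * u ^+ 2 * Y) * (2 ^+ n * u ^+ 2))).
  by rewrite ler_wpM2r// mulr_ge0 ?exprn_ge0//; lra.
have -> : 2 * u * (16 * p * u ^+ 2 * Y) * (2 ^+ n * u ^+ 2) = (2 ^+ n * Y) * (32 * p * u ^+ 5) by ring.
have -> : 2 ^+ n * 64 * p ^+ 2 * m ^+ 2 * u ^+ 14 * Y = (2 ^+ n * Y) * (64 * p ^+ 2 * m ^+ 2 * u ^+ 14) by ring.
rewrite ler_wpM2l//; first by rewrite mulr_ge0//; lra.
rewrite ler_pM ?exprn_ge0 ?mulr_ge0//; try lra.
have m2 : 1 <= m ^+ 2 by rewrite expr2; nra.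
have pp : p <= p ^+ 2 by rewrite expr2; nra.
have pm : p ^+ 2 <= p ^+ 2 * m ^+ 2 by rewrite ler_peMr// sqr_ge0.
by rewrite -mulrA; move: pm; set t := p ^+ 2 * _ => pm; lra.
Qed.

Fixpoint lipH n : R := if n is m.+1 then lipH m * lip m.+1 else 1.

Lemma lipH_ge1 n : 1 <= lipH n.
Proof. by elim: n => //= n ih; rewrite mulr_ege1// lip_ge1. Qed.

Lemma lip_le n : (0 < n)%N -> lip n <= Q n.+1.
Proof.
move=> n0; apply: le_trans (lip_growth n0); rewrite ler_peMr//.
  by apply: le_trans (lip_ge1 n).
have q2 := Q_ge2 n0; apply: mulr_ege1; apply: exprn_ege1; first by rewrite ler1n.
by lra.
Qed.

(** The square of [Q n] in [lip_growth] pays for this: one factor absorbs the Lipschitz constants of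
    all the earlier shears, whose product is at most [Q n.+1] by induction. *)
Lemma lipH_growth n : lipH n.+1 * (2 ^+ n.+1 * Q n.+1) <= Q n.+2.
Proof.
have H : lipH n <= Q n.+1.
  elim: n => [|n ih] /=; first by have := @Q_ge2 1%N isT; lra.
  apply: le_trans (lip_growth (ltn0Sn n)); rewrite mulrC ler_wpM2l//.
    by apply: le_trans (lip_ge1 _).
  apply: (le_trans ih); have := @Q_ge2 n.+1 isT.
  have : 1 <= 2 ^+ n.+1 :> R by rewrite exprn_ege1// ler1n.
  by rewrite expr2; set t := 2 ^+ _; set u := Q _ => *; nra.
apply: le_trans (lip_growth (ltn0Sn n)); rewrite -[lipH n.+1]/(lipH n * lip n.+1).
have -> : lip n.+1 * (2 ^+ n.+1 * Q n.+1 ^+ 2) = Q n.+1 * (lip n.+1 * (2 ^+ n.+1 * Q n.+1)) by ring.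
have l0 : 0 <= lip n.+1 := le_trans ler01 (lip_ge1 _).
by rewrite -mulrA ler_wpM2r// mulr_ge0// mulr_ge0 ?exprn_ge0.
Qed.

(** This chains the strips: the image strip of [hb n] lies in the strip on which [hb n.+1] is
    controlled. The exponential in [lip n] dominates its own exponent, hence [width n]. *)
Lemma width_le n : (0 < n)%N -> width n <= Q n.+1.
Proof.
move=> n0; apply: le_trans (lip_le n0); rewrite /lip.
have q2 := Q_ge2 n0; have p2 := pi2; have w1 := widthD1_ge1 n.
set X := 2 * pi * Q n * (width n + 1).
have hX : width n + 1 <= X.
  rewrite /X ler_peMl//; first by lra.
  by set u := Q n in q2 *; nra.
have := expR_ge1Dx X; set e := expR X => he.
have e1 : 1 <= e by lra.
have : 1 <= 8 * pi * Q n ^+ 2 by rewrite expr2; set u := Q n in q2 *; nra.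
set a := 8 * _ * _ => a1; have : e <= a * e by nra.
by set u := Q n in q2 *; nra.
Qed.

Lemma q_lt n : (0 < n)%N -> (q n < q n.+1)%N.
Proof.
move=> n0; rewrite -(ltr_nat R); apply: lt_le_trans (lip_growth n0).
have := lip_ge1 n; have := Q_ge2 n0.
have : 1 <= 2 ^+ n :> R by rewrite exprn_ege1// ler1n.
set t := 2 ^+ n; set u := Q n; set l := lip n => t1 u2 l1.
have : 1 * (1 * u ^+ 2) <= l * (t * u ^+ 2).
  by rewrite ler_pM ?mulr_ge0 ?ler_wpM2r ?exprn_ge0//; lra.
by rewrite !mul1r expr2; nra.
Qed.

Lemma Q_ratio n : (0 < n)%N -> Q n * 2 ^+ n <= Q n.+1.
Proof.
case: n => // n _; apply: le_trans (lipH_growth n); rewrite mulrC ler_peMl//.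
exact: lipH_ge1.
Qed.

Lemma Q_le m n : (0 < m)%N -> (m <= n)%N -> Q m <= Q n.
Proof.
move=> m0 /subnK <-; elim: (n - m)%N => // k ih; rewrite (le_trans ih)// ler_nat.
by rewrite ltnW// addSn q_lt// addn_gt0 m0 orbT.
Qed.

(* The first multiple of 1 / q_n beyond the previous angle; hence hf n commutes
   with tr (alpha n). *)
Fixpoint alpha n : R := if n is m.+1 then
  (Num.floor (alpha m * Q n) + 1)%:~R / Q n else 0.

Lemma alpha_int n : (0 < n)%N -> exists k : int, Q n * alpha n = k%:~R.
Proof.
case: n => // n _; exists (Num.floor (alpha n * Q n.+1) + 1) => /=.
by rewrite mulrC divfK//; have := @Q_ge2 n.+1 isT; lra.
Qed.

Lemma alpha_step n : 0 < alpha n.+1 - alpha n <= (Q n.+1)^-1.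
Proof.
have q0 : 0 < Q n.+1 by have := @Q_ge2 n.+1 isT; lra.
have -> : alpha n.+1 - alpha n =
    ((Num.floor (alpha n * Q n.+1) + 1)%:~R - alpha n * Q n.+1) / Q n.+1.
  by rewrite mulrBl /= mulfK// lt0r_neq0.
apply/andP; split; first by rewrite divr_gt0// subr_gt0 floorD1_gt.
rewrite ler_piMl ?invr_ge0 ?(ltW q0)// intrD mulr1z.
by have := floor_le (alpha n * Q n.+1); lra.
Qed.

(** Multiplied by [Q n * Q n.+1], the positive difference of the two rational angles is an integer,
    hence at least 1. This bounds the mixing time by [q n.+1]. *)
Lemma alpha_step_lower n : (0 < n)%N -> (Q n * Q n.+1)^-1 <= alpha n.+1 - alpha n.
Proof.
move=> n0; have q0 : 0 < Q n by have := Q_ge2 n0; lra.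
have q1 : 0 < Q n.+1 by have := @Q_ge2 n.+1 isT; lra.
have [k hk] := alpha_int n0; have [l hl] := alpha_int (ltn0Sn n).
have := alpha_step n => /andP[a0 _].
rewrite -[leLHS]mul1r ler_pdivrMr ?mulr_gt0//.
have E : (alpha n.+1 - alpha n) * (Q n * Q n.+1) = (l * q n - k * q n.+1)%:~R.
  by rewrite intrD mulrNz !intrM -!pmulrn -hk -hl; ring.
rewrite E -[1]/(1%:~R) ler_int -gtz0_ge1 -(ltr_int R) -E.
by rewrite !mulr_gt0.
Qed.

Definition bR n : R := Q n.
Definition phiR n (x : R) : R := Q n * cos (2 * pi * Q n * x).
Definition bC n : R[i] := (Q n)%:C.
Definition phiC n (z : R[i]) : R[i] := (Q n)%:C * cosC ((2 * pi * Q n)%:C * z).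

Definition emb x : R[i] * R[i] := (x.1%:C, x.2%:C).

Lemma phiC_real n (t : R) : phiC n t%:C = (phiR n t)%:C.
Proof. by rewrite /phiC /phiR -rmorphM/= cosC_real -rmorphM. Qed.

Lemma hf_emb n x : hf bC phiC n (emb x) = emb (hf bR phiR n x).
Proof. by rewrite /hf/= phiC_real -!rmorphD -!rmorphM -rmorphD. Qed.

Lemma hb_emb n x : hb bC phiC n (emb x) = emb (hb bR phiR n x).
Proof. by rewrite /hb /bC/= -rmorphM -rmorphB phiC_real -!rmorphB. Qed.

Lemma Hf_emb n x : Hf bC phiC n (emb x) = emb (Hf bR phiR n x).
Proof. by elim: n x => //= n ih x; rewrite hf_emb ih. Qed.

Lemma Hb_emb n x : Hb bC phiC n (emb x) = emb (Hb bR phiR n x).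
Proof. by elim: n => //= n ->; rewrite hb_emb. Qed.

Lemma tr_emb (t : R) x : tr t%:C (emb x) = emb (tr t x).
Proof. by rewrite /tr/= -rmorphD. Qed.

Lemma conj_emb n (t : R) x : conj bC phiC n t%:C (emb x) = emb (conj bR phiR n t x).
Proof. by rewrite /conj Hb_emb tr_emb Hf_emb. Qed.

Lemma phiC_period n j (z : R[i]) : (0 < n)%N ->
  phiC n (z + (j%:~R * alpha n)%:C) = phiC n z.
Proof.
move=> n0; rewrite /phiC mulrDr -rmorphM/=; have [k hk] := alpha_int n0.
have -> : 2 * pi * Q n * (j%:~R * alpha n) = 2 * pi * (j * k)%:~R.
  by rewrite intrM -hk; ring.
by rewrite cosC_2piz.
Qed.

Lemma phiR_period n j (t : R) : (0 < n)%N ->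
  phiR n (t + j%:~R * alpha n) = phiR n t.
Proof.
by move=> n0; apply: (@complexI R); rewrite -!phiC_real rmorphD phiC_period.
Qed.

Lemma phiR_int n (k : int) (t : R) : phiR n (t + k%:~R) = phiR n t.
Proof.
apply: (@complexI R); rewrite -!phiC_real rmorphD /phiC mulrDr -!rmorphM/=.
have -> : 2 * pi * Q n * k%:~R = 2 * pi * (Posz (q n) * k)%:~R.
  by rewrite intrM -pmulrn; ring.
by rewrite cosC_2piz.
Qed.

Definition strip_le (s : R) z := `|Im z.1| <= s /\ `|Im z.2| <= s.
Definition distC z w := nc (z.1 - w.1) + nc (z.2 - w.2).
Definition distR x y := `|x.1 - y.1| + `|x.2 - y.2|.

Lemma distC_ge0 z w : 0 <= distC z w.
Proof. by rewrite addr_ge0 ?nc_ge0. Qed.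

Lemma distC_tri z w v : distC z v <= distC z w + distC w v.
Proof. by rewrite addrACA lerD ?nc_tri. Qed.

Lemma distCC z w : distC z w = distC w z.
Proof. by rewrite /distC ncBC (ncBC z.2). Qed.

Lemma distC_emb x y : distC (emb x) (emb y) = distR x y.
Proof. by rewrite /distC /distR !ncRB. Qed.

Lemma distR_ge0 x y : 0 <= distR x y.
Proof. by rewrite -distC_emb distC_ge0. Qed.

Lemma distR_tri x y u : distR x u <= distR x y + distR y u.
Proof. by rewrite -!distC_emb distC_tri. Qed.

Lemma distRC x y : distR x y = distR y x.
Proof. by rewrite -!distC_emb distCC. Qed.

Lemma strip_tr s (t : R) z : strip_le s z -> strip_le s (tr t%:C z).
Proof. by rewrite /strip_le /tr/= ImD/= addr0. Qed.

Lemma strip_dist s z w : strip_le s z -> distC w z <= 1 -> strip_le (s + 1) w.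
Proof.
move=> [z1 z2] d; have n1 := nc_ge0 (w.1 - z.1); have n2 := nc_ge0 (w.2 - z.2).
rewrite /distC in d.
have h1 := nc_ge_Im (w.1 - z.1); have h2 := nc_ge_Im (w.2 - z.2).
rewrite !ImD !ImN in h1 h2.
have t1 := ler_normD (Im w.1 - Im z.1) (Im z.1); rewrite subrK in t1.
have t2 := ler_normD (Im w.2 - Im z.2) (Im z.2); rewrite subrK in t2.
by split; lra.
Qed.

Lemma strip_weak s s' z : s <= s' -> strip_le s z -> strip_le s' z.
Proof. by move=> ss' [h1 h2]; split; apply: le_trans ss'. Qed.

Lemma strip_emb s x : 0 <= s -> strip_le s (emb x).
Proof. by move=> s0; rewrite /strip_le/= normr0. Qed.

Lemma pi2Q_ge0 n : 0 <= 2 * pi * Q n.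
Proof. by rewrite !mulr_ge0 ?pi_ge0. Qed.

Lemma hb_strip n z : (0 < n)%N -> strip_le (Q n) z -> strip_le (width n) (hb bC phiC n z).
Proof.
move=> n0 [z1 z2]; have q2 := Q_ge2 n0.
have h1 : `|Im (z.1 - bC n * z.2)| <= Q n * (1 + Q n).
  rewrite ImD ImN ImMr (le_trans (ler_normB _ _))// normrM (ger0_norm (Q_ge0 n)).
  by rewrite mulrDr mulr1 lerD// ler_wpM2l.
rewrite /hb /width; split => /=.
  by apply: (le_trans h1); rewrite lerDl mulr_ge0 ?expR_ge0.
rewrite ImD ImN (le_trans (ler_normB _ _))// lerD//.
  by apply: (le_trans z2); set u := Q n in q2 *; nra.
rewrite ImMr normrM (ger0_norm (Q_ge0 n)) ler_wpM2l//.
apply: (le_trans (nc_ge_Im _)); apply: (le_trans (nc_cosC _)).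
by rewrite ler_expR ImMr normrM ger0_norm ?pi2Q_ge0// ler_wpM2l ?pi2Q_ge0.
Qed.

Lemma hf_lip n z w : strip_le (width n + 1) z -> strip_le (width n + 1) w ->
  distC (hf bC phiC n z) (hf bC phiC n w) <= lip n * distC z w.
Proof.
move=> [z1 _] [w1 _]; rewrite /distC /hf/=.
set X := expR (2 * pi * Q n * (width n + 1)).
have hphi : nc (phiC n z.1 - phiC n w.1) <= 8 * pi * Q n ^+ 2 * X * nc (z.1 - w.1).
  rewrite /phiC -mulrBr ncM ncR ger0_norm//.
  have : nc (cosC ((2 * pi * Q n)%:C * z.1) - cosC ((2 * pi * Q n)%:C * w.1)) <=
         4 * X * nc ((2 * pi * Q n)%:C * z.1 - (2 * pi * Q n)%:C * w.1).
    by apply: cosC_lip; rewrite ImMr normrM ger0_norm ?pi2Q_ge0// ler_wpM2l ?pi2Q_ge0.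
  have -> : nc ((2 * pi * Q n)%:C * z.1 - (2 * pi * Q n)%:C * w.1) =
            2 * pi * Q n * nc (z.1 - w.1).
    by rewrite -mulrBr ncRM ger0_norm ?pi2Q_ge0.
  move=> h.
  apply: (le_trans (ler_wpM2l (Q_ge0 n) h)).
  by rewrite le_eqVlt; apply/orP; left; apply/eqP; ring.
set d := nc (z.2 + phiC n z.1 - (w.2 + phiC n w.1)).
have hd : d <= nc (z.2 - w.2) + 8 * pi * Q n ^+ 2 * X * nc (z.1 - w.1).
  by rewrite /d opprD addrACA (le_trans (ncD _ _))// lerD2l.
have h1 : nc (z.1 + bC n * (z.2 + phiC n z.1) - (w.1 + bC n * (w.2 + phiC n w.1))) <=
          nc (z.1 - w.1) + Q n * d.
  by rewrite opprD addrACA -mulrBr (le_trans (ncD _ _))// ncM ncR ger0_norm.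
rewrite /lip -/X; have q0 := Q_ge0 n.
have a0 : 0 <= 8 * pi * Q n ^+ 2 * X.
  by rewrite !mulr_ge0 ?pi_ge0 ?exprn_ge0 ?expR_ge0.
have n1 := nc_ge0 (z.1 - w.1); have n2 := nc_ge0 (z.2 - w.2).
move: h1 hd n1 n2 q0 a0; rewrite -/d; set e := nc (_ + _ - _).
set A := 8 * _ * _ * _; set u := Q n; set r := nc (z.1 - _); set s := nc (z.2 - _).
move=> h1 hd n1 n2 q0 a0.
apply: (@le_trans _ _ (r + (1 + u) * (s + A * r))).
  have : u * d <= u * (s + A * r) by rewrite ler_wpM2l.
  by lra.
have As := mulr_ge0 a0 n2; have := mulr_ge0 q0 As; have := mulr_ge0 q0 n1.
by lra.
Qed.

Lemma Hb_strip n z : strip_le (Q 1) z ->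
  strip_le (Q n.+1) (Hb bC phiC n z) /\ strip_le (width n.+1) (Hb bC phiC n.+1 z).
Proof.
move=> z1; elim: n => [|n [ih1 ih2]]; first by split=> //; exact: hb_strip.
have h : strip_le (Q n.+2) (Hb bC phiC n.+1 z).
  by apply: strip_weak ih2; exact: width_le.
by split=> //=; exact: hb_strip.
Qed.

(* Hf k maps vorb j z k to conj k (j * alpha k.+1) z; the orbit under the inverse
   shears of any point near vorb j z k stays in the strips where hf is controlled. *)
Definition vorb j z k := tr (j%:~R * alpha k.+1)%:C (Hb bC phiC k z).

Lemma hf_vorb j z k : hf bC phiC k.+1 (tr (j%:~R * alpha k.+1)%:C (Hb bC phiC k.+1 z)) =
  vorb j z k.
Proof. by rewrite hf_tr ?hbK// => x; rewrite phiC_period. Qed.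

Lemma dist_tr (s t : R) z : distC (tr s%:C z) (tr t%:C z) = `|s - t|.
Proof.
by rewrite /distC /tr/= subrr nc0 addr0 opprD addrACA subrr add0r -rmorphB ncR.
Qed.

(** Only the backward orbit of [z] is known to stay in the right strips, so the Lipschitz bound is
    local. The induction works because a shear maps the ball of radius 1 / q_(k+2) around
    [vorb j z k.+1] into the ball of radius 1 / q_(k+1) around [vorb j z k]. The bound on [j] leaves
    room for the map ([j = 1]) and its inverse ([j = -1]). *)
Lemma Hf_stable j z k w w' : `|j| <= 1 -> strip_le (Q 1) z ->
  distC w (vorb j z k) <= (Q k.+1)^-1 -> distC w' (vorb j z k) <= (Q k.+1)^-1 ->
  distC (Hf bC phiC k w) (Hf bC phiC k w') <= lipH k * distC w w'.
Proof.
move=> j1 z1; elim: k w w' => [|k ih] w w' dw dw' /=; first by rewrite mul1r.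
have q2 := @Q_ge2 k.+1 isT; have q2' := @Q_ge2 k.+2 isT.
have inv1 : (Q k.+2)^-1 <= 1 by rewrite invf_le1; lra.
have [_ hw] := Hb_strip k z1.
have sv : strip_le (width k.+1) (vorb j z k.+1) by exact: strip_tr.
have step u : distC u (vorb j z k.+1) <= (Q k.+2)^-1 ->
    strip_le (width k.+1 + 1) u /\ distC (hf bC phiC k.+1 u) (vorb j z k) <= (Q k.+1)^-1.
  move=> du; have su : strip_le (width k.+1 + 1) u.
    by apply: strip_dist sv _; exact: le_trans inv1.
  split=> //; rewrite -hf_vorb.
  apply: (le_trans (hf_lip su _)).
    apply: strip_weak (strip_tr _ hw); lra.
  (* One 1 / q_(k+2) is the radius of the ball, the other one is the change of angle from
     [alpha k.+1] to [alpha k.+2]. *)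
  have d2 : distC u (tr (j%:~R * alpha k.+1)%:C (Hb bC phiC k.+1 z)) <= 2 * (Q k.+2)^-1.
    apply: (le_trans (distC_tri _ (vorb j z k.+1) _)).
    rewrite /vorb dist_tr -mulrBr normrM.
    have /andP[a0 a1] := alpha_step k.+1; rewrite (gtr0_norm a0).
    have : `|j%:~R : R| <= 1 by rewrite -intr_norm -[1]/(1%:~R) ler_int.
    move: du; rewrite /vorb => du jn.
    have : `|j%:~R : R| * (alpha k.+2 - alpha k.+1) <= 1 * (Q k.+2)^-1.
      by rewrite ler_pM// ltW.
    by lra.
  have l0 := lip_ge1 k.+1; have lg := lip_growth (ltn0Sn k).
  apply: (le_trans (ler_wpM2l (le_trans ler01 l0) d2)).
  rewrite mulrA ler_pdivrMr; last by lra.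
  rewrite ler_pdivlMl; last by lra.
  apply: le_trans lg.
  have -> : Q k.+1 * (lip k.+1 * 2) = lip k.+1 * (2 * Q k.+1) by ring.
  rewrite ler_wpM2l//; first by lra.
  rewrite exprS; have : 1 <= 2 ^+ k :> R by rewrite exprn_ege1// ler1n.
  by set t := 2 ^+ k; set r := Q k.+1 in q2 *; rewrite expr2 => t1; nra.
have [sw hw1] := step _ dw; have [sw' hw2] := step _ dw'.
apply: (le_trans (ih _ _ hw1 hw2)); rewrite -mulrA ler_wpM2l//.
  exact: le_trans (lipH_ge1 k).
exact: hf_lip.
Qed.

Lemma two_half n : (2 ^+ n)^-1 = (1 / 2) ^+ n :> R.
Proof. by rewrite div1r exprVn. Qed.

Lemma lipH_half n : lipH n.+1 / Q n.+2 <= (1 / 2) ^+ n.+1 / Q n.+1.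
Proof.
have q2 := @Q_ge2 n.+1 isT; have q2' := @Q_ge2 n.+2 isT.
rewrite ler_pdivrMr; last by lra.
rewrite -two_half -invfM mulrC ler_pdivlMr.
  exact: lipH_growth.
by rewrite mulr_gt0 ?exprn_gt0//; lra.
Qed.

Lemma conjC_close n j z : `|j| <= 1 -> strip_le (Q 1) z ->
  distC (conj bC phiC n.+1 (j%:~R * alpha n.+2)%:C z)
        (conj bC phiC n (j%:~R * alpha n.+1)%:C z) <= (1 / 2) ^+ n.+1.
Proof.
move=> j1 z1; rewrite -(@conj_step _ bC phiC n _ z); last by move=> x; rewrite phiC_period.
have q2 := @Q_ge2 n.+1 isT; have q2' := @Q_ge2 n.+2 isT.
have jd : `|(j%:~R * alpha n.+1) - (j%:~R * alpha n.+2)| <= (Q n.+2)^-1.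
  rewrite -mulrBr normrM distrC; have /andP[a0 a1] := alpha_step n.+1.
  rewrite (gtr0_norm a0) -[leRHS]mul1r ler_pM// ?(ltW a0)//.
  by rewrite -intr_norm -[1]/(1%:~R) ler_int.
rewrite /conj (le_trans (Hf_stable j1 z1 _ _))//.
- rewrite /vorb dist_tr subrr normr0 invr_ge0; lra.
- by rewrite /vorb dist_tr.
rewrite dist_tr distrC (le_trans (ler_wpM2l _ jd))//.
  exact: le_trans (lipH_ge1 _).
apply: (le_trans (lipH_half n)); rewrite ler_pdivrMr; last by lra.
by rewrite ler_peMr ?exprn_ge0//; lra.
Qed.

(** Real points lie in every strip, so here the bound is global. This is what lets [conjR_close]
    treat an arbitrary multiple [j] of the angle, that is, iterates. *)
Lemma HfR_lip n x y : distR (Hf bR phiR n x) (Hf bR phiR n y) <= lipH n * distR x y.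
Proof.
elim: n x y => [|n ih] x y /=; first by rewrite mul1r.
rewrite (le_trans (ih _ _))// -mulrA ler_wpM2l//; first exact: le_trans (lipH_ge1 n).
rewrite -!distC_emb -!hf_emb; apply: hf_lip; apply: strip_emb.
  by have := width_ge0 n.+1; lra.
by have := width_ge0 n.+1; lra.
Qed.

Lemma conjR_close n j x :
  distR (conj bR phiR n.+1 (j%:~R * alpha n.+2) x)
        (conj bR phiR n (j%:~R * alpha n.+1) x) <= `|j%:~R| / Q n.+1 * (1 / 2) ^+ n.+1.
Proof.
rewrite -(@conj_step _ bR phiR n _ x); last by move=> t; rewrite phiR_period.
rewrite /conj (le_trans (HfR_lip _ _ _))//.
rewrite -distC_emb -!tr_emb dist_tr -mulrBr normrM.
have /andP[a0 a1] := alpha_step n.+1; rewrite (gtr0_norm a0) mulrCA -mulrA ler_wpM2l//.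
rewrite mulrC [leRHS]mulrC; apply: le_trans (lipH_half n).
by rewrite mulrC ler_wpM2l// (le_trans _ (lipH_ge1 _)).
Qed.

End AbC.

(** * Analyticity of uniform limits *)

Lemma differentiable_bound (K : numFieldType) (V W : normedModType K) (f : V -> W)
    (L : {linear V -> W}) (x : V) : continuous L ->
  (forall e, 0 < e -> exists2 d, 0 < d &
     forall h, `|h| < d -> `|f (h + x) - f x - L h| <= e * `|h|) ->
  differentiable f x.
Proof.
move=> cL h; have o : f \o shift x = cst (f x) + L +o_ 0 id.
  apply/eqaddoP => e e0; have [d d0 hd] := h e e0.
  have nd : \forall y \near (0 : V), `|y| < d.
    by apply/nbhs_normP; exists d => // y; rewrite /ball_/= sub0r normrN.
  near=> y; rewrite -[X in `|X|]/(f (y + x) - (f x + L y)) opprD addrA.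
  by apply: hd; near: y; exact: nd.
by have dE := diff_unique cL o; apply/diff_locallyP; rewrite dE.
Unshelve. all: by end_near. Qed.

Section Analytic.
Variable R : realType.
Local Notation V := (R[i]^o * R[i]^o)%type.

Lemma approx_continuous z0 (F : R[i] * R[i] -> R[i]) : approximable z0 F ->
  forall e : R, 0 < e -> exists2 d : R, 0 < d & forall z : R[i] * R[i],
    nc (z.1 - z0.1) <= d -> nc (z.2 - z0.2) <= d -> nc (F z - F z0) <= e.
Proof.
move=> hF e e0; have [a [M [aM hM]]] := approx_series hF.
have M0 : 0 <= M := le_trans (nc_ge0 _) (aM 0%N 0%N).
(* The remainder estimate with [h = 0] and [N = 1] identifies the constant term. *)
have a00 : F z0 = a 0%N 0%N.
  have h0 : ((0 : R) <= 0) && ((0 : R) <= 1 / 4) by apply/andP; split; lra.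
  have := @hM 1%N 0 0 0 h0; rewrite nc0 => /(_ (lexx _) (lexx _)).
  rewrite !addr0 -surjective_pairing /hsum !big_ord1 !expr0 !mulr1 mulr0 expr1 mulr0.
  move=> h; apply/eqP; rewrite -subr_eq0; apply/eqP/ComplexField.Normc.eq0_normc/eqP.
  by rewrite eq_le h nc_ge0.
have K0 : 0 < 2 * M + 1 by lra.
pose d := Num.min (1 / 4) (e / (2 * M + 1)).
have d0 : 0 < d by rewrite lt_min divr_gt0 ?divr_gt0//.
have d4 : d <= 1 / 4 by rewrite ge_min lexx.
have de : d * (2 * M + 1) <= e by rewrite -ler_pdivlMr// ge_min lexx orbT.
exists d => // z z1 z2; have h0 : 0 <= d <= 1 / 4 by rewrite (ltW d0).
have := @hM 1%N d _ _ h0 z1 z2.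
rewrite !subrKC -surjective_pairing /hsum !big_ord1 !expr0 !mulr1 -a00 expr1.
move=> h; apply: (le_trans h); nra.
Qed.

(** [F] is real at real points, so the real parts of its Taylor coefficients already sum to [f]. On
    the radius 1/4 the terms of degree n add up to at most M (1/2)^n in absolute value. *)
Lemma approx_real_analytic (F : R[i] * R[i] -> R[i]) (f : R * R -> R) (p : R * R) :
  approximable (p.1%:C, p.2%:C) F -> (forall x : R * R, F (x.1%:C, x.2%:C) = (f x)%:C) ->
  real_analytic_at f p.
Proof.
move=> hF Ff; have [a [M [aM hM]]] := approx_series hF.
have M0 : 0 <= M := le_trans (nc_ge0 _) (aM 0%N 0%N).
have h4 : ((0 : R) <= 1 / 4) && ((1 / 4 : R) <= 1 / 4) by apply/andP; split; lra.
exists (1 / 4), (fun i j => Re (a i j)); split; first by lra.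
move=> x x1 x2; set u := x.1 - p.1 in x1 *; set v := x.2 - p.2 in x2 * => t.
have tE i j : t i j = Re (a i j * u%:C ^+ i * v%:C ^+ j).
  have -> : a i j * u%:C ^+ i * v%:C ^+ j = (u ^+ i * v ^+ j)%:C * a i j.
    by rewrite rmorphM !rmorphXn/=; ring.
  by rewrite ReMr /t; ring.
have tb n (i : 'I_n.+1) : `|t i (n - i)%N| <= M * (1 / 4) ^+ n.
  rewrite /t !normrM !normrX -mulrA ler_pM ?mulr_ge0 ?exprn_ge0 ?normr_ge0//.
    exact: le_trans (nc_ge_Re _) (aM _ _).
  have im : (i <= n)%N by rewrite -ltnS.
  rewrite -[X in _ <= _ ^+ X](subnKC im) exprD ler_pM ?exprn_ge0//.
    by rewrite lerXn2r ?nnegrE//; lra.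
  by rewrite lerXn2r ?nnegrE//; lra.
split.
  apply: (@series_le_cvg _ _ (geometric M (1 / 2))).
  - by move=> n; rewrite sumr_ge0.
  - by move=> n; rewrite /= mulr_ge0// exprn_ge0//; lra.
  - move=> n; apply: (@le_trans _ _ (\sum_(i < n.+1) M * (1 / 4) ^+ n)).
      by apply: ler_sum => i _; exact: tb.
    rewrite sumr_const card_ord -mulrnAr ler_wpM2l// -mulr_natl.
    have -> : (1 / 2 : R) ^+ n = 2 ^+ n * (1 / 4) ^+ n.
      by rewrite -exprMn; congr (_ ^+ n); field.
    by rewrite ler_wpM2r ?natr_le_exp2// exprn_ge0//; lra.
  - by apply: is_cvg_geometric_series; rewrite ger0_norm; lra.
apply/cvgrPdist_le => e e0.
have K0 : 0 < M + 1 by lra.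
have [N hN] := half_small (divr_gt0 e0 K0).
rewrite ler_pdivlMr// in hN.
near=> n.
have hn : (1 / 2 : R) ^+ n <= (1 / 2) ^+ N.
  rewrite ler_wiXn2l//; try lra.
  by near: n; exact: nbhs_infty_ge.
have := @hM n (1 / 4) u%:C v%:C h4; rewrite !ncR => /(_ (ltW x1) (ltW x2)).
rewrite [(_, _).1]/= [(_, _).2]/= -!rmorphD /u /v !subrKC (Ff x).
have -> : 2 * (1 / 4) = 1 / 2 :> R by field.
move=> h; apply: (le_trans _ (_ : M * (1 / 2) ^+ n <= e)); last first.
  apply: le_trans hN; have := half_gt0 R n; have := half_gt0 R N; nra.
apply: le_trans h; rewrite -/u -/v.
apply: le_trans (nc_ge_Re _); rewrite ReD ReN /= /hsum Re_sum /series/= big_mkord.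
rewrite le_eqVlt; apply/orP; left; apply/eqP; congr (`|_ - _|).
by apply: eq_bigr => k _; rewrite Re_sum; apply: eq_bigr => i _; rewrite tE.
Unshelve. all: by end_near. Qed.

Definition lin2 (a b : R[i]) (h : V) : R[i]^o := a * h.1 + b * h.2.

Lemma lin2_linear a b : linear (lin2 a b).
Proof. by move=> k x y; rewrite /lin2 /= /GRing.scale/=; ring. Qed.

HB.instance Definition _ a b :=
  GRing.isLinear.Build R[i] V R[i]^o _ (lin2 a b) (lin2_linear a b).

Lemma lin2_continuous a b : continuous (lin2 a b : V -> R[i]^o).
Proof.
move=> x; apply: cvgD; apply: cvgM; [exact: cvg_cst| |exact: cvg_cst|].
  exact: cvg_fst.
exact: cvg_snd.
Qed.

(** The norm of [V] is an element of [R[i]]; here it is replaced by the real number that it is. *)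
Lemma prod_norm_nc (h : V) : exists t : R,
  [/\ `|h| = t%:C, 0 <= t, nc h.1 <= t & nc h.2 <= t].
Proof.
have := lexx `|h|; rewrite {1}prod_normE num_ge_max => /andP[].
have : 0 <= `|h| by [].
have /complex_realP[t ->] : `|h| \is Num.real by rewrite normr_real.
rewrite ler0c => t0 h1 h2.
by exists t; split=> //; rewrite -lecR; [exact: h1|exact: h2].
Qed.

(** The derivative is given by the two coefficients of degree 1, since the remainder after two
    degrees is quadratic. *)
Lemma approx_differentiable (z0 : V) (F : R[i] * R[i] -> R[i]) :
  approximable z0 F -> differentiable (F : V -> R[i]^o) z0.
Proof.
move=> hF; have [a [M [aM hM]]] := approx_series hF.
have M0 : 0 <= M := le_trans (nc_ge0 _) (aM 0%N 0%N).
have key (h : V) (t : R) : 0 <= t <= 1 / 4 -> nc h.1 <= t -> nc h.2 <= t ->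
    nc (F (h + z0) - F z0 - lin2 (a 1%N 0%N) (a 0%N 1%N) h) <= M * (2 * t) ^+ 2.
  move=> t4 h1 h2; have h0 : ((0 : R) <= 0) && ((0 : R) <= 1 / 4) by apply/andP; split; lra.
  have a00 : F z0 = a 0%N 0%N.
    have := @hM 1%N 0 0 0 h0; rewrite nc0 => /(_ (lexx _) (lexx _)).
    rewrite !addr0 -surjective_pairing /hsum !big_ord1 !expr0 !mulr1 mulr0 expr1 mulr0.
    move=> h'; apply/eqP; rewrite -subr_eq0; apply/eqP/ComplexField.Normc.eq0_normc/eqP.
    by rewrite eq_le h' nc_ge0.
  have := @hM 2%N t h.1 h.2 t4 h1 h2; apply: le_trans.
  rewrite le_eqVlt; apply/orP; left; apply/eqP; congr nc.
  have -> : h + z0 = (z0.1 + h.1, z0.2 + h.2) by rewrite addrC.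
  rewrite /hsum !big_ord_recl !big_ord0 /= /lin2 a00 /bump/= subn0 subnn !expr0 !expr1.
  rewrite -[(1 + 0 - 0)%N]/1%N -[(1 + 0)%N]/1%N; move: (F _) => w.
  by ring.
apply: (@differentiable_bound _ _ _ (F : V -> R[i]^o) (lin2 (a 1%N 0%N) (a 0%N 1%N))).
  exact: lin2_continuous.
move=> e e0.
  have /complex_realP[r er] : e \is Num.real by apply: gtr0_real.
  rewrite er; rewrite er ltcR in e0 *.
  have K0 : 0 < 4 * M + 1 by lra.
  (* Chosen so that the remainder M (2 t)^2 is at most r t for t < d. *)
  pose d := Num.min (1 / 4) (r / (4 * M + 1)).
  have d0 : 0 < d by rewrite lt_min divr_gt0 ?divr_gt0//.
  have d4 : d <= 1 / 4 by rewrite ge_min lexx.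
  have de : d * (4 * M + 1) <= r by rewrite -ler_pdivlMr// ge_min lexx orbT.
  have d0c : 0 < d%:C by rewrite ltcR.
exists d%:C => // h hd; have [t [ht t0 h1 h2]] := prod_norm_nc h.
  have td : t < d by rewrite -ltcR -ht.
  rewrite ht -[X in X <= _]/((nc _)%:C) -rmorphM lecR.
  have t4 : 0 <= t <= 1 / 4 by rewrite t0/=; lra.
apply: le_trans (key h t t4 h1 h2) _.
have Mt : 4 * M * t <= r by nra.
by have := ler_wpM2l t0 Mt; rewrite expr2; lra.
Qed.

End Analytic.

(** * The limit diffeomorphism *)

Section ApproxPairs.
Variables (R : realType) (q : nat -> nat).
Local Notation C := R[i].

Definition approx_pair (z0 : C * C) (G : C * C -> C * C) :=
  approximable z0 (fun z => (G z).1) /\ approximable z0 (fun z => (G z).2).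

Lemma approx_pair_id z0 : approx_pair z0 id.
Proof. by split; [exact: approx_fst|exact: approx_snd]. Qed.

Lemma approxZ z0 (c : C) f : approximable z0 f -> approximable z0 (fun z => c * f z).
Proof. by move=> h; apply: approxM => //; exact: approx_cst. Qed.

Lemma approxN z0 (f : C * C -> C) : approximable z0 f -> approximable z0 (fun z => - f z).
Proof. by move=> h; apply: approx_ext (approxZ (- 1) h) => z; rewrite mulN1r. Qed.

Lemma approx_phi z0 n (f : C * C -> C) : approximable z0 f ->
  approximable z0 (fun z => phiC q n (f z)).
Proof. by move=> h; apply: approxZ; apply: approx_cos; exact: approxZ. Qed.

Lemma approx_hf z0 n G : approx_pair z0 G ->
  approx_pair z0 (fun z => hf (bC R q) (phiC q) n (G z)).
Proof.
move=> [h1 h2]; have h3 := approxD h2 (approx_phi n h1).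
by split=> //; apply: approxD => //; exact: approxZ.
Qed.

Lemma approx_hb z0 n G : approx_pair z0 G ->
  approx_pair z0 (fun z => hb (bC R q) (phiC q) n (G z)).
Proof.
move=> [h1 h2]; have h3 := approxD h1 (approxN (approxZ (bC R q n) h2)).
by split=> //; apply: approxD => //; apply: approxN; exact: approx_phi.
Qed.

Lemma approx_Hf z0 n G : approx_pair z0 G ->
  approx_pair z0 (fun z => Hf (bC R q) (phiC q) n (G z)).
Proof. by elim: n G => //= n ih G hG; apply: ih; exact: approx_hf. Qed.

Lemma approx_Hb z0 n G : approx_pair z0 G ->
  approx_pair z0 (fun z => Hb (bC R q) (phiC q) n (G z)).
Proof. by move=> hG; elim: n => //= n ih; exact: approx_hb. Qed.

Lemma approx_conj z0 n (t : C) : approx_pair z0 (conj (bC R q) (phiC q) n t).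
Proof.
apply: (@approx_Hf _ _ (fun z => tr t (Hb (bC R q) (phiC q) n z))).
have [h1 h2] := approx_Hb n (approx_pair_id z0).
by split=> //; apply: approxD => //; exact: approx_cst.
Qed.

End ApproxPairs.

(** * Convergence, inverse and equivariance of the limit map *)

Section Limit.
Variables (R : realType) (q : nat -> nat).
Hypothesis q_gt1 : forall n, (0 < n)%N -> (1 < q n)%N.
Hypothesis q_growth : growth R q.
Implicit Types (x y : R * R) (z w : R[i] * R[i]) (n : nat) (j : int).

Local Notation Q n := ((q n)%:R : R).
Local Notation al n := (alpha R q n).
Local Notation cR := (conj (bR R q) (phiR q)).
Local Notation cC := (conj (bC R q) (phiC q)).
Local Notation d2 := (@distR R).

(** [j = 1] gives the diffeomorphism and [j = -1] its inverse, so that one convergence proof serves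
    both. *)
Definition flimC j z : R[i] * R[i] :=
  (limC (fun n => (cC n (j%:~R * al n.+1)%:C z).1),
   limC (fun n => (cC n (j%:~R * al n.+1)%:C z).2)).

Lemma flimC_close n j z : `|j| <= 1 -> strip_le (Q 1) z ->
  distC (cC n (j%:~R * al n.+1)%:C z) (flimC j z) <= 8 * (1 / 2) ^+ n.
Proof.
move=> j1 z1; have step k := conjC_close q_gt1 q_growth k j1 z1.
have half k : (1 / 2 : R) ^+ k.+1 <= (1 / 2) ^+ k.
  by rewrite exprS; have := half_gt0 R k; lra.
have h1 : nc ((cC n (j%:~R * al n.+1)%:C z).1 - (flimC j z).1) <= 4 * (1 / 2) ^+ n.
  apply: (@climit R (fun k => (cC k (j%:~R * al k.+1)%:C z).1)) => k.
  apply: le_trans (half k); apply: le_trans (step k).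
  by rewrite /distC lerDl nc_ge0.
have h2 : nc ((cC n (j%:~R * al n.+1)%:C z).2 - (flimC j z).2) <= 4 * (1 / 2) ^+ n.
  apply: (@climit R (fun k => (cC k (j%:~R * al k.+1)%:C z).2)) => k.
  apply: le_trans (half k); apply: le_trans (step k).
  by rewrite /distC lerDr nc_ge0.
by rewrite /distC; lra.
Qed.

Definition flim j x : R * R := (Re (flimC j (emb x)).1, Re (flimC j (emb x)).2).

Lemma flimC_real j x : `|j| <= 1 -> flimC j (emb x) = emb (flim j x).
Proof.
move=> j1.
suff [h1 h2] : Im (flimC j (emb x)).1 = 0 /\ Im (flimC j (emb x)).2 = 0.
  by rewrite /flim; move: h1 h2; case: (flimC j (emb x)) => [[a b] [c d]] /= -> ->.
have z1 : strip_le (Q 1) (emb x) by apply: strip_emb.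
suff small e : 0 < e -> `|Im (flimC j (emb x)).1| <= e /\ `|Im (flimC j (emb x)).2| <= e.
  split; apply/eqP; rewrite -normr_le0; apply/ler_addgt0Pr => e e0; rewrite add0r.
    by have [] := small e e0.
  by have [] := small e e0.
move=> e0; have [n hn] := half_smallM (ltr0Sn R 7) e0.
have := flimC_close n j1 z1; rewrite conj_emb /distC.
move: (flimC j (emb x)) (cR n _ x) => w u h.
have t1 := nc_ge_Im ((emb u).1 - w.1); have t2 := nc_ge_Im ((emb u).2 - w.2).
rewrite !ImD !ImN /= !add0r !normrN in t1 t2.
have := nc_ge0 ((emb u).1 - w.1); have := nc_ge0 ((emb u).2 - w.2).
by move=> a b; split; lra.
Qed.

Lemma flim_close n j x : `|j| <= 1 ->
  d2 (cR n (j%:~R * al n.+1) x) (flim j x) <= 8 * (1 / 2) ^+ n.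
Proof.
move=> j1; rewrite -distC_emb -conj_emb -flimC_real//.
by apply: flimC_close => //; exact: strip_emb.
Qed.

(** The margin 1 in [rho + 1 <= Q 1] places the unit polydisc around a point of the strip of
    half-width [rho] inside the strip where convergence is uniform. *)
Lemma approx_flimC j z0 (rho : R) : `|j| <= 1 -> rho + 1 <= Q 1 -> strip_le rho z0 ->
  approx_pair z0 (flimC j).
Proof.
move=> j1 hr sz0.
have sz z : disc z0 z -> strip_le (Q 1) z.
  move=> [h1 h2]; apply: strip_weak hr _.
  have t1 := nc_ge_Im (z.1 - z0.1); have t2 := nc_ge_Im (z.2 - z0.2).
  rewrite !ImD !ImN in t1 t2; case: sz0 => s1 s2.
  have u1 := ler_normD (Im z.1 - Im z0.1) (Im z0.1); rewrite subrK in u1.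
  have u2 := ler_normD (Im z.2 - Im z0.2) (Im z0.2); rewrite subrK in u2.
  by split; lra.
split; apply: approx_unif => e e0;
  have [n hn] := half_smallM (ltr0Sn R 7) e0.
  exists (fun z => (cC n (j%:~R * al n.+1)%:C z).1).
    by have [] := approx_conj q z0 n (j%:~R * al n.+1)%:C.
  move=> z /sz zs; have := flimC_close n j1 zs; rewrite ncBC /distC.
  by have := nc_ge0 ((cC n (j%:~R * al n.+1)%:C z).2 - (flimC j z).2); lra.
exists (fun z => (cC n (j%:~R * al n.+1)%:C z).2).
  by have [] := approx_conj q z0 n (j%:~R * al n.+1)%:C.
move=> z /sz zs; have := flimC_close n j1 zs; rewrite ncBC /distC.
by have := nc_ge0 ((cC n (j%:~R * al n.+1)%:C z).1 - (flimC j z).1); lra.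
Qed.

Lemma approx_flim_emb j x : `|j| <= 1 -> approx_pair (emb x) (flimC j).
Proof.
move=> j1; apply: (@approx_flimC _ _ 0) => //; last exact: strip_emb.
by rewrite add0r; have := @Q_ge2 R _ q_gt1 1%N isT; lra.
Qed.

Lemma distR_le0 x y : (forall e, 0 < e -> d2 x y <= e) -> x = y.
Proof.
move=> h; have /eqP : d2 x y = 0.
  apply/eqP; rewrite eq_le distR_ge0 andbT; apply/ler_addgt0Pr => e e0.
  by rewrite add0r h.
rewrite /distR paddr_eq0// !normr_eq0 !subr_eq0 => /andP[/eqP h1 /eqP h2].
by rewrite (surjective_pairing x) h1 h2 -surjective_pairing.
Qed.

Lemma flim_continuous j x e : `|j| <= 1 -> 0 < e ->
  exists2 d : R, 0 < d & forall y, d2 x y <= d -> d2 (flim j x) (flim j y) <= e.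
Proof.
move=> j1 e0; have [a1 a2] := approx_flim_emb x j1.
have e2 : 0 < e / 2 by lra.
have [d1 d10 h1] := approx_continuous a1 e2.
have [d2' d20 h2] := approx_continuous a2 e2.
exists (Num.min d1 d2'); first by rewrite lt_min d10.
move=> y; rewrite le_min => /andP[]; rewrite /distR => u1 u2.
have p1 := normr_ge0 (x.1 - y.1); have p2 := normr_ge0 (x.2 - y.2).
have := h1 (emb y); have := h2 (emb y); rewrite !ncRB !(distrC y.1) !(distrC y.2).
rewrite !flimC_real// !ncRB => k2 k1.
rewrite (distrC (flim j x).1) (distrC (flim j x).2).
have {}k1 := k1 _ _; have {}k2 := k2 _ _.
suff : `|(flim j y).1 - (flim j x).1| <= e / 2 /\ `|(flim j y).2 - (flim j x).2| <= e / 2.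
  by lra.
by split; [apply: k1|apply: k2]; lra.
Qed.

(** No rate is asked for: with [m] fixed, this only serves to pass to the limit at the end of the
    telescoping in [iter_flim_close], from which the rate comes. *)
Lemma iter_flim_cvg (j : int) m x : `|j| <= 1 -> forall e, 0 < e ->
  exists N, forall n, (N <= n)%N ->
    d2 (cR n ((j%:~R * al n.+1) *+ m) x) (iter m (flim j) x) <= e.
Proof.
move=> j1; elim: m => [|m ih] e e0.
  exists 0%N => n _; rewrite mulr0n conj0 /=.
  by rewrite /distR !subrr normr0 addr0 ltW.
have e2 : 0 < e / 2 by lra.
have [d d0 hd] := flim_continuous (iter m (flim j) x) j1 e2.
have [N hN] := ih d d0.
have [M hM] := half_smallM (ltr0Sn R 7) e2.
exists (maxn N M) => n; rewrite geq_max => /andP[Nn Mn].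
rewrite mulrSr -conjD -/(iter _ _ _).
apply: (le_trans (distR_tri _ (flim j (cR n ((j%:~R * al n.+1) *+ m) x)) _)).
have h1 := flim_close n (cR n ((j%:~R * al n.+1) *+ m) x) j1.
have h2 : d2 (flim j (cR n ((j%:~R * al n.+1) *+ m) x)) (iter m.+1 (flim j) x) <= e / 2.
  by rewrite distRC iterS; apply: hd; rewrite distRC; exact: hN.
have : (1 / 2 : R) ^+ n <= (1 / 2) ^+ M by rewrite ler_wiXn2l//; lra.
by lra.
Qed.

(** The approximants for [j] and [- j] are exact inverses, both converge uniformly on real points,
    and [flim (- j)] is continuous at [flim j x]. *)
Lemma flimK j x : `|j| <= 1 -> flim (- j) (flim j x) = x.
Proof.
move=> j1; have jN1 : `|- j| <= 1 by rewrite normrN.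
apply: distR_le0 => e e0; have e2 : 0 < e / 2 by lra.
have [d d0 hd] := flim_continuous (flim j x) jN1 e2.
have m0 : 0 < Num.min d (e / 2) by rewrite lt_min d0.
have [n hn] := half_smallM (ltr0Sn R 7) m0.
move: hn; rewrite le_min => /andP[hn1 hn2].
set y := cR n (j%:~R * al n.+1) x.
apply: (le_trans (distR_tri _ (flim (- j) y) _)).
have h1 : d2 (flim (- j) (flim j x)) (flim (- j) y) <= e / 2.
  by apply: hd; rewrite distRC (le_trans (flim_close n x j1)).
have h2 : d2 (flim (- j) y) x <= e / 2.
  have E : cR n ((- j)%:~R * al n.+1) y = x by rewrite /y mulrNz mulNr conjK.
  by rewrite distRC -[X in d2 X _]E; exact: le_trans (flim_close n y jN1) hn2.
by lra.
Qed.

(* m <= q_{N+1} bounds all the later steps of the telescoping by powers of 1/2. *)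
Lemma iter_flim_close m N x : (m <= q N.+1)%N ->
  d2 (cR N (al N.+1 *+ m) x) (iter m (flim 1) x) <= 2 * (1 / 2) ^+ N.
Proof.
move=> mq; apply/ler_addgt0Pr => e e0.
have [K hK] := @iter_flim_cvg 1 m x (lexx _) e e0.
pose c k := cR k (al k.+1 *+ m) x.
have h1 : d2 (c N) (c (maxn N K)) <= 2 * (1 / 2) ^+ N.
  apply: (@chain_le R (fun i k => d2 (c i) (c k))).
  - by move=> i; rewrite /distR !subrr normr0 addr0.
  - by move=> i k l; exact: distR_tri.
  - move=> i Ni; rewrite distRC /c.
    have := @conjR_close R q q_gt1 q_growth i (Posz m) x.
    rewrite -!pmulrn ![m%:R * _]mulr_natl => h.
    apply: (le_trans h).
    apply: (@le_trans _ _ ((1 / 2) ^+ i.+1)); last by rewrite exprS; have := half_gt0 R i; lra.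
    apply: ler_piMl; first exact/ltW/half_gt0.
    rewrite normr_nat ler_pdivrMr; last first.
      by have := @Q_ge2 R _ q_gt1 i.+1 isT; lra.
    rewrite mul1r (le_trans (_ : _ <= Q N.+1)) ?ler_nat//.
    by rewrite -(ler_nat R); apply: Q_le => //.
  - exact: leq_maxl.
have h2 := hK _ (leq_maxr N K); rewrite !mul1r in h2.
by rewrite (le_trans (distR_tri _ (c (maxn N K)) _))// lerD.
Qed.

(** Commutation with the integer translations: such maps descend to the torus, with a displacement
    that is periodic. *)
Definition Z2eq (f : R * R -> R * R) := forall x (k l : int),
  f (x.1 + k%:~R, x.2 + l%:~R) = ((f x).1 + k%:~R, (f x).2 + l%:~R).

(** A shear alone is not equivariant: it acts on the integer translations by (k, l) -> (k + q_n l,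
    l). Its inverse undoes this, hence a conjugate of an equivariant map is equivariant. *)
Lemma hf_Z2 n x (k l : int) : hf (bR R q) (phiR q) n (x.1 + k%:~R, x.2 + l%:~R) =
  ((hf (bR R q) (phiR q) n x).1 + (k + Posz (q n) * l)%:~R,
   (hf (bR R q) (phiR q) n x).2 + l%:~R).
Proof.
by rewrite /hf/= phiR_int /bR intrD intrM -pmulrn; congr pair; ring.
Qed.

Lemma hb_Z2 n x (k l : int) : hb (bR R q) (phiR q) n (x.1 + k%:~R, x.2 + l%:~R) =
  ((hb (bR R q) (phiR q) n x).1 + (k - Posz (q n) * l)%:~R,
   (hb (bR R q) (phiR q) n x).2 + l%:~R).
Proof.
rewrite /hb/= /bR.
have -> : x.1 + k%:~R - Q n * (x.2 + l%:~R) = x.1 - Q n * x.2 + (k - Posz (q n) * l)%:~R.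
  by rewrite intrD mulrNz intrM -pmulrn; ring.
by rewrite phiR_int; congr pair; ring.
Qed.

Lemma Hf_Z2eq n P : Z2eq P ->
  Z2eq (fun x => Hf (bR R q) (phiR q) n (P (Hb (bR R q) (phiR q) n x))).
Proof.
elim: n P => //= n ih P hP.
apply: (ih (fun x => hf (bR R q) (phiR q) n.+1 (P (hb (bR R q) (phiR q) n.+1 x)))).
move=> x k l; rewrite hb_Z2 hP hf_Z2; congr (_ + _, _).
by congr (_%:~R); lia.
Qed.

Lemma conj_Z2eq n t : Z2eq (cR n t).
Proof.
apply: (@Hf_Z2eq n (tr t)) => x k l.
by rewrite /tr/= addrAC.
Qed.

Lemma distR_shift x y (s t : R) :
  d2 (x.1 + s, x.2 + t) (y.1 + s, y.2 + t) = d2 x y.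
Proof.
by rewrite /distR/= !opprD ![_ + _ + (- _ - _)]addrACA !subrr !addr0.
Qed.

Lemma flim_Z2eq j : `|j| <= 1 -> Z2eq (flim j).
Proof.
move=> j1 x k l; apply: distR_le0 => e e0.
have [n hn] := half_smallM (ltr0Sn R 15) e0.
set xk := (_, _); set y := cR n (j%:~R * al n.+1) x.
apply: (le_trans (distR_tri _ (cR n (j%:~R * al n.+1) xk) _)).
have h1 := flim_close n xk j1; rewrite distRC in h1.
have h2 : d2 (cR n (j%:~R * al n.+1) xk) ((flim j x).1 + k%:~R, (flim j x).2 + l%:~R) <=
    8 * (1 / 2) ^+ n.
  by rewrite /xk conj_Z2eq distR_shift; exact: flim_close.
by lra.
Qed.

End Limit.

Local Open Scope quotient_scope.

(** * Torus maps induced by equivariant maps of the plane *)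

Section Torus.
Variable R : realType.
Implicit Types (x y : R * R) (p : torus R).
Local Notation toT := (@toT R).

Lemma toTP x y : toT x = toT y <->
  exists k l : int, y = (x.1 + k%:~R, x.2 + l%:~R).
Proof.
have h : toT x = toT y <-> same_mod_Z2 x y.
  by split=> [/eqmodP|h]; last apply/eqmodP.
rewrite h /same_mod_Z2; split=> [/andP[/intrP[k hk] /intrP[l hl]]|[k [l ->]]].
  exists (- k), (- l); rewrite !mulrNz -hk -hl (surjective_pairing y).
  by rewrite /= !opprB !subrKC.
by rewrite /= !opprD !addNKr -!mulrNz !intr_int.
Qed.

Lemma toT_repr p : toT (repr p) = p.
Proof. exact: reprK. Qed.

Lemma toT_Z2 x (k l : int) : toT (x.1 + k%:~R, x.2 + l%:~R) = toT x.
Proof. by apply/esym/toTP; exists k, l. Qed.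

Definition tmap (F : R * R -> R * R) p := toT (F (repr p)).

Lemma tmapE F x : Z2eq F -> tmap F (toT x) = toT (F x).
Proof.
move=> hF; rewrite /tmap; have := toT_repr (toT x).
by move: (repr _) => y /toTP[k [l ->]]; rewrite hF toT_Z2.
Qed.

Lemma iter_tmap F m x : Z2eq F -> iter m (tmap F) (toT x) = toT (iter m F x).
Proof. by move=> hF; elim: m => //= m ->; rewrite tmapE. Qed.

Lemma toT_continuous : continuous toT.
Proof. exact: pi_continuous. Qed.

(** The saturation of an open set is the union of its integer translates. *)
Lemma toT_open x (V : set (R * R)) : nbhs x V -> nbhs (toT x) (toT @` V).
Proof.
rewrite !nbhsE => -[U [oU Ux] UV]; exists (toT @` U); last by apply: image_subset.
split; last by exists x.
rewrite /open/= /quotient_open.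
have -> : \pi_(quotient_topology _) @^-1` (toT @` U) =
    \bigcup_(kl in [set: int * int]) [set y : R * R | U (y.1 + kl.1%:~R, y.2 + kl.2%:~R)].
  apply/seteqP; split=> [y [u Uu /esym/toTP[k [l uE]]]|y [[k l] _ /= Uy]].
    by exists (k, l) => //=; rewrite -uE.
  by exists (y.1 + k%:~R, y.2 + l%:~R) => //; exact: toT_Z2.
apply: bigcup_open => -[k l] _.
have /continuousP : continuous (fun y : R * R => (y.1 + k%:~R, y.2 + l%:~R)).
  move=> y.
  have h1 : {for y, continuous (fun y : R * R => y.1 + k%:~R)}.
    by apply: cvgD; [exact: cvg_fst|exact: cvg_cst].
  have h2 : {for y, continuous (fun y : R * R => y.2 + l%:~R)}.
    by apply: cvgD; [exact: cvg_snd|exact: cvg_cst].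
  exact: cvg_pair h1 h2.
by apply.
Qed.

Lemma tmap_continuous F : Z2eq F -> continuous F -> continuous (tmap F).
Proof.
move=> hF cF p; rewrite -(toT_repr p); move: (repr p) => x.
move=> N; rewrite tmapE// => hN.
have h : nbhs x (F @^-1` (toT @^-1` N)) by apply: cF; exact: toT_continuous.
by apply: filterS (toT_open h) => _ [y /= hy <-]; rewrite /= tmapE.
Qed.

(** Linear interpolation in the plane between two equivariant maps is equivariant, so it descends to
    the torus. *)
Lemma homotopic_tmap F : Z2eq F -> continuous F -> homotopic (tmap F) id.
Proof.
move=> hF cF.
pose G (s : R) x := (s * x.1 + (1 - s) * (F x).1, s * x.2 + (1 - s) * (F x).2).
have hG s : Z2eq (G s).
  by move=> x k l; rewrite /G hF/=; congr pair; ring.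
exists (fun u : R * torus R => tmap (G u.1) u.2); split=> [|p|p].
- apply: continuous_subspaceT => -[s p]; rewrite -(toT_repr p); move: (repr p) => x.
  move=> N; rewrite /= tmapE// => hN.
  have cG : continuous (fun v : R * (R * R) => G v.1 v.2).
    move=> v; have cs : {for v, continuous (fun v : R * (R * R) => v.1)} by exact: cvg_fst.
    have c1 : {for v, continuous (fun v : R * (R * R) => v.2.1)}.
      apply: (@cvg_comp _ _ _ snd fst); [exact: cvg_snd|exact: cvg_fst].
    have c2 : {for v, continuous (fun v : R * (R * R) => v.2.2)}.
      apply: (@cvg_comp _ _ _ snd snd); [exact: cvg_snd|exact: cvg_snd].
    have cf : {for v, continuous (fun v : R * (R * R) => F v.2)}.
      apply: (@cvg_comp _ _ _ snd F); [exact: cvg_snd|exact: cF].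
    have cf1 : {for v, continuous (fun v : R * (R * R) => (F v.2).1)}.
      by apply: (@cvg_comp _ _ _ (fun v : R * (R * R) => F v.2) fst); [exact: cf|exact: cvg_fst].
    have cf2 : {for v, continuous (fun v : R * (R * R) => (F v.2).2)}.
      by apply: (@cvg_comp _ _ _ (fun v : R * (R * R) => F v.2) snd); [exact: cf|exact: cvg_snd].
    have c1s : {for v, continuous (fun v : R * (R * R) => 1 - v.1)}.
      by apply: cvgB; [exact: cvg_cst|exact: cs].
    have g1 : {for v, continuous (fun v : R * (R * R) => v.1 * v.2.1 + (1 - v.1) * (F v.2).1)}.
      by apply: cvgD; apply: cvgM.
    have g2 : {for v, continuous (fun v : R * (R * R) => v.1 * v.2.2 + (1 - v.1) * (F v.2).2)}.
      by apply: cvgD; apply: cvgM.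
    exact: cvg_pair g1 g2.
  have h : nbhs (s, x) ((fun v : R * (R * R) => G v.1 v.2) @^-1` (toT @^-1` N)).
    by apply: cG; exact: toT_continuous.
  case: h => -[A B] /= [hA hB] AB.
  exists (A, toT @` B) => /=; first by split=> //; exact: toT_open.
  move=> [t _] /= [At [y By <-]]; rewrite /= tmapE//.
  by have := AB (t, y); apply.
- by rewrite /= /tmap /G !mul0r !add0r subr0 !mul1r -surjective_pairing.
- by rewrite /= /tmap /G !mul1r subrr !mul0r !addr0 -surjective_pairing toT_repr.
Qed.

End Torus.

(** * The limit map is a diffeomorphism of the required class *)

Section DiffOmega.
Variables (R : realType) (q : nat -> nat) (rho : R).
Hypothesis rho_gt0 : 0 < rho.
Hypothesis q_gt1 : forall n, (0 < n)%N -> (1 < q n)%N.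
Hypothesis q1 : rho + 1 <= (q 1%N)%:R.
Hypothesis q_growth : growth R q.
Local Notation flim := (@flim R q).
Local Notation flimC := (@flimC R q).

Lemma distR_norm (x y : R * R) : distR x y <= 2 * `|x - y|.
Proof.
rewrite /distR prod_normE mulr_natl mulr2n lerD// le_max lexx ?orbT//.
Qed.

Lemma norm_distR (x y : R * R) : `|x - y| <= distR x y.
Proof. by rewrite /distR prod_normE ge_max/= lerDl lerDr !normr_ge0. Qed.

Lemma flim_cont j : `|j| <= 1 -> continuous (flim j).
Proof.
move=> j1 x; apply/cvgrPdist_le => e e0.
have [d d0 hd] := flim_continuous q_gt1 q_growth x j1 e0.
have d2 : 0 < d / 2 by lra.
near=> y; apply: (le_trans (norm_distR _ _)); apply: hd.
apply: (le_trans (distR_norm _ _)).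
suff : `|x - y| <= d / 2 by lra.
by near: y; apply: cvgr_dist_le.
Unshelve. all: by end_near. Qed.

Lemma flim_real_analytic j x : `|j| <= 1 ->
  real_analytic_at (fun y => (flim j y).1) x /\ real_analytic_at (fun y => (flim j y).2) x.
Proof.
move=> j1; have [a1 a2] := approx_flim_emb q_gt1 q_growth x j1.
split; [apply: approx_real_analytic a1 _|apply: approx_real_analytic a2 _] => y;
  by rewrite -/(emb y) flimC_real.
Qed.

Lemma flim_torus_analytic j : `|j| <= 1 -> torus_analytic (tmap (flim j)).
Proof.
move=> j1 p; exists (flim j); have [h1 h2] := flim_real_analytic p j1; split=> //.
exists (setT, setT) => [|x _]; first by split; exact: filterT.
by rewrite /= tmapE//; exact: flim_Z2eq.
Qed.

Lemma tmap_flimK j : `|j| <= 1 -> cancel (tmap (flim j)) (tmap (flim (- j))).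
Proof.
move=> j1 p; rewrite -{1}(toT_repr p) !tmapE ?flimK ?toT_repr//.
all: by apply: flim_Z2eq => //; rewrite normrN.
Qed.

(** A pair of projections treats both coordinates of the displacement at once. The displacement is
    bounded on the strip because the limit is within 8 of its approximant of index 0, the rotation
    by [alpha 1]. *)
Lemma flim_C_omega (pr1 : R[i] * R[i] -> R[i]) (pr2 : R * R -> R) :
  (pr1 = fst /\ pr2 = fst) \/ (pr1 = snd /\ pr2 = snd) ->
  C_omega rho (fun x => pr2 (flim 1 x) - pr2 x).
Proof.
move=> pr; have j1 : `|1%:Z| <= 1 by [].
have pr_emb x : pr1 (emb x) = (pr2 x)%:C by case: pr => -[-> ->].
pose G z := pr1 (flimC 1 z) - pr1 z.
have Gemb x : G (emb x) = (pr2 (flim 1 x) - pr2 x)%:C.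
  by rewrite /G flimC_real// !pr_emb rmorphB.
have Gapp z : strip_le rho z -> approximable z G.
  move=> sz; have [a1 a2] := approx_flimC q_gt1 q_growth j1 q1 sz.
  by case: pr => -[h1 _]; rewrite /G h1; apply: approxD => //; apply: approxN;
    [exact: approx_fst|exact: approx_snd].
split.
- move=> p; apply: approx_real_analytic (Gapp (emb p) _) Gemb.
  by apply: strip_emb; exact: ltW.
- move=> x k l; rewrite flim_Z2eq//.
  by case: pr => -[_ ->] /=; ring.
- exists G; split; [|exact: Gemb|].
    by move=> z [z1 z2]; apply: approx_differentiable; apply: Gapp; split; exact: ltW.
  exists (8 + `|alpha R q 1|) => z [z1 z2].
  have sz : strip_le (q 1)%:R z.
    by apply: (@strip_weak _ rho); [apply: le_trans q1; rewrite lerDl|split; exact: ltW].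
  have := flimC_close q_gt1 q_growth 0 j1 sz; rewrite distCC expr0 mulr1 => h.
  have h2 : distC (conj (bC R q) (phiC q) 0 (1%:~R * alpha R q 1)%:C z) z <= `|alpha R q 1|.
    rewrite /conj/= mul1r -{2}(tr0 z) -[X in tr X z]/(0%:C) dist_tr subr0 lexx//.
  have h3 := le_trans (distC_tri _ _ _) (lerD h h2).
  rewrite -[X in X <= _]/((nc _)%:C) lecR; apply: le_trans h3.
  by case: pr => -[h1 _]; rewrite /G h1 /distC ?lerDl ?lerDr nc_ge0.
Qed.

Lemma flim_Diff_omega : Diff_omega rho (tmap (flim 1)).
Proof.
have j1 : `|1%:Z| <= 1 by []; have jN1 : `|(-1 : int)| <= 1 by [].
have hZ := flim_Z2eq q_gt1 q_growth j1.
split.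
- exists (tmap (flim (-1))); split.
  + exact: tmap_flimK j1.
  + by have := tmap_flimK jN1; rewrite opprK.
  + exact: flim_torus_analytic.
  + exact: flim_torus_analytic.
- by apply: homotopic_tmap => //; exact: flim_cont.
- exists (fun x => (flim 1 x).1 - x.1), (fun x => (flim 1 x).2 - x.2); split.
  + by apply: (@flim_C_omega fst fst); left.
  + by apply: (@flim_C_omega snd snd); right.
  + by move=> x; rewrite tmapE// !subrKC -surjective_pairing.
Qed.

End DiffOmega.

Local Close Scope quotient_scope.

(** * Means of periodic functions *)

Section Continuity.
Variables (R : realType) (T : topologicalType).
Implicit Types (f g : T -> R).

Lemma contD f g : continuous f -> continuous g -> continuous (fun z => f z + g z).
Proof. by move=> cf cg z; apply: cvgD; [exact: cf|exact: cg]. Qed.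

Lemma contN f : continuous f -> continuous (fun z => - f z).
Proof. by move=> cf z; apply: cvgN; exact: cf. Qed.

Lemma contM f g : continuous f -> continuous g -> continuous (fun z => f z * g z).
Proof. by move=> cf cg z; apply: cvgM; [exact: cf|exact: cg]. Qed.

Lemma cont_cst (c : R) : continuous (fun _ : T => c).
Proof. by move=> z; exact: cvg_cst. Qed.

Lemma cont_comp (h : R -> R) f : continuous h -> continuous f -> continuous (fun z => h (f z)).
Proof. by move=> ch cf z; apply: (@continuous_comp _ _ _ f h); [exact: cf|exact: ch]. Qed.

Lemma cont_comp2 (U : R * R -> R) f g : continuous U -> continuous f -> continuous g ->
  continuous (fun z => U (f z, g z)).
Proof.
move=> cU cf cg z; apply: (@continuous_comp _ _ _ (fun z => (f z, g z)) U); last exact: cU.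
exact: cvg_pair (cf z) (cg z).
Qed.

End Continuity.

Lemma cont_fst (R : realType) : continuous (fun z : R * R => z.1).
Proof. by move=> z; exact: cvg_fst. Qed.

Lemma cont_snd (R : realType) : continuous (fun z : R * R => z.2).
Proof. by move=> z; exact: cvg_snd. Qed.

Lemma cont_id (R : realType) : continuous (fun x : R => x).
Proof. by move=> z; exact: cvg_id. Qed.

(** Syntax-directed continuity; the clauses for partially applied operations catch eta-reduced
    bodies, and unrecognized goals are left over. *)
Ltac cont := try assumption; lazymatch goal with
  | |- forall z, continuous_at z (fun x => @?f x + @?g x) => refine (@contD _ _ f g _ _); cont
  | |- forall z, continuous_at z (fun x => - @?f x) => refine (@contN _ _ f _); cont
  | |- forall z, continuous_at z (fun x => @?f x * @?g x) => refine (@contM _ _ f g _ _); cont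
  | |- forall z, continuous_at z (+%R ?a) => refine (@contD _ _ (fun=> a) (fun x => x) _ _); cont
  | |- forall z, continuous_at z ( *%R ?a) => refine (@contM _ _ (fun=> a) (fun x => x) _ _); cont
  | |- forall z, continuous_at z fst => exact: cont_fst
  | |- forall z, continuous_at z snd => exact: cont_snd
  | |- forall z, continuous_at z (fun x => x) => exact: cont_id
  | |- forall z, continuous_at z (fun x => fst x) => exact: cont_fst
  | |- forall z, continuous_at z (fun x => snd x) => exact: cont_snd
  | |- forall z, continuous_at z (fun=> ?c) => exact: cont_cst
  | |- _ => idtac
  end.

Section Primitives.
Variable R : realType.
Implicit Types (f g F G : R -> R) (a b c x y : R).

Lemma is_derive_ext f g x (df dg : R) : (forall y, f y = g y) -> df = dg ->
  is_derive x 1 f df -> is_derive x 1 g dg.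
Proof. by move=> /funext <- <-. Qed.

Lemma is_derive_c c x : is_derive x 1 (fun=> c) 0.
Proof. exact: is_derive_cst. Qed.

Lemma is_derive_lin a b x : is_derive x 1 (fun y => a * y + b) a.
Proof.
apply: (@is_derive_ext ((a \*: id) + cst b) _ _ (a *: 1 + 0)) => //.
by rewrite addr0 /GRing.scale/= mulr1.
Qed.

Lemma is_derive_comp_lin F f a b x : (forall y, is_derive y 1 F (f y)) ->
  is_derive x 1 (fun y => F (a * y + b)) (f (a * x + b) * a).
Proof.
move=> h; apply: (@is_derive1_comp _ F (fun y => a * y + b)) => //.
exact: is_derive_lin.
Qed.

Lemma is_derive_mul f g x (df dg : R) : is_derive x 1 f df -> is_derive x 1 g dg ->
  is_derive x 1 (fun y => f y * g y) (df * g x + f x * dg).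
Proof.
move=> h1 h2; apply: (@is_derive_ext (f * g) _ _ (f x *: dg + g x *: df)) => //.
by rewrite /GRing.scale/= addrC (mulrC (g x)).
Qed.

Lemma is_derive_continuous f (df : R) x : is_derive x 1 f df -> {for x, continuous f}.
Proof. by move=> [h _]; exact/differentiable_continuous/derivable1_diffP. Qed.

Lemma deriv0_const f a x y : (forall z, a < z -> is_derive z 1 f 0) ->
  a < x -> a < y -> f x = f y.
Proof.
wlog xy : x y / x <= y.
  move=> h h0 ax ay; have [xy|/ltW yx] := leP x y; first exact: h.
  by apply/esym; exact: h.
move=> h ax ay.
have [||c _] := @MVT_segment R f (fun=> 0) x y xy.
- by move=> z; rewrite in_itv/= => /andP[xz _]; apply: h; exact: lt_trans xz.
- apply: continuous_in_subspaceT => z; rewrite inE/= in_itv/= => /andP[xz _].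
  by apply: is_derive_continuous (h z _); exact: lt_le_trans xz.
by rewrite mul0r => /eqP; rewrite subr_eq0 => /eqP.
Qed.

Lemma local_primitive f a : continuous f ->
  exists F, forall x, a < x -> is_derive x 1 F (f x).
Proof.
move=> cf; exists (fun x => \int[lebesgue_measure]_(t in `[a, x]) f t) => x ax.
have xu : x < x + 1 by rewrite ltrDl.
have [||h1 h2] := @continuous_FTC1_closed R f a x (x + 1) xu _ ax.
- apply: continuous_compact_integrable; first exact: segment_compact.
  exact: continuous_subspaceT.
- exact: cf.
by split; [exact: h1|rewrite -derive1E].
Qed.

(** An integral from a base point is a primitive only to the right of that point. The primitives on
    the half-lines (-n, oo), normalized to vanish at 0, agree where both are defined and glue
    together. *)
Lemma primitive f : continuous f -> exists F, forall x, is_derive x 1 F (f x).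
Proof.
move=> cf.
have /choice[P hP] : forall n : nat, exists F, forall x, - n%:R < x -> is_derive x 1 F (f x).
  by move=> n; exact: local_primitive.
pose k x := Num.bound `|x|.
have kx x : - (k x)%:R < x.
  have /ltr_normlP[h _] : `|x| < (k x)%:R by apply: le_lt_trans (archi_boundP _).
  by rewrite ltrNl.
pose F x := P (k x).+1 x - P (k x).+1 0.
have FE m x : - m.+1%:R < x -> F x = P m.+1 x - P m.+1 0.
  move=> mx; rewrite /F; set j := (k x).+1.
  pose g y := P j y - P m.+1 y.
  suff : g x = g 0 by rewrite /g; lra.
  have jx : - j%:R < x by apply: lt_trans (kx x); rewrite ltrN2 ltr_nat.
  apply: (@deriv0_const g (- Num.min (j%:R : R) m.+1%:R)).
  - move=> z; rewrite ltrNl lt_min => /andP[z1 z2].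
    apply: (@is_derive_ext (P j - P m.+1) _ _ (f z - f z)) => //.
      by rewrite subrr.
    by apply: is_deriveB; apply: hP; rewrite ltrNl.
  - by rewrite ltrNl lt_min !(ltrNl x) jx.
  - by rewrite oppr_lt0 lt_min !ltr0n.
exists F => x; have [m mx] : exists m : nat, - m.+1%:R < x.
  by exists (k x); apply: lt_trans (kx x); rewrite ltrN2 ltr_nat.
apply: (@near_eq_is_derive _ _ _ (fun y => P m.+1 y - P m.+1 0)).
- have nx : \forall y \near x, - y < m.+1%:R by apply: Nlt_nbhsl; rewrite ltrNl.
  by apply: filterS nx => y hy; apply/esym/FE; rewrite ltrNl.
- apply: (@is_derive_ext (P m.+1 - cst (P m.+1 0)) _ _ (f x - 0)) => //.
    by rewrite subr0.
  by apply: is_deriveB; apply: hP.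
Unshelve. all: by end_near. Qed.

Definition mean f : R := \int[lebesgue_measure]_(x in `[0, 1]) f x.

Lemma mean_integrable f : continuous f ->
  (@lebesgue_measure R).-integrable `[0, 1] (EFin \o f).
Proof.
move=> cf; apply: continuous_compact_integrable; first exact: segment_compact.
exact: continuous_subspaceT.
Qed.

Lemma mean_prim F f : continuous f -> (forall x, is_derive x 1 F (f x)) ->
  mean f = F 1 - F 0.
Proof.
move=> cf hF; have cF x : {for x, continuous F} := is_derive_continuous (hF x).
rewrite /mean /Rintegral (@continuous_FTC2 _ f F)//.
- exact: continuous_subspaceT.
- split=> [x _||]; first by have [] := hF x.
    by apply: cvg_at_right_filter; exact: cF.
  by apply: cvg_at_left_filter; exact: cF.
- by move=> x _; rewrite derive1E; have [_ ->] := hF x.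
Qed.

Lemma mean_cst c : mean (fun=> c) = c.
Proof.
rewrite /mean Rintegral_cst//= lebesgue_measure_itv/= lte_fin ltr01/=.
by rewrite oppr0 addr0 mulr1.
Qed.

Lemma meanD f g : continuous f -> continuous g ->
  mean (fun x => f x + g x) = mean f + mean g.
Proof. by move=> cf cg; rewrite /mean RintegralD//; exact: mean_integrable. Qed.

Lemma meanB f g : continuous f -> continuous g ->
  mean (fun x => f x - g x) = mean f - mean g.
Proof. by move=> cf cg; rewrite /mean RintegralB//; exact: mean_integrable. Qed.

Lemma meanZ f c : continuous f -> mean (fun x => c * f x) = c * mean f.
Proof. by move=> cf; rewrite /mean RintegralZl//; exact: mean_integrable. Qed.

Lemma mean_le f g : continuous f -> continuous g ->
  (forall x, 0 <= x <= 1 -> f x <= g x) -> mean f <= mean g.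
Proof.
move=> cf cg h; apply: le_Rintegral => //; try exact: mean_integrable.
Qed.

Lemma eq_mean f g : (forall x, f x = g x) -> mean f = mean g.
Proof. by move=> /funext ->. Qed.

Lemma mean_dist f g e : continuous f -> continuous g ->
  (forall x, 0 <= x <= 1 -> `|f x - g x| <= e) -> `|mean f - mean g| <= e.
Proof.
move=> cf cg h; rewrite -meanB//.
have c1 : continuous (fun x => f x - g x) by move=> x; apply: cvgB; [exact: cf|exact: cg].
rewrite ler_norml; apply/andP; split.
  rewrite -(mean_cst (- e)); apply: mean_le => //; first by move=> x; exact: cvg_cst.
  by move=> x /h; rewrite ler_norml => /andP[].
rewrite -(mean_cst e); apply: mean_le => //; first by move=> x; exact: cvg_cst.
by move=> x /h; rewrite ler_norml => /andP[].
Qed.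

Definition per1 f := forall x, f (x + 1) = f x.

Lemma per1n f n x : per1 f -> f (x + n%:R) = f x.
Proof.
move=> h; elim: n => [|n ih]; first by rewrite addr0.
by rewrite -natr1 addrA h.
Qed.

Lemma continuous_lin f a b : continuous f -> continuous (fun x => f (a * x + b)).
Proof.
move=> cf x; apply: (@continuous_comp _ _ _ (fun x => a * x + b) f); last exact: cf.
exact: is_derive_continuous (is_derive_lin a b x).
Qed.

Lemma prim_per1 F f x : continuous f -> per1 f -> (forall x, is_derive x 1 F (f x)) ->
  F (x + 1) - F x = mean f.
Proof.
move=> cf pf hF; rewrite (mean_prim cf hF).
have d y : is_derive y 1 (fun y => F (1 * y + 1) - F y) 0.
  apply: (@is_derive_ext ((fun y => F (1 * y + 1)) - F) _ _ (f (1 * y + 1) * 1 - f y)) => //.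
    by rewrite mul1r pf mulr1 subrr.
  by apply: is_deriveB; exact: is_derive_comp_lin.
have := @is_derive_0_is_cst R _ x 0 d.
by rewrite !mul1r add0r.
Qed.

Lemma mean_shift f c : continuous f -> per1 f -> mean (fun x => f (x + c)) = mean f.
Proof.
move=> cf pf; have [F hF] := primitive cf.
rewrite -(prim_per1 c cf pf hF) addrC.
have h x : is_derive x 1 (fun x => F (1 * x + c)) (f (x + c)).
  apply: is_derive_ext (is_derive_comp_lin 1 c x hF) => //.
  by rewrite mul1r mulr1.
have cfc : continuous (fun x => f (x + c)).
  by have := @continuous_lin f 1 c cf; under eq_fun do rewrite mul1r.
by rewrite (mean_prim cfc h) mulr1 mulr0 add0r addrC (addrC 1).
Qed.

Lemma mean_split f n : (0 < n)%N -> continuous f ->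
  mean f = n%:R^-1 * \sum_(i < n) mean (fun t => f ((i%:R + t) / n%:R)).
Proof.
move=> n0 cf; have [F hF] := primitive cf.
have nn : n%:R != 0 :> R by rewrite pnatr_eq0 -lt0n.
have E i : mean (fun t => f ((i%:R + t) / n%:R)) =
    n%:R * (F (i.+1%:R / n%:R) - F (i%:R / n%:R)).
  have lin (t : R) : (i%:R + t) / n%:R = n%:R^-1 * t + i%:R / n%:R by ring.
  rewrite (eq_mean (fun t => congr1 f (lin t))).
  have h x : is_derive x 1 (fun t => n%:R * F (n%:R^-1 * t + i%:R / n%:R)) (f (n%:R^-1 * x + i%:R / n%:R)).
    have h := is_derive_mul (is_derive_c (n%:R) x) (is_derive_comp_lin n%:R^-1 (i%:R / n%:R) x hF).
    by apply: is_derive_ext h => //; rewrite mul0r add0r mulrC mulfVK.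
  rewrite (mean_prim (@continuous_lin f _ _ cf) h) mulr1 mulr0 add0r -mulrBr -(natr1 i).
  by congr (_ * (F _ - _)); ring.
under eq_bigr do rewrite E.
rewrite -mulr_sumr mulKf//.
rewrite -(big_mkord xpredT (fun i => F (i.+1%:R / n%:R) - F (i%:R / n%:R))).
rewrite telescope_sumr//= divff// mul0r.
exact: mean_prim.
Qed.

(* On an interval of length 1 / n the slow variable s may be frozen while n s
   runs through a full period. *)
Lemma frozen_average (K : R -> R -> R) (L : R) n : (0 < n)%N ->
  (forall s s' t, `|K s t - K s' t| <= L * `|s - s'|) ->
  (forall s, continuous (K s)) -> (forall s, per1 (K s)) ->
  continuous (fun s => K s (n%:R * s)) -> continuous (fun s => mean (K s)) ->
  `|mean (fun s => K s (n%:R * s)) - mean (fun s => mean (K s))| <= 2 * L / n%:R.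
Proof.
move=> n0 lK cK pK c1 c2; have nn : 0 < n%:R :> R by rewrite ltr0n.
have nn0 : n%:R != 0 :> R by rewrite gt_eqF.
have ce f (i : nat) : continuous f -> continuous (fun t : R => f ((i%:R + t) / n%:R)).
  move=> cf; have h := @continuous_lin f n%:R^-1 (i%:R / n%:R) cf.
  have -> : (fun t : R => f ((i%:R + t) / n%:R)) = (fun t => f (n%:R^-1 * t + i%:R / n%:R)) => //.
  by apply/funext => t; congr f; ring.
have step (i : nat) (t : R) : 0 <= t <= 1 -> `|(i%:R + t) / n%:R - i%:R / n%:R| <= n%:R^-1.
  move=> /andP[t0 t1]; rewrite -mulrBl addrC addKr ger0_norm; last by rewrite divr_ge0// ltW.
  by rewrite ler_piMl// invr_ge0 ltW.
have L0 : 0 <= L.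
  by have := lK 1 0 0; rewrite subr0 normr1 mulr1; apply: le_trans.
rewrite (mean_split n0 c1) (mean_split n0 c2) -mulrBr -sumrB normrM ger0_norm ?invr_ge0 ?(ltW nn)//.
rewrite ler_pdivrMl// mulrCA mulfV// mulr1.
apply: (le_trans (ler_norm_sum _ _ _)).
apply: (@le_trans _ _ (\sum_(i < n) (2 * L / n%:R))); last first.
  by rewrite sumr_const card_ord -[leLHS]mulr_natl mulrCA mulfV// mulr1.
apply: ler_sum => i _; set s0 := i%:R / n%:R : R.
have Ln : L * n%:R^-1 + L * n%:R^-1 = 2 * L / n%:R by ring.
rewrite -Ln; set A := mean _; set B := mean _.
have -> : A - B = (A - mean (K s0)) + (mean (K s0) - B) by rewrite subrKA.
apply: (le_trans (ler_normD _ _)); apply: lerD.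
  apply: mean_dist => //; first by apply: (ce (fun s => K s (n%:R * s))).
  (* At s = (i + t) / n the fast variable is i + t, and periodicity removes the integer i. *)
  move=> t t01; rewrite [n%:R * _]mulrC mulfVK// [X in K _ X]addrC per1n//.
  by apply: (le_trans (lK _ _ _)); rewrite ler_wpM2l// step.
rewrite distrC -(mean_cst (mean (K s0))).
apply: mean_dist => //.
- by apply: (ce (fun s => mean (K s))).
- by move=> x; exact: cvg_cst.
move=> t t01; apply: mean_dist => // u _.
by apply: (le_trans (lK _ _ _)); rewrite ler_wpM2l// step.
Qed.

End Primitives.

(** * Equidistribution modulo 1 of a sine of large amplitude *)

Section Sine.
Variable R : realType.
Implicit Types (f g F G : R -> R) (a b c x y : R).

Lemma is_derive_sin_lin a x : is_derive x 1 (fun y => sin (a * y)) (a * cos (a * x)).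
Proof.
have h := is_derive_comp_lin a 0 x (@is_derive_sin R).
by apply: is_derive_ext h => [y|]; rewrite ?addr0// mulrC.
Qed.

Lemma is_derive_cos_lin a x : is_derive x 1 (fun y => cos (a * y)) (- a * sin (a * x)).
Proof.
have h := is_derive_comp_lin a 0 x (@is_derive_cos R).
by apply: is_derive_ext h => [y|]; rewrite ?addr0// mulrC mulrN mulNr.
Qed.

Lemma is_derive_exp f (df : R) n x : is_derive x 1 f df ->
  is_derive x 1 (fun y => f y ^+ n) (n%:R * f x ^+ n.-1 * df).
Proof.
move=> h; elim: n => [|n ih].
  by apply: is_derive_ext (is_derive_c 1 x) => //; rewrite !mul0r.
apply: is_derive_ext (is_derive_mul h ih) => [y|]; first by rewrite exprS.
rewrite /= -natr1; case: n {ih} => [|n] /=; first by rewrite !expr0; ring.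
by rewrite exprS; ring.
Qed.

Definition sn x : R := sin (2 * pi * x).
Definition cs x : R := cos (2 * pi * x).

Lemma is_derive_sn x : is_derive x 1 sn (2 * pi * cs x).
Proof. exact: is_derive_sin_lin. Qed.

Lemma is_derive_cs x : is_derive x 1 cs (- (2 * pi) * sn x).
Proof. exact: is_derive_cos_lin. Qed.

Lemma continuous_sn : continuous sn.
Proof. by move=> x; exact: is_derive_continuous (is_derive_sn x). Qed.

Lemma continuous_cs : continuous cs.
Proof. by move=> x; exact: is_derive_continuous (is_derive_cs x). Qed.

Lemma sn0 : sn 0 = 0. Proof. by rewrite /sn mulr0 sin0. Qed.
Lemma cs0 : cs 0 = 1. Proof. by rewrite /cs mulr0 cos0. Qed.
Lemma sn1 : sn 1 = 0.
Proof. by rewrite /sn mulr1 mulr_natl sin2pi. Qed.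
Lemma cs1 : cs 1 = 1.
Proof. by rewrite /cs mulr1 mulr_natl cos2pi. Qed.

Lemma cs2 x : cs x ^+ 2 = 1 - sn x ^+ 2.
Proof. exact: cos2sin2. Qed.

Lemma sn_le1 x : `|sn x| <= 1. Proof. exact: sin_max. Qed.
Lemma cs_le1 x : `|cs x| <= 1. Proof. exact: cos_max. Qed.

Lemma continuousX f n : continuous f -> continuous (fun x => f x ^+ n).
Proof.
move=> cf; elim: n => [|n ih]; first by move=> x; exact: cvg_cst.
have -> : (fun x => f x ^+ n.+1) = (fun x => f x * f x ^+ n) by apply/funext => x; rewrite exprS.
by move=> x; apply: cvgM; [exact: cf|exact: ih].
Qed.

Definition wallis n := mean (fun x => sn x ^+ (2 * n)%N).

(** The derivative of cs sn^(2n+1) integrates to 0 over a period. *)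
Lemma wallis_rec n : (2 * n.+1)%:R * wallis n.+1 = (2 * n).+1%:R * wallis n.
Proof.
have c k : continuous (fun x => sn x ^+ k) by exact: continuousX continuous_sn.
pose f x := 2 * pi * ((2 * n).+1%:R * sn x ^+ (2 * n)%N - (2 * n.+1)%:R * sn x ^+ (2 * n.+1)%N).
have ca : continuous (fun x => (2 * n).+1%:R * sn x ^+ (2 * n)%N).
  by move=> x; apply: cvgM; [exact: cvg_cst|exact: c].
have cb : continuous (fun x => (2 * n.+1)%:R * sn x ^+ (2 * n.+1)%N).
  by move=> x; apply: cvgM; [exact: cvg_cst|exact: c].
have cab : continuous (fun x => (2 * n).+1%:R * sn x ^+ (2 * n)%N - (2 * n.+1)%:R * sn x ^+ (2 * n.+1)%N).
  by move=> x; apply: cvgB; [exact: ca|exact: cb].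
have cf : continuous f by move=> x; apply: cvgM; [exact: cvg_cst|exact: cab].
have hF x : is_derive x 1 (fun y => cs y * sn y ^+ (2 * n).+1) (f x).
  have h := is_derive_mul (is_derive_cs x) (is_derive_exp (2 * n).+1 (is_derive_sn x)).
  apply: is_derive_ext h => //=; rewrite /f.
  have -> : (2 * n.+1)%N = (2 * n).+2 by rewrite mulnS.
  have := cs2 x; set C := cs x; set S := sn x; set T := S ^+ (2 * n) => C2.
  rewrite !exprS -/T -[(2 * n).+2%:R]natr1.
  have -> : C * ((2 * n).+1%:R * T * (2 * pi * C)) = 2 * pi * (2 * n).+1%:R * T * C ^+ 2.
    by move: (pi) => p; ring.
  by rewrite C2; move: (pi) => p; ring.
have := mean_prim cf hF; rewrite sn0 sn1 !expr0n/= !mulr0 subrr.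
rewrite /f meanZ// meanB// !meanZ//; try exact: c.
move/eqP; rewrite mulf_eq0 => /orP[|].
  by rewrite mulf_eq0 pnatr_eq0/= gt_eqF ?pi_gt0.
by rewrite subr_eq0 => /eqP.
Qed.

Lemma wallis_ge0 n : 0 <= wallis n.
Proof.
rewrite -(mean_cst 0); apply: mean_le; first by move=> x; exact: cvg_cst.
  exact: continuousX continuous_sn.
by move=> x _; rewrite exprM exprn_ge0// sqr_ge0.
Qed.

(** Induction on the recurrence, using (2n+1)(2n+3) <= (2n+2)^2. It gives a decay of order n^(-1/2)
    without computing the integrals. *)
Lemma wallis_le n : (2 * n).+1%:R * wallis n ^+ 2 <= 1.
Proof.
elim: n => [|n ih].
  rewrite /wallis muln0 mul1r (eq_mean (g := fun=> 1)) ?mean_cst ?expr1n//.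
have := wallis_rec n; set a := wallis n.+1; set b := wallis n in ih *.
have e1 : (2 * n.+1)%:R = 2 * n%:R + 2 :> R by rewrite mulnS natrD natrM; lra.
have e2 : (2 * n).+1%:R = 2 * n%:R + 1 :> R by rewrite -natr1 natrM.
have e3 : (2 * n.+1).+1%:R = 2 * n%:R + 3 :> R by rewrite -natr1 e1; lra.
rewrite e1 e2 e3; rewrite e2 in ih; have n0 : 0 <= n%:R :> R by [].
move: (n%:R) n0 ih => u u0 ih h.
have u2 : 0 < (2 * u + 2) ^+ 2 by rewrite exprn_gt0//; lra.
rewrite -(ler_pM2l u2) mulr1.
have -> : (2 * u + 2) ^+ 2 * ((2 * u + 3) * a ^+ 2) = (2 * u + 3) * ((2 * u + 2) * a) ^+ 2 by ring.
rewrite h exprMn.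
have -> : (2 * u + 3) * ((2 * u + 1) ^+ 2 * b ^+ 2) = (2 * u + 3) * (2 * u + 1) * ((2 * u + 1) * b ^+ 2) by ring.
apply: (@le_trans _ _ ((2 * u + 3) * (2 * u + 1) * 1)).
  by rewrite ler_wpM2l// mulr_ge0//; lra.
rewrite !expr2; lra.
Qed.

Lemma wallis_small e : 0 < e -> exists n, wallis n <= e.
Proof.
move=> e0; pose n := Num.bound (e ^- 2); exists n.
have hn : e ^- 2 < n%:R by apply: archi_boundP; rewrite invr_ge0 exprn_ge0// (ltW e0).
rewrite -ler_sqr ?nnegrE ?wallis_ge0 ?(ltW e0)//.
have w := wallis_le n; have e2 : 0 < e ^+ 2 by rewrite exprn_gt0.
have n0 : 1 < n%:R * e ^+ 2 by rewrite -ltr_pdivrMr// mul1r.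
have n1 : n%:R <= (2 * n).+1%:R :> R by rewrite ler_nat; lia.
have w2 := sqr_ge0 (wallis n).
have : n%:R * wallis n ^+ 2 <= 1 by apply: le_trans w; rewrite ler_wpM2r.
have npos : 0 < n%:R :> R by apply: lt_trans hn; rewrite invr_gt0 exprn_gt0.
by move=> h; rewrite -(ler_pM2l npos); lra.
Qed.

Lemma continuous_ord_sum (h : nat -> R -> R) n : (forall j, continuous (h j)) ->
  continuous (fun x => \sum_(j < n) h j x).
Proof.
move=> ch; elim: n => [|n ih].
  have -> : (fun x => \sum_(j < 0) h j x) = (fun=> 0) by apply/funext => x; rewrite big_ord0.
  by move=> x; exact: cvg_cst.
have -> : (fun x => \sum_(j < n.+1) h j x) = (fun x => \sum_(j < n) h j x + h n x).
  by apply/funext => x; rewrite big_ord_recr.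
by move=> x; apply: cvgD; [exact: ih|exact: ch].
Qed.

(* The weight vanishes where sn is critical, so that one can integrate by parts:
   1 - sn ^+ 2n = cs * (cs * sum_(j < n) sn ^+ 2j). *)
Lemma mean_sine_weight f C n : continuous f -> per1 f -> mean f = 0 ->
  (forall x, `|f x| <= 2) -> C != 0 ->
  `|mean (fun x => f (C * sn x) * (1 - sn x ^+ (2 * n)))| <= 6 * n%:R ^+ 2 / `|C|.
Proof.
move=> cf pf f0 f2 C0; have [F0 hF0] := primitive cf.
pose F x := F0 x - F0 0.
have hF x : is_derive x 1 F (f x).
  apply: (@is_derive_ext R (F0 - cst (F0 0)) _ _ (f x - 0)) => //; by rewrite subr0.
(* The primitive is periodic because [f] has mean 0; hence it is bounded by 2, its maximal variation
   on a unit interval from its zero at 0. *)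
have pF : per1 F.
  move=> x; rewrite /F; have := prim_per1 x cf pf hF0; rewrite f0 => /eqP.
  by rewrite subr_eq0 => /eqP ->.
have F2 x : `|F x| <= 2.
  have [k [y [xE y01]]] : exists k : int, exists y, x = y + k%:~R /\ 0 <= y <= 1.
    exists (Num.floor x), (x - (Num.floor x)%:~R); rewrite subrK; split=> //.
    have h1 := floor_le x; have h2 := floorD1_gt x; rewrite intrD mulr1z in h2.
    by apply/andP; split; lra.
  have -> : F x = F y.
    rewrite xE; case: k {xE} => m; first by rewrite -pmulrn per1n.
    by rewrite NegzE mulrNz -(per1n m.+1 (y - _) pF) subrK.
  have /andP[y0 y1] := y01; have [|c _] := @MVT_segment R F f 0 y y0 (fun z _ => hF z).
    by apply: continuous_subspaceT => z; exact: is_derive_continuous (hF z).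
  rewrite /F subr0 subrr subr0 => ->; rewrite normrM (ger0_norm y0) -[leRHS]mulr1.
  by rewrite ler_pM.
pose k x := cs x * \sum_(j < n) sn x ^+ (2 * j).
pose dk x := 2 * pi * (- sn x * \sum_(j < n) sn x ^+ (2 * j) +
   cs x * \sum_(j < n) ((2 * j)%:R * sn x ^+ (2 * j).-1 * cs x)).
have hsum x : is_derive x 1 (fun y => \sum_(j < n) sn y ^+ (2 * j))
    (\sum_(j < n) ((2 * j)%:R * sn x ^+ (2 * j).-1 * (2 * pi * cs x))).
  have h := @is_derive_sum R R R n (fun j y => sn y ^+ (2 * j)) x 1 _ (fun j => is_derive_exp (2 * j) (is_derive_sn x)).
  apply: is_derive_ext h => // y; by rewrite fct_sumE.
have hk x : is_derive x 1 k (dk x).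
  apply: is_derive_ext (is_derive_mul (is_derive_cs x) (hsum x)) => //; rewrite /dk.
  have -> : \sum_(j < n) ((2 * j)%:R * sn x ^+ (2 * j).-1 * (2 * pi * cs x)) =
      2 * pi * \sum_(j < n) ((2 * j)%:R * sn x ^+ (2 * j).-1 * cs x).
    by rewrite mulr_sumr; apply: eq_bigr => j _; move: (pi) => p; ring.
  by move: (pi) (\sum_(j < n) (_ * _)) (\sum_(j < n) _) => p A B; ring.
have kE x : cs x * k x = 1 - sn x ^+ (2 * n).
  rewrite /k mulrA -expr2 cs2 exprM; have := subrX1 (sn x ^+ 2) n.
  under eq_bigr do rewrite -exprM; move=> h.
  by move: h; set A := (sn x ^+ 2) ^+ n; set S := \sum_i _; lra.
have dkb x : `|dk x| <= 2 * pi * (3 * n%:R ^+ 2).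
  rewrite /dk normrM ger0_norm ?mulr_ge0 ?pi_ge0//; rewrite ler_wpM2l ?mulr_ge0 ?pi_ge0//.
  have s1 : `|\sum_(j < n) sn x ^+ (2 * j)| <= n%:R.
    rewrite (le_trans (ler_norm_sum _ _ _))// -[n in leRHS]card_ord -sumr_const ler_sum// => j _.
    by rewrite normrX exprn_ile1// sn_le1.
  have s2 : `|\sum_(j < n) ((2 * j)%:R * sn x ^+ (2 * j).-1 * cs x)| <= 2 * n%:R ^+ 2.
    rewrite (le_trans (ler_norm_sum _ _ _))//.
    apply: (@le_trans _ _ (\sum_(j < n) 2 * n%:R)); last first.
      by rewrite sumr_const card_ord -[leLHS]mulr_natl expr2; lra.
    apply: ler_sum => j _; rewrite !normrM normr_nat normrX.
    rewrite -[leRHS]mulr1 ler_pM ?mulr_ge0 ?exprn_ge0 ?cs_le1//.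
    rewrite -[leRHS]mulr1 ler_pM ?exprn_ge0//; first by rewrite -natrM ler_nat leq_mul2l/= ltnW.
    by rewrite exprn_ile1// sn_le1.
  apply: (le_trans (ler_normD _ _)); rewrite !normrM normrN.
  have n2 : n%:R <= n%:R ^+ 2 :> R by rewrite -natrX ler_nat expnS expn1; case: (n) => // m; exact: leq_pmull.
  have t1 : `|sn x| * `|\sum_(j < n) sn x ^+ (2 * j)| <= 1 * n%:R by rewrite ler_pM// sn_le1.
  have t2 : `|cs x| * `|\sum_(j < n) ((2 * j)%:R * sn x ^+ (2 * j).-1 * cs x)| <= 1 * (2 * n%:R ^+ 2).
    by rewrite ler_pM// cs_le1.
  by lra.
have cCs : continuous (fun x => C * sn x).
  by move=> x; apply: cvgM; [exact: cvg_cst|exact: continuous_sn].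
have comp g : continuous g -> continuous (fun x => g (C * sn x)).
  by move=> cg x; apply: (@continuous_comp _ _ _ (fun x => C * sn x) g); [exact: cCs|exact: cg].
have cF : continuous F by move=> x; exact: is_derive_continuous (hF x).
have hFC x : is_derive x 1 (fun y => F (C * sn y)) (f (C * sn x) * (C * (2 * pi * cs x))).
  have h : is_derive x 1 (fun y => C * sn y) (C * (2 * pi * cs x)).
    have h := is_derive_mul (is_derive_c C x) (is_derive_sn x).
    by apply: is_derive_ext h => //; rewrite mul0r add0r.
  exact: (@is_derive1_comp R F (fun y => C * sn y) x _ _ (hF _) h).
have csX m : continuous (fun x => sn x ^+ m) by exact: continuousX continuous_sn.
have c1 : continuous (fun x => f (C * sn x) * (1 - sn x ^+ (2 * n))).
  apply: contM; first exact: comp.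
  by move=> x; apply: cvgB; [exact: cvg_cst|exact: csX].
have cdk : continuous dk.
  apply: contM; first by move=> x; exact: cvg_cst.
  have cS : continuous (fun x => \sum_(j < n) sn x ^+ (2 * j)).
    by move=> x; exact: is_derive_continuous (hsum x).
  have cT : continuous (fun x => \sum_(j < n) ((2 * j)%:R * sn x ^+ (2 * j).-1 * cs x)).
    apply: (@continuous_ord_sum (fun j x => (2 * j)%:R * sn x ^+ (2 * j).-1 * cs x)) => j.
    apply: contM; last exact: continuous_cs.
    by apply: contM => //; move=> x; exact: cvg_cst.
  move=> x; apply: cvgD; apply: cvgM; try exact: cS; try exact: cT; try exact: continuous_cs.
  by apply: cvgN; exact: continuous_sn.
have c2 : continuous (fun x => F (C * sn x) * dk x).
  by apply: contM => //; exact: comp.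
(* This derivative integrates to 0 over a period. Its second term is at most 2 (2 pi 3 n^2), and
   division by 2 pi |C| produces the constant of the statement. *)
have hP x : is_derive x 1 (fun y => F (C * sn y) * k y)
    (2 * pi * C * (f (C * sn x) * (1 - sn x ^+ (2 * n))) + F (C * sn x) * dk x).
  apply: is_derive_ext (is_derive_mul (hFC x) (hk x)) => //.
  by rewrite -kE; congr (_ + _); move: (pi) => p; ring.
have c3 : continuous (fun x => 2 * pi * C * (f (C * sn x) * (1 - sn x ^+ (2 * n)))).
  by apply: contM => //; move=> x; exact: cvg_cst.
have := @mean_prim R (fun y => F (C * sn y) * k y) _ _ hP.
have -> : F (C * sn 1) * k 1 - F (C * sn 0) * k 0 = 0.
  by rewrite /k sn0 sn1 cs0 cs1 subrr.
rewrite meanD// meanZ// => /(_ (fun x => cvgD (c3 x) (c2 x))) /eqP.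
rewrite addr_eq0 => /eqP E.
have p0 : 0 < 2 * pi * `|C| by rewrite !mulr_gt0 ?pi_gt0// normr_gt0.
have b2 : `|mean (fun x => F (C * sn x) * dk x)| <= 2 * (2 * pi * (3 * n%:R ^+ 2)).
  rewrite -[X in `|X|]subr0 -(mean_cst 0); apply: mean_dist => //.
    by move=> x; exact: cvg_cst.
  by move=> x _; rewrite subr0 normrM ler_pM.
have := congr1 (fun t => `|t|) E; rewrite normrN !normrM (ger0_norm (pi_ge0 R)) (ger0_norm (ler0n R 2)).
set M := `|mean _|; set N := `|mean _| in b2 * => EN.
rewrite ler_pdivlMr ?normr_gt0// -(ler_pM2l (pi_gt0 R)).
move: EN b2; set p := pi; set c := `|C|; set u := n%:R ^+ 2 => EN b2; nra.
Qed.

(** The part of the integral weighted by sn^(2n), concentrated near the critical points, costs 2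
    [wallis n] <= e / 2; with n now fixed, the rest decays like 1 / |C|. The threshold depends on
    [e] alone: it must serve all the slices of a function of two variables at once. *)
Lemma sine_equidistribution e : 0 < e -> exists C0 : R, forall f C phi,
  continuous f -> per1 f -> (forall x, `|f x| <= 1) -> C0 <= `|C| ->
  `|mean (fun x => f (C * sin (2 * pi * x + phi))) - mean f| <= e.
Proof.
move=> e0; have e4 : 0 < e / 4 by lra.
have [n hn] := wallis_small e4.
(* 12 n^2 / e brings the bound 6 n^2 / |C| below e / 2, and the added 1 keeps C away from 0. *)
exists (12 * n%:R ^+ 2 / e + 1) => f C phi cf pf f1 hC.
have C0 : 0 < `|C|.
  by apply: lt_le_trans hC; rewrite ltr_wpDl// divr_ge0 ?mulr_ge0 ?exprn_ge0 ?(ltW e0).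
have Cn : C != 0 by rewrite -normr_gt0.
have hC2 : 6 * n%:R ^+ 2 / `|C| <= e / 2.
  rewrite ler_pdivrMr//.
  have : 12 * n%:R ^+ 2 / e <= `|C| by apply: le_trans hC; lra.
  by rewrite ler_pdivrMr// ; set u := n%:R ^+ 2; lra.
have cCs : continuous (fun x => f (C * sn x)).
  move=> x; apply: (@continuous_comp _ _ _ (fun x => C * sn x) f); last exact: cf.
  by apply: cvgM; [exact: cvg_cst|exact: continuous_sn].
have -> : mean (fun x => f (C * sin (2 * pi * x + phi))) = mean (fun x => f (C * sn x)).
  rewrite -[RHS](@mean_shift R _ (phi / (2 * pi))) //.
    apply: eq_mean => x; rewrite /sn; congr (f (C * sin _)).
    have : pi != 0 :> R by rewrite gt_eqF ?pi_gt0.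
    by move: (pi) => p p0; field.
  move=> x; have -> : sn (x + 1) = sin (2 * pi * x + pi *+ 2).
    by rewrite /sn -mulr_natl; congr sin; move: (pi) => p; ring.
  by rewrite sinD2pi.
pose m := mean f; pose g x := f x - m.
have m1 : `|m| <= 1.
  rewrite -[m]subr0 -(mean_cst 0); apply: mean_dist => //.
    by move=> x; exact: cvg_cst.
  by move=> x _; rewrite subr0.
have cg : continuous g by move=> x; apply: cvgB; [exact: cf|exact: cvg_cst].
have pg : per1 g by move=> x; rewrite /g pf.
have g0 : mean g = 0.
  by rewrite /g meanB ?mean_cst ?subrr//; move=> x; exact: cvg_cst.
have g2 x : `|g x| <= 2.
  by have := f1 x; have := ler_normB (f x) m; rewrite -/(g x); lra.
have b1 := @mean_sine_weight g C n cg pg g0 g2 Cn.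
have cgs : continuous (fun x => g (C * sn x)).
  by move=> x; apply: cvgB; [exact: cCs|exact: cvg_cst].
have csX : continuous (fun x => sn x ^+ (2 * n))  by exact: continuousX continuous_sn.
have c1 : continuous (fun x => g (C * sn x) * (1 - sn x ^+ (2 * n))).
  by apply: contM => //; move=> x; apply: cvgB; [exact: cvg_cst|exact: csX].
have c2 : continuous (fun x => g (C * sn x) * sn x ^+ (2 * n)) by exact: contM.
have b2 : `|mean (fun x => g (C * sn x) * sn x ^+ (2 * n))| <= 2 * wallis n.
  have cw : continuous (fun x => 2 * sn x ^+ (2 * n)).
    by apply: contM => // x; exact: cvg_cst.
  have cw' : continuous (fun x => - (2 * sn x ^+ (2 * n))) by move=> x; apply: cvgN; exact: cw.
  rewrite /wallis -meanZ// ler_norml; apply/andP; split.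
    rewrite -mulN1r -meanZ//; apply: mean_le => //.
      by under eq_fun do rewrite mulN1r.
    move=> x _; have := g2 (C * sn x); rewrite ler_norml => /andP[h _].
    have : 0 <= sn x ^+ (2 * n) by rewrite exprM exprn_ge0 ?sqr_ge0.
    by set t := _ ^+ _; nra.
  apply: mean_le => // x _; have := g2 (C * sn x); rewrite ler_norml => /andP[_ h].
  have : 0 <= sn x ^+ (2 * n) by rewrite exprM exprn_ge0 ?sqr_ge0.
  by set t := _ ^+ _; nra.
have -> : mean (fun x => f (C * sn x)) - m = mean (fun x => g (C * sn x)).
  by rewrite /g meanB ?mean_cst//; move=> x; exact: cvg_cst.
have -> : mean (fun x => g (C * sn x)) = mean (fun x => g (C * sn x) * (1 - sn x ^+ (2 * n))) +
    mean (fun x => g (C * sn x) * sn x ^+ (2 * n)).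
  by rewrite -meanD//; apply: eq_mean => x; ring.
by apply: (le_trans (ler_normD _ _)); lra.
Qed.

End Sine.

(** * Correlations of Lipschitz functions *)

Section PlaneIntegral.
Variable R : realType.
Implicit Types (U V : R * R -> R).

(** An open set is a countable union of rational boxes, so it belongs to the product
    sigma-algebra. *)
Lemma open_measurable2 (O : set (R * R)) : open O -> measurable O.
Proof.
move=> oO; pose box (a b e : R) : set (R * R) := `]a - e, a + e[%classic `*` `]b - e, b + e[%classic.
pose F (i : rat * rat * rat) := let B := box (ratr i.1.1) (ratr i.1.2) (ratr i.2) in
  if pselect (B `<=` O) then B else set0.
have -> : O = \bigcup_i F i.
  apply/seteqP; split=> [x Ox|x [i _]]; last first.
    by rewrite /F; case: pselect => // h; exact: h.
  have /nbhs_ballP[e /= e0 he] : nbhs x O by exact: open_nbhs_nbhs.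
  (* A box of half-side c < e / 2 whose centre is within c of x contains x and lies in the ball of
     radius e. *)
  have /rat_in_itvoo[c] : (0 < e / 2) by lra.
  rewrite in_itv/= => /andP[c0 ce].
  have /rat_in_itvoo[a] : (x.1 - ratr c < x.1 + ratr c) by lra.
  have /rat_in_itvoo[b] : (x.2 - ratr c < x.2 + ratr c) by lra.
  rewrite !in_itv/= => /andP[b1 b2] /andP[a1 a2].
  exists ((a, b), c); first exact: Logic.I; rewrite /F /=; case: pselect => [h|[]] /=.
    by split; rewrite /= in_itv/=; apply/andP; split; lra.
  move=> y [/=]; rewrite !in_itv/= => /andP[y1 y2] /andP[y3 y4].
  apply: he; split; rewrite /ball/= ltr_distlC; apply/andP; split; lra.
apply: countable_bigcupT_measurable; first exact: countableP.
move=> i; rewrite /F; case: pselect => h /=; last exact: measurable0.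
by apply: measurableX; exact: measurable_itv.
Qed.

Lemma continuous_measurable2 (U : R * R -> R) : continuous U -> measurable_fun setT U.
Proof.
move=> cU; apply: (measurability _ (measurable_realfun.RGenOpens.measurableE R)).
move=> _ [_ [a [b ->] <-]]; rewrite setTI; apply: open_measurable2.
by move/continuousP: cU; apply; exact: interval_open.
Qed.

Local Notation mu2 := ((@lebesgue_measure R \x @lebesgue_measure R)%E).
Local Notation Sq := (@unit_square R).

Lemma unit_squareE : Sq = `[0, 1[%classic `*` `[0, 1[%classic.
Proof. by apply/seteqP; split=> x; rewrite /unit_square/= !in_itv/=. Qed.

Lemma unit_square_measurable : measurable Sq.
Proof. by rewrite unit_squareE; apply: measurableX; exact: measurable_itv. Qed.

Lemma unit_square_mu : mu2 Sq = 1%E.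
Proof.
rewrite unit_squareE product_measure1E//; try exact: measurable_itv.
have E : lebesgue_measure (`[0, 1[%classic : set R) = 1%E.
  by rewrite lebesgue_measure_itv/= lte_fin ltr01 oppr0 adde0.
by rewrite -[RHS](mule1 1%E) -[in RHS]E.
Qed.

Definition mean2 U := \int[mu2]_(z in Sq) U z.

Lemma slice1 U y : continuous U -> continuous (fun x => U (x, y)).
Proof.
move=> cU x; apply: (@continuous_comp _ _ _ (fun x => (x, y)) U); last exact: cU.
have h1 : (fun t : R => t) @ x --> x by exact: cvg_id.
have h2 : (fun=> y) @ x --> y by exact: cvg_cst.
exact: (cvg_pair h1 h2).
Qed.

Lemma slice2 U x : continuous U -> continuous (fun y => U (x, y)).
Proof.
move=> cU y; apply: (@continuous_comp _ _ _ (fun y => (x, y)) U); last exact: cU.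
have h1 : (fun t : R => t) @ y --> y by exact: cvg_id.
have h2 : (fun=> x) @ y --> x by exact: cvg_cst.
exact: (cvg_pair h2 h1).
Qed.

Lemma integral_mean (f : R -> R) : continuous f ->
  (\int[@lebesgue_measure R]_(y in `[0%R, 1%R[) (f y)%:E = (mean f)%:E)%E.
Proof.
move=> cf; rewrite integral_itv_bndo_bndc; last first.
  apply/measurable_EFinP; apply: measurable_funTS; exact: continuous_measurable_fun.
rewrite /mean /Rintegral fineK//; apply: integrable_fin_num => //.
exact: mean_integrable.
Qed.

(** Tonelli in both orders; the half-open square gives closed intervals because endpoints are
    negligible. *)
Lemma mean2E U : continuous U -> (forall x, 0 <= U x) ->
  (mean2 U = mean (fun x => mean (fun y => U (x, y)))) /\
  (mean2 U = mean (fun y => mean (fun x => U (x, y)))).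
Proof.
move=> cU U0; pose f : R * R -> \bar R := (EFin \o U) \_ Sq.
have mf : measurable_fun setT f.
  apply/(measurable_restrictT _ unit_square_measurable).
  apply/measurable_EFinP; apply: measurable_funTS; exact: continuous_measurable2.
have f0 x : (0 <= f x)%E by rewrite /f patchE; case: ifP => //= _; rewrite lee_fin.
have m01 : measurable (`[0, 1[%classic : set R) by exact: measurable_itv.
have fE x y : f (x, y) = if (x \in `[0, 1[%classic) && (y \in `[0, 1[%classic) then (U (x, y))%:E else 0%E.
  by rewrite /f patchE unit_squareE in_setX.
have FE x : fubini_F (@lebesgue_measure R) f x =
    ((EFin \o (fun x => mean (fun y => U (x, y)))) \_ `[0, 1[%classic) x.
  rewrite patchE /fubini_F; case: ifP => x01.
    rewrite /= -integral_mean; last exact: slice2.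
    rewrite [RHS]integral_mkcond; apply: eq_integral => y _.
    by rewrite fE x01 patchE.
  by apply: integral0_eq => y _; rewrite fE x01.
have GE y : fubini_G (@lebesgue_measure R) f y =
    ((EFin \o (fun y => mean (fun x => U (x, y)))) \_ `[0, 1[%classic) y.
  rewrite patchE /fubini_G; case: ifP => y01.
    rewrite /= -integral_mean; last exact: slice1.
    rewrite [RHS]integral_mkcond; apply: eq_integral => x _.
    by rewrite fE y01 andbT patchE.
  by apply: integral0_eq => x _; rewrite fE y01 andbF.
have mF := measurable_fun_fubini_tonelli_F (m2 := @lebesgue_measure R) f mf f0.
have mG := measurable_fun_fubini_tonelli_G (m1 := @lebesgue_measure R) f mf f0.
have fin (g : R -> R) : measurable_fun (`[0%R, 1%R[%classic : set R) (EFin \o g) ->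
    fine (\int[@lebesgue_measure R]_(x in `[0%R, 1%R[) (g x)%:E) = mean g.
  by move=> mg; rewrite integral_itv_bndo_bndc.
rewrite /mean2 /Rintegral integral_mkcond; split.
  transitivity (fine (\int[@lebesgue_measure R]_x fubini_F (@lebesgue_measure R) f x)%E).
    congr (fine _); have h := fubini_tonelli1 (m1 := @lebesgue_measure R) (m2 := @lebesgue_measure R) f mf f0.
    exact: h.
  transitivity (fine (\int[@lebesgue_measure R]_x ((EFin \o (fun x => mean (fun y => U (x, y)))) \_ (`[0%R, 1%R[%classic : set R)) x)%E).
    by congr (fine _); apply: eq_integral => x _; exact: FE.
  rewrite -integral_mkcond.
  rewrite fin//; apply/(measurable_restrictT _ m01).
  by move: mF; rewrite (funext FE).
transitivity (fine (\int[@lebesgue_measure R]_x fubini_G (@lebesgue_measure R) f x)%E).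
  congr (fine _); have h := fubini_tonelli2 (m1 := @lebesgue_measure R) (m2 := @lebesgue_measure R) f mf f0.
  exact: h.
transitivity (fine (\int[@lebesgue_measure R]_x ((EFin \o (fun y => mean (fun x => U (x, y)))) \_ (`[0%R, 1%R[%classic : set R)) x)%E).
  by congr (fine _); apply: eq_integral => x _; exact: GE.
rewrite -integral_mkcond.
rewrite fin//; apply/(measurable_restrictT _ m01).
by move: mG; rewrite (funext GE).
Qed.

Lemma bounded_integrable2 U (M : R) : continuous U -> (forall x, `|U x| <= M) ->
  mu2.-integrable Sq (EFin \o U).
Proof.
move=> cU bU; apply: (@le_integrable _ _ _ mu2 Sq unit_square_measurable _ (EFin \o cst M)).
- apply/measurable_EFinP; apply: measurable_funTS; exact: continuous_measurable2.
- by move=> x _ /=; rewrite lee_fin (le_trans (bU x))// ler_norm.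
- apply/integrableP; split; first exact/measurable_EFinP/measurable_cst.
  rewrite (_ : (fun x => _) = cst `|M|%:E)// integral_cst; last exact: unit_square_measurable.
  by rewrite [X in (_ * X)%E]unit_square_mu mule1 ltry.
Qed.

End PlaneIntegral.

Lemma mean_continuous (R : realType) (U : R * R -> R) (M : R) : continuous U ->
  (forall x, `|U x| <= M) -> continuous (fun y => mean (fun x => U (x, y))).
Proof.
move=> cU bU y; pose I : set R := `]y - 1, y + 1[%classic.
apply: (@continuity_under_integral R _ _ (@lebesgue_measure R) (fun y x => U (x, y)) `[0%R, 1%R]%classic
   _ (y - 1) (y + 1) _ _ (fun=> M)) => //.
- by move=> z _; apply: mean_integrable; apply: cont_comp2 => //; cont.
- apply/aeW => x _ z _.
  by apply: (@cont_comp2 R R U (fun=> x) id cU); cont.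
- by apply: mean_integrable; exact: cont_cst.
- by move=> z _; apply/aeW => x _; exact: bU.
- by rewrite inE/= in_itv/=; apply/andP; split; lra.
Qed.

(** * Invariance of the mean under shears and translations *)

Section ShearInvariance.
Variable R : realType.
Implicit Types (U V : R * R -> R).

(** The test functions: continuous functions on the torus with values in [0, 1], seen on the
    plane. *)
Definition unit_fun U := [/\ continuous U, Z2_periodic U & forall x, 0 <= U x <= 1].

Definition hsh (b : R) (z : R * R) := (z.1 + b * z.2, z.2).
Definition vsh (f : R -> R) (z : R * R) := (z.1, z.2 + f z.1).

(** When the sheared direction is integrated first, every inner mean is merely translated. The slope
    is an integer so that periodicity survives. *)
Lemma unit_fun_hsh (k : int) U : unit_fun U ->
  unit_fun (U \o hsh k%:~R) /\ mean2 (U \o hsh k%:~R) = mean2 U.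
Proof.
move=> [cU pU U01]; have c1 : continuous (U \o hsh k%:~R).
  by apply: cont_comp2 => //; cont.
split; [split=> // [x i j|x]; last exact: U01|].
  rewrite /= /hsh/= -[RHS](pU _ (i + k * j) j).
  by congr (U (_, _)); rewrite /= intrD intrM; ring.
rewrite (mean2E c1 _).2; last by move=> x; have /andP[] := U01 (hsh k%:~R x).
rewrite (mean2E cU _).2; last by move=> x; have /andP[] := U01 x.
apply: eq_mean => y; apply: (@mean_shift R (fun x => U (x, y)) (k%:~R * y)).
  by apply: cont_comp2 => //; cont.
by move=> x; have := pU (x, y) 1 0; rewrite addr0.
Qed.

Lemma unit_fun_vsh (f : R -> R) U : continuous f -> (forall x (k : int), f (x + k%:~R) = f x) ->
  unit_fun U -> unit_fun (U \o vsh f) /\ mean2 (U \o vsh f) = mean2 U.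
Proof.
move=> cf pf [cU pU U01]; have cff : continuous (fun z : R * R => f z.1).
  by apply: cont_comp => //; cont.
have c1 : continuous (U \o vsh f).
  by apply: cont_comp2 => //; cont.
split; [split=> // [x i j|x]; last exact: U01|].
  rewrite /= /vsh/= pf -[RHS](pU _ i j).
  by congr (U (_, _)); rewrite /= addrAC.
rewrite (mean2E c1 _).1; last by move=> x; have /andP[] := U01 (vsh f x).
rewrite (mean2E cU _).1; last by move=> x; have /andP[] := U01 x.
apply: eq_mean => x; apply: (@mean_shift R (fun y => U (x, y)) (f x)).
  by apply: cont_comp2 => //; cont.
by move=> y; have := pU (x, y) 0 1; rewrite addr0.
Qed.

Lemma unit_fun_tr t U : unit_fun U ->
  unit_fun (U \o tr t) /\ mean2 (U \o tr t) = mean2 U.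
Proof.
move=> [cU pU U01]; have c1 : continuous (U \o tr t).
  by apply: cont_comp2 => //; cont.
split; [split=> // [x i j|x]; last exact: U01|].
  rewrite /= /tr/= -[RHS](pU _ i j).
  by congr (U (_, _)); rewrite /= addrAC.
rewrite (mean2E c1 _).2; last by move=> x; have /andP[] := U01 (tr t x).
rewrite (mean2E cU _).2; last by move=> x; have /andP[] := U01 x.
apply: eq_mean => y; apply: (@mean_shift R (fun x => U (x, y))).
  by apply: cont_comp2 => //; cont.
by move=> x; have := pU (x, y) 1 0; rewrite addr0.
Qed.

Lemma unit_funM U V : unit_fun U -> unit_fun V -> unit_fun (fun z => U z * V z).
Proof.
move=> [cU pU U01] [cV pV V01]; split.
- exact: contM.
- by move=> x k l; rewrite pU pV.
- move=> x; have /andP[u0 u1] := U01 x; have /andP[v0 v1] := V01 x.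
  by rewrite mulr_ge0//= mulr_ile1.
Qed.

Lemma mean2_dist U V (e : R) : unit_fun U -> unit_fun V ->
  (forall x, `|U x - V x| <= e) -> `|mean2 U - mean2 V| <= e.
Proof.
have b1 (W : R * R -> R) : unit_fun W -> (forall x, 0 <= W x) /\ (forall x, `|W x| <= 1).
  by move=> [_ _ h]; split=> x; have /andP[h1 h2] := h x; rewrite ?ger0_norm.
move=> uU uV h; have [U0 U1] := b1 _ uU; have [V0 V1] := b1 _ uV.
have [cU _ _] := uU; have [cV _ _] := uV.
rewrite (mean2E cU U0).2 (mean2E cV V0).2.
apply: mean_dist; [exact: mean_continuous U1|exact: mean_continuous V1|].
by move=> y _; apply: mean_dist; [exact: slice1|exact: slice1|move=> x _; exact: h].
Qed.

End ShearInvariance.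

Section Invariance.
Variables (R : realType) (q : nat -> nat).
Implicit Types (U V : R * R -> R).
Local Notation Q n := ((q n)%:R : R).
Local Notation hfR := (hf (bR R q) (phiR q)).
Local Notation hbR := (hb (bR R q) (phiR q)).
Local Notation HfR := (Hf (bR R q) (phiR q)).
Local Notation HbR := (Hb (bR R q) (phiR q)).
Local Notation cR := (conj (bR R q) (phiR q)).

Lemma phiR_continuous n : continuous (phiR q n : R -> R).
Proof. by apply: contM; [exact: cont_cst|apply: (@cont_comp R R (@cos R)); [exact: continuous_cos|cont]]. Qed.

Lemma unit_fun_hf n U : unit_fun U ->
  unit_fun (U \o hfR n) /\ mean2 (U \o hfR n) = mean2 U.
Proof.
move=> uU; have [u1 e1] := unit_fun_hsh (Posz (q n)) uU.
have [u2 e2] := unit_fun_vsh (phiR_continuous (n:=n)) (fun x k => phiR_int q n k x) u1.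
by rewrite e1 in e2.
Qed.

Lemma unit_fun_hb n U : unit_fun U ->
  unit_fun (U \o hbR n) /\ mean2 (U \o hbR n) = mean2 U.
Proof.
move=> uU; have cN : continuous (fun x => - phiR q n x : R).
  by apply: contN; exact: phiR_continuous.
have pN x (k : int) : - phiR q n (x + k%:~R) = - phiR q n x :> R by rewrite phiR_int.
have [u1 e1] := unit_fun_vsh cN pN uU.
have [u2 e2] := unit_fun_hsh (- Posz (q n)) u1.
have E : hbR n = vsh (fun x => - phiR q n x) \o hsh (- Posz (q n))%:~R.
  by apply/funext => x; rewrite /hb /vsh /hsh/= intrN -pmulrn mulNr.
by rewrite e1 in e2; rewrite E.
Qed.

Lemma unit_fun_Hf n U : unit_fun U ->
  unit_fun (U \o HfR n) /\ mean2 (U \o HfR n) = mean2 U.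
Proof.
elim: n U => [//|n ih] U uU; have [u1 e1] := ih U uU.
by have [u2 e2] := unit_fun_hf n.+1 u1; rewrite e1 in e2.
Qed.

Lemma unit_fun_Hb n U : unit_fun U ->
  unit_fun (U \o HbR n) /\ mean2 (U \o HbR n) = mean2 U.
Proof.
elim: n U => [//|n ih] U uU; have [u1 e1] := unit_fun_hb n.+1 uU.
by have [u2 e2] := ih _ u1; rewrite e1 in e2.
Qed.

Lemma unit_fun_conj n t U : unit_fun U ->
  unit_fun (U \o cR n t) /\ mean2 (U \o cR n t) = mean2 U.
Proof.
move=> uU; have [u1 e1] := unit_fun_Hf n uU.
have [u2 e2] := unit_fun_tr t u1; have [u3 e3] := unit_fun_Hb n u2.
by rewrite e2 e1 in e3.
Qed.

End Invariance.

(** * Decorrelation by one sheared rotation *)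

Section Correlation.
Variables (R : realType) (n : nat).
Hypothesis n0 : (0 < n)%N.
Local Notation N := (n%:R : R).
Implicit Types (U V : R * R -> R).

Definition lip_fun (L : R) U := forall x y, `|U x - U y| <= L * distR x y.

(** cos (a + b) - cos (a - b) = - 2 sin a sin b, where b is half the phase gained during the
    translation by t. *)
Lemma osc_cos s t : N * cos (2 * pi * N * (s + t)) - N * cos (2 * pi * N * s) =
  (- (2 * N * sin (pi * N * t))) * sin (2 * pi * (N * s) + pi * N * t).
Proof.
set a := 2 * pi * (N * s) + pi * N * t; set b := pi * N * t.
have -> : 2 * pi * N * (s + t) = a + b by rewrite /a /b; move: (pi) => p; ring.
have -> : 2 * pi * N * s = a - b by rewrite /a /b; move: (pi) => p; ring.
by rewrite cosD cosB; ring.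
Qed.

Variables (U V : R * R -> R) (L : R).
Hypothesis uU : unit_fun U.
Hypothesis uV : unit_fun V.
Hypothesis lU : lip_fun L U.
Hypothesis lV : lip_fun L V.

Let cU : continuous U. Proof. by case: uU. Qed.
Let cV : continuous V. Proof. by case: uV. Qed.
Let U1 x : `|U x| <= 1.
Proof. by case: uU => _ _ /(_ x) /andP[h1 h2]; rewrite ger0_norm. Qed.
Let V1 x : `|V x| <= 1.
Proof. by case: uV => _ _ /(_ x) /andP[h1 h2]; rewrite ger0_norm. Qed.
Let U0 x : 0 <= U x. Proof. by case: uU => _ _ /(_ x) /andP[]. Qed.
Let V0 x : 0 <= V x. Proof. by case: uV => _ _ /(_ x) /andP[]. Qed.
Let perU1 y : per1 (fun x => U (x, y)).
Proof. by move=> x; case: uU => _ /(_ (x, y) 1 0); rewrite addr0. Qed.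
Let perU2 (c t : R) (k : nat) : per1 (fun y => U (c + k%:R * y, t + y)).
Proof.
move=> y; case: uU => _ /(_ (c + k%:R * y, t + y) (Posz k) 1) h _; rewrite -h /=.
by congr (U (_, _)); rewrite -?pmulrn; ring.
Qed.

Variable t : R.
Let C := - (2 * N * sin (pi * N * t)).
Let D (s : R) := C * sin (2 * pi * s + pi * N * t).

Let cD : continuous D.
Proof. by apply: contM; [cont|apply: cont_comp; [exact: continuous_sin|cont]]. Qed.

Let perD s : D (s + 1) = D s.
Proof.
rewrite /D; have -> : 2 * pi * (s + 1) + pi * N * t = 2 * pi * s + pi * N * t + pi *+ 2.
  by rewrite -mulr_natl; move: (pi) => p; ring.
by rewrite sinD2pi.
Qed.

(* In the coordinates (z.1 + N * z.2, z.2), with N = q_n, the first factor is U composed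
   with h_n o R_t o h_n^-1; D (N * z.1) is the difference of cosines of osc_cos. *)
Let G (z : R * R) := U (z.1 + t + N * (z.2 + D (N * z.1)), z.2 + D (N * z.1)) *
  V (z.1 + N * z.2, z.2).

Let cDN (T : topologicalType) (f : T -> R) : continuous f -> continuous (fun z => D (f z)).
Proof. by move=> cf; apply: cont_comp; [exact: cD|]. Qed.

Let cG : continuous G.
Proof.
have c1 : continuous (fun z : R * R => D (N * z.1)) by apply: cDN; cont.
by apply: contM; apply: cont_comp2 => //; cont.
Qed.

Let A s := mean (fun y => U (s + t + N * y, y)).

Let cA : continuous A.
Proof.
apply: (@mean_continuous R (fun z => U (z.2 + t + N * z.1, z.1)) 1) => //.
by apply: cont_comp2 => //; cont.
Qed.

(** [A s] is the mean of [U] along a closed curve of slope N. Such a curve equidistributes: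
    [frozen_average] applies with y as slow and N y as fast variable. *)
Let A_close s : `|A s - mean2 U| <= 2 * L / N.
Proof.
have -> : mean2 U = mean (fun y => mean (fun x => U (s + t + x, y))).
  rewrite (mean2E cU U0).2; apply: eq_mean => y; apply/esym.
  rewrite -[RHS](@mean_shift R (fun x => U (x, y)) (s + t)) //.
    by apply: eq_mean => x; rewrite addrC.
  by apply: cont_comp2 => //; cont.
apply: (@frozen_average R (fun y x => U (s + t + x, y)) L n n0).
- move=> y y' x; apply: (le_trans (lU _ _)); rewrite /distR/= subrr normr0 add0r//.
- by move=> y; apply: cont_comp2 => //; cont.
- by move=> y x; rewrite addrA perU1.
- by apply: cont_comp2 => //; cont.
- apply: (@mean_continuous R (fun z => U (s + t + z.1, z.2)) 1) => //.
  by apply: cont_comp2 => //; cont.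
Qed.

Let L0 : 0 <= L.
Proof.
have := lU (1, 0) 0; rewrite /distR/= !subr0 normr1 normr0 addr0 mulr1.
exact: le_trans.
Qed.

(** Two averages. Freezing s while the phase N s of [D] runs through a period costs 4 L / N. By the
    hypothesis on [C], a point displaced by [D x] along the closed curve is then distributed, up to
    e, like a uniform point of the curve, which produces [A s]. *)
Let G_close (e : R) r :
  (forall f phi, continuous f -> per1 f -> (forall x, `|f x| <= 1) ->
    `|mean (fun x => f (C * sin (2 * pi * x + phi))) - mean f| <= e) ->
  `|mean (fun s => G (s, r)) - mean (fun s => V (s + N * r, r) * A s)| <= 4 * L / N + e.
Proof.
move=> he.
pose K s x := U (s + t + N * (r + D x), r + D x) * V (s + N * r, r).
have lK s s' x : `|K s x - K s' x| <= 2 * L * `|s - s'|.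
  rewrite /K; set a := (_, r + D x); set a' := (s' + _ + _, r + D x).
  set c := (_, r); set c' := (s' + _, r).
  have -> : U a * V c - U a' * V c' = (U a - U a') * V c + U a' * (V c - V c') by ring.
  apply: (le_trans (ler_normD _ _)); rewrite !normrM.
  have h1 : `|U a - U a'| <= L * `|s - s'|.
    apply: (le_trans (lU _ _)); rewrite /distR/= subrr normr0 addr0.
    by rewrite (_ : s + t + _ - _ = s - s')//; ring.
  have h2 : `|V c - V c'| <= L * `|s - s'|.
    apply: (le_trans (lV _ _)); rewrite /distR/= subrr normr0 addr0.
    by rewrite (_ : s + _ - _ = s - s')//; ring.
  have k1 : `|U a - U a'| * `|V c| <= L * `|s - s'| * 1 by apply: ler_pM.
  have k2 : `|U a'| * `|V c - V c'| <= 1 * (L * `|s - s'|) by apply: ler_pM.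
  by lra.
have c1 : continuous (fun z : R * R => D z.1) by apply: cDN; cont.
have c3 : continuous (fun s => D (N * s)) by apply: cDN; cont.
have cK2 : continuous (fun z : R * R => K z.2 z.1).
  by apply: contM; apply: cont_comp2 => //; cont.
have cmK : continuous (fun s => mean (K s)).
  apply: (@mean_continuous R (fun z => K z.2 z.1) 1) => // z.
  by rewrite normrM; apply: mulr_ile1.
have cDD : continuous (fun s => D s) by exact: cD.
have cKN : continuous (fun s => K s (N * s)).
  by apply: contM; apply: cont_comp2 => //; cont.
have F := @frozen_average R K (2 * L) n n0 lK _ _ _ _.
have {F} F : `|mean (fun s => K s (N * s)) - mean (fun s => mean (K s))| <= 2 * (2 * L) / N.
  apply: F => //.
  - by move=> s; apply: contM; last cont; apply: cont_comp2 => //; cont.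
  - by move=> s x; rewrite /K perD.
have -> : mean (fun s => G (s, r)) = mean (fun s => K s (N * s)) by [].
have cVr : continuous (fun s => V (s + N * r, r)) by apply: cont_comp2 => //; cont.
have H : `|mean (fun s => mean (K s)) - mean (fun s => V (s + N * r, r) * A s)| <= e.
  apply: mean_dist => //; first by apply: contM.
  move=> s _; pose w y := U (s + t + N * (r + y), r + y).
  have cw : continuous w by apply: cont_comp2 => //; cont.
  have cwr : continuous (fun y => U (s + t + N * y, y)) by apply: cont_comp2 => //; cont.
  have pw0 : per1 (fun y => U (s + t + N * y, y)).
    by move=> y; have := @perU2 (s + t) 0 n y; rewrite !add0r.
  have pw : per1 w by move=> y; rewrite /w addrA; apply: pw0.
  have -> : mean (K s) = V (s + N * r, r) * mean (fun x => w (D x)).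
    rewrite -meanZ; last by apply: cont_comp2 => //; cont.
    by apply: eq_mean => x; rewrite mulrC.
  have -> : A s = mean w.
    rewrite /A -(mean_shift r cwr pw0); apply: eq_mean => y.
    by rewrite /w [y + r]addrC.
  rewrite -mulrBr normrM -[leRHS]mul1r ler_pM//.
  by apply: he => // x; rewrite /w.
have := ler_normD (mean (fun s => K s (N * s)) - mean (fun s => mean (K s)))
  (mean (fun s => mean (K s)) - mean (fun s => V (s + N * r, r) * A s)).
rewrite subrKA => h; apply: (le_trans h).
have -> : 4 * L / N = 2 * (2 * L) / N by ring.
by rewrite lerD.
Qed.

(** After [G_close], [A s] may be replaced by the constant [mean2 U] at the cost 2 L / N; what
    remains is the mean of [V], unchanged by the horizontal shear. *)
Lemma sheared_correlation (e : R) :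
  (forall f phi, continuous f -> per1 f -> (forall x, `|f x| <= 1) ->
    `|mean (fun x => f (C * sin (2 * pi * x + phi))) - mean f| <= e) ->
  `|mean2 G - mean2 U * mean2 V| <= 6 * L / N + e.
Proof.
move=> he; have G0 x : 0 <= G x by exact: mulr_ge0.
have G1 x : `|G x| <= 1 by rewrite normrM; apply: mulr_ile1.
rewrite (mean2E cG G0).2.
have cVA : continuous (fun z : R * R => V (z.1 + N * z.2, z.2) * A z.1).
  apply: contM; first by apply: cont_comp2 => //; cont.
  by apply: cont_comp; cont.
have A1 s : `|A s| <= 1.
  rewrite -[A s]subr0 -(mean_cst 0); apply: mean_dist; cont.
    by apply: cont_comp2 => //; cont.
  by move=> x _; rewrite subr0.
have VA1 z : `|V (z.1 + N * z.2, z.2) * A z.1| <= 1.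
  by rewrite normrM; apply: mulr_ile1.
have cm1 := mean_continuous cG G1.
have cm2 := mean_continuous cVA VA1.
have h1 : `|mean (fun r => mean (fun s => G (s, r))) -
    mean (fun r => mean (fun s => V (s + N * r, r) * A s))| <= 4 * L / N + e.
  by apply: mean_dist => // r _; exact: G_close.
have [[cV' _ V01'] eV] := unit_fun_hsh (Posz n) uV.
have V0' x : 0 <= (V \o hsh n%:~R) x by have /andP[] := V01' x.
have V1' x : `|(V \o hsh n%:~R) x| <= 1 by exact: V1.
have := (mean2E cV' V0').2; rewrite eV => {}eV.
have cmV := mean_continuous cV' V1'.
have cV1 r : continuous (fun s => (V \o hsh n%:~R) (s, r)).
  by apply: cont_comp2 => //; cont.
have h2 : `|mean (fun r => mean (fun s => V (s + N * r, r) * A s)) - mean2 U * mean2 V| <= 2 * L / N.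
  rewrite eV -meanZ//; apply: mean_dist => //; first by cont.
  move=> r _; rewrite -meanZ//; apply: mean_dist => //.
  - by apply: contM => //; apply: cont_comp2 => //; cont.
  - by cont; exact: cV1.
  move=> s _; rewrite /= /hsh/= -pmulrn mulrC -mulrBl normrM -[leRHS]mulr1.
  by apply: ler_pM => //; exact: A_close.
have := ler_normD (mean (fun r => mean (fun s => G (s, r))) -
    mean (fun r => mean (fun s => V (s + N * r, r) * A s)))
  (mean (fun r => mean (fun s => V (s + N * r, r) * A s)) - mean2 U * mean2 V).
rewrite subrKA => h; apply: (le_trans h).
have -> : 6 * L / N = 4 * L / N + 2 * L / N by ring.
by rewrite addrAC lerD.
Qed.

End Correlation.

(** * From mixing along a sequence to weak mixing *)

Section BlumHanson.
Context d (T : measurableType d) (R : realType) (P : probability T R).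
Implicit Types (A B : set T) (f : T -> R).
Local Notation p A := (fine (P A)).

Lemma prob_ge0 A : 0 <= p A.
Proof. by rewrite fine_ge0. Qed.

Lemma prob_le1 A : measurable A -> p A <= 1.
Proof.
by move=> mA; rewrite -lee_fin fineK ?fin_num_measure// probability_le1.
Qed.

Lemma prob_le A B : measurable A -> measurable B -> A `<=` B -> p A <= p B.
Proof.
move=> mA mB AB; rewrite fine_le ?fin_num_measure//.
by apply: le_measure => //; rewrite inE.
Qed.

Lemma integrable_indic_scale A (c : R) : measurable A ->
  P.-integrable setT (EFin \o (fun x => c * \1_A x)).
Proof.
move=> mA; have h : P.-integrable setT (EFin \o \1_A) by exact: integrable_indic.
have := @integrableZl _ _ _ P setT measurableT c _ h.
by apply: eq_integrable => // x _; rewrite /= EFinM.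
Qed.

Lemma Rintegral_indic A (c : R) : measurable A ->
  \int[P]_(x in setT) (c * \1_A x) = c * p A.
Proof.
move=> mA; rewrite RintegralZl//; last exact: integrable_indic.
by rewrite /Rintegral integral_indic// setIT.
Qed.

Lemma Rintegral_sum (f : nat -> T -> R) K :
  (forall k, P.-integrable setT (EFin \o f k)) ->
  P.-integrable setT (EFin \o (fun x => \sum_(0 <= k < K) f k x)) /\
  \int[P]_(x in setT) (\sum_(0 <= k < K) f k x) = \sum_(0 <= k < K) \int[P]_(x in setT) f k x.
Proof.
move=> If; elim: K => [|K [ih1 ih2]].
  have -> : (fun x => \sum_(0 <= k < 0) f k x) = (fun=> 0) by apply/funext => x; rewrite big_nil.
  rewrite big_nil Rintegral_cst//= mul0r; split=> //.
  exact: (@integrable0 _ _ _ P setT).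
have -> : (fun x => \sum_(0 <= k < K.+1) f k x) = (fun x => \sum_(0 <= k < K) f k x + f K x).
  by apply/funext => x; rewrite big_nat_recr.
rewrite RintegralD// big_nat_recr//= ih2; split=> //.
have := @integrableD _ _ _ P setT measurableT _ _ ih1 (If K).
by apply: eq_integrable => // x _; rewrite /= EFinD.
Qed.

(** The double sum is the integral of the square of the combination of the indicators of the [D k]
    with coefficients [c k]. *)
Lemma gram_ge0 (D : nat -> set T) (c : nat -> R) K : (forall k, measurable (D k)) ->
  0 <= \sum_(0 <= k < K) \sum_(0 <= l < K) c k * c l * p (D k `&` D l).
Proof.
move=> mD.
have mDD k l : measurable (D k `&` D l) by exact: measurableI.
have h k := @Rintegral_sum (fun l x => c k * c l * \1_(D k `&` D l) x) K
  (fun l => integrable_indic_scale (c k * c l) (mDD k l)).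
have [_ h2] := @Rintegral_sum (fun k x => \sum_(0 <= l < K) c k * c l * \1_(D k `&` D l) x) K
  (fun k => (h k).1).
have E : \int[P]_(x in setT) (\sum_(0 <= k < K) \sum_(0 <= l < K) c k * c l * \1_(D k `&` D l) x) =
   \sum_(0 <= k < K) \sum_(0 <= l < K) c k * c l * p (D k `&` D l).
  rewrite h2; apply: eq_bigr => k _; rewrite (h k).2; apply: eq_bigr => l _.
  by rewrite Rintegral_indic.
rewrite -E; apply: Rintegral_ge0 => x _.
have -> : \sum_(0 <= k < K) \sum_(0 <= l < K) c k * c l * \1_(D k `&` D l) x =
    (\sum_(0 <= k < K) c k * \1_(D k) x) ^+ 2.
  rewrite expr2 mulr_suml; apply: eq_bigr => k _; rewrite mulr_sumr.
  by apply: eq_bigr => l _; rewrite indicI/=; ring.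
exact: sqr_ge0.
Qed.

(* With X = sum_j s_j (1_(C j) - a) and lam = E (X 1_B), this is
   0 <= E ((X - lam 1_B)^2) <= E (X^2) - lam^2. *)
Lemma correlation_sqr (C : nat -> set T) B (s : nat -> R) (a : R) K :
  (forall j, measurable (C j)) -> measurable B -> (forall j, p (C j) = a) ->
  (\sum_(0 <= j < K) s j * (p (C j `&` B) - a * p B)) ^+ 2 <=
  \sum_(0 <= i < K) \sum_(0 <= j < K) s i * s j * (p (C i `&` C j) - a ^+ 2).
Proof.
move=> mC mB pC.
set lam := \sum_(0 <= j < K) (s j * (p (C j `&` B) - a * p B)).
pose S := \sum_(0 <= j < K) s j; pose h := \sum_(0 <= j < K) s j * p (C j `&` B).
pose g := \sum_(0 <= i < K) \sum_(0 <= j < K) s i * s j * p (C i `&` C j).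
have lamE : lam = h - a * S * p B.
  rewrite /h /S mulr_sumr mulr_suml -sumrB; apply: eq_bigr => j _; ring.
have gE : \sum_(0 <= i < K) \sum_(0 <= j < K) s i * s j * (p (C i `&` C j) - a ^+ 2) = g - a ^+ 2 * S ^+ 2.
  have -> : a ^+ 2 * S ^+ 2 = \sum_(0 <= i < K) \sum_(0 <= j < K) s i * s j * a ^+ 2.
    rewrite mulrC expr2 /S mulr_suml mulr_suml; apply: eq_bigr => i _.
    by rewrite mulr_sumr mulr_suml.
  rewrite -sumrB; apply: eq_bigr => i _; rewrite -sumrB; apply: eq_bigr => j _; ring.
(* These coefficients write X - lam 1_B as one combination of indicators: the whole space carries
   the constant - a S, then come B and the events C j. *)
pose D k := match k with 0%N => setT | 1%N => B | j.+2 => C j end.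
pose c k := match k with 0%N => - (a * S) | 1%N => - lam | j.+2 => s j end.
have mD k : measurable (D k) by case: k => [|[|k]]; [exact: measurableT|exact: mB|exact: mC].
have := @gram_ge0 D c K.+2 mD.
have pT : p [set: T] = 1 by rewrite probability_setT.
have row k : \sum_(0 <= l < K.+2) c k * c l * p (D k `&` D l) =
    c k * (- (a * S)) * p (D k) + (c k * (- lam) * p (D k `&` B) +
    \sum_(0 <= j < K) c k * s j * p (D k `&` C j)).
  by rewrite big_nat_recl// big_nat_recl//= setIT.
under eq_bigr do rewrite row.
rewrite big_nat_recl// big_nat_recl//= pT !setTI setIid gE.
have -> : \sum_(0 <= j < K) - (a * S) * s j * p (setT `&` C j) = - (a * S) * (a * S).
  rewrite /S !mulr_sumr; apply: eq_bigr => j _; rewrite setTI pC; ring.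
have -> : \sum_(0 <= j < K) - lam * s j * p (B `&` C j) = - lam * h.
  rewrite /h !mulr_sumr; apply: eq_bigr => j _; rewrite setIC; ring.
rewrite !big_split/=.
have -> : \sum_(0 <= i < K) s i * - (a * S) * p (C i) = - (a * S) * (a * S).
  rewrite /S !mulr_sumr; apply: eq_bigr => j _; rewrite pC; ring.
have -> : \sum_(0 <= i < K) s i * - lam * p (C i `&` B) = - lam * h.
  rewrite /h !mulr_sumr; apply: eq_bigr => j _; ring.
rewrite -/g => H.
have pB := prob_le1 mB; have pB0 := prob_ge0 B.
have hE : h = lam + a * S * p B by rewrite lamE; ring.
rewrite hE in H; move: H pB pB0; set b := p B; set aS := a * S => H b1 b0.
have -> : a ^+ 2 * S ^+ 2 = aS ^+ 2 by rewrite /aS exprMn.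
have l2 := sqr_ge0 lam.
have : lam ^+ 2 * b <= lam ^+ 2 * 1 by rewrite ler_wpM2l.
move: H; rewrite !expr2; lra.
Qed.

Variable th : T -> T.
Hypothesis th_pres : forall A, measurable A -> measurable (th @^-1` A) /\ P (th @^-1` A) = P A.
Local Notation pre n A := (iter n th @^-1` A).

Lemma iter_pres n A : measurable A -> measurable (pre n A) /\ P (pre n A) = P A.
Proof.
elim: n A => [//|n ih] A mA; have [m1 e1] := th_pres mA; have [m2 e2] := ih _ m1.
by rewrite -e1 -e2; split.
Qed.

Lemma pre_add m n A : pre (m + n) A = pre n (pre m A).
Proof. by apply/funext => x; rewrite /preimage/= iterD. Qed.

Variables (A B : set T).
Hypotheses (mA : measurable A) (mB : measurable B).
Let c n : R := `|p (pre n A `&` B) - p A * p B|.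

Let c_le1 n : c n <= 1.
Proof.
have mn := (iter_pres n mA).1; have mI := measurableI _ _ mn mB.
have := prob_ge0 (pre n A `&` B); have := prob_le1 mI.
have := prob_ge0 A; have := prob_le1 mA; have := prob_ge0 B; have := prob_le1 mB.
rewrite /c; move: (p A) (p B) (p (pre n A `&` B)) => a b x *.
have ab0 : 0 <= a * b by rewrite mulr_ge0.
have ab1 : a * b <= 1 by rewrite mulr_ile1.
by rewrite ler_norml; apply/andP; split; lra.
Qed.

(** Choosing the signs of the correlations turns [correlation_sqr] into a bound on the sum of their
    absolute values. The common shift [n] disappears from the pairwise intersections by invariance;
    the diagonal contributes K, the other pairs at most K^2 e. *)
Lemma blum_hanson_sum (m : nat -> nat) K (e : R) n : 0 <= e ->
  (forall i j, (i < j < K)%N -> `|p (pre (m i) A `&` pre (m j) A) - p A ^+ 2| <= e) ->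
  (\sum_(0 <= j < K) c (m j + n)%N) ^+ 2 <= K%:R + K%:R ^+ 2 * e.
Proof.
move=> e0 he.
pose C j := pre (m j + n)%N A.
have mC j : measurable (C j) by exact: (iter_pres _ mA).1.
have pC j : p (C j) = p A by rewrite (iter_pres _ mA).2.
pose s j := Num.sg (p (C j `&` B) - p A * p B).
have s1 j : `|s j| <= 1 by rewrite normr_sg lern1 leq_b1.
have := @correlation_sqr C B s (p A) K mC mB pC.
have -> : \sum_(0 <= j < K) s j * (p (C j `&` B) - p A * p B) = \sum_(0 <= j < K) c (m j + n)%N.
  by apply: eq_bigr => j _; rewrite /s -normrEsg.
move/le_trans; apply.
have E i j : p (C i `&` C j) = p (pre (m i) A `&` pre (m j) A).
  have mIJ : measurable (pre (m i) A `&` pre (m j) A).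
    by apply: measurableI; exact: (iter_pres _ mA).1.
  rewrite /C !pre_add -[in RHS](iter_pres n mIJ).2.
  by [].
have diag i : `|p (C i `&` C i) - p A ^+ 2| <= 1.
  rewrite setIid pC; have := prob_ge0 A; have := prob_le1 mA; set a := p A => a1 a0.
  by rewrite ler_norml expr2; apply/andP; split; nra.
have off i j : (i < K)%N -> (j < K)%N -> i != j -> `|p (C i `&` C j) - p A ^+ 2| <= e.
  rewrite neq_ltn E => iK jK /orP[ij|ji]; first by apply: he; rewrite ij.
  by rewrite setIC; apply: he; rewrite ji.
apply: (@le_trans _ _ (\sum_(0 <= i < K) (1 + K%:R * e))); last first.
  rewrite sumr_const_nat subn0 -[leLHS]mulr_natl expr2; lra.
rewrite !big_mkord; apply: ler_sum => -[i iK] _ /=.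
rewrite big_mkord (bigD1 (Ordinal iK))//= lerD//.
  apply: (le_trans (ler_norm _)); rewrite !normrM.
  by rewrite -[leRHS]mulr1 ler_pM ?mulr_ge0// mulr_ile1.
apply: (@le_trans _ _ (\sum_(j < K) e)); last by rewrite sumr_const card_ord -[leLHS]mulr_natl.
rewrite big_mkcond/=; apply: ler_sum => j _; case: ifPn => // ji.
apply: (le_trans (ler_norm _)); rewrite !normrM -[leRHS]mul1r ler_pM ?mulr_ge0//.
  by rewrite mulr_ile1.
by apply: off => //; rewrite eq_sym.
Qed.

(** Each shift of the window by one changes the sum by at most one term, and terms are at most 1. *)
Lemma shift_sum N m : \sum_(1 <= n < N.+1) c n <= m%:R + \sum_(1 <= n < N.+1) c (m + n)%N.
Proof.
elim: m => [|m ih]; first by rewrite add0r.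
apply: (le_trans ih); rewrite -natr1 -addrA lerD2l.
have E k : \sum_(1 <= n < N.+1) c (k + n)%N = \sum_(0 <= n < N) c (k.+1 + n)%N.
  by rewrite big_add1 /=; apply: eq_bigr => i _; rewrite addSnnS.
rewrite !E; case: N {ih E} => [|N]; first by rewrite !big_nil addr0.
rewrite big_nat_recl// big_nat_recr//= addn0 lerD ?c_le1//.
apply: (@le_trans _ _ (\sum_(0 <= i < N) c (m.+2 + i)%N)).
  by under eq_bigr do rewrite addnS -addSn.
by rewrite lerDl normr_ge0.
Qed.

Variable m_ : nat -> nat.
Hypothesis mixing : forall B', measurable B' -> forall e, 0 < e -> exists n0, forall n,
  (n0 <= n)%N -> `|p (pre (m_ n) A `&` B') - p A * p B'| <= e.

(** The times are chosen greedily: each new one is far enough along [m_] to mix with the finitely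
    many events already chosen. It is put at the head of the list because [mixing] lets the time of
    the first factor vary. *)
Lemma spread_times (e : R) K : 0 < e -> exists m : nat -> nat,
  forall i j, (i < j < K)%N -> `|p (pre (m i) A `&` pre (m j) A) - p A ^+ 2| <= e.
Proof.
move=> e0.
suff [s [sK hs]] : exists s : seq nat, size s = K /\
    pairwise (fun x y => `|p (pre x A `&` pre y A) - p A ^+ 2| <= e) s.
  exists (nth 0%N s) => i j /andP[ij jK]; move/(pairwiseP 0%N): hs; apply; rewrite ?inE ?sK//.
  exact: ltn_trans jK.
elim: K => [|K [s [sK hs]]]; first by exists [::].
have [n0 h0] : exists n0, forall n, (n0 <= n)%N ->
    all (fun y => `|p (pre (m_ n) A `&` pre y A) - p A ^+ 2| <= e) s.
  elim: s {sK hs} => [|y s [n0 h0]]; first by exists 0%N.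
  have [n1 h1] := mixing (iter_pres y mA).1 e0; exists (maxn n0 n1) => n.
  rewrite geq_max => /andP[a0 a1]; rewrite /= h0// andbT.
  by have := h1 _ a1; rewrite (iter_pres y mA).2 expr2.
by exists (m_ n0 :: s); rewrite /= sK; split=> //; rewrite hs h0.
Qed.

Lemma blum_hanson :
  (fun N : nat => N%:R^-1 * \sum_(1 <= n < N.+1) c n) @ \oo --> (0 : R).
Proof.
apply/cvgrPdist_le => e e0.
(* With K d0 >= 1, the bound K + K^2 d0 is at most 2 K^2 d0 = (K e / 2)^2. *)
pose d0 := e ^+ 2 / 8; have d00 : 0 < d0 by rewrite divr_gt0// exprn_gt0.
pose K := (Num.bound (d0^-1)).+1.
have K0 : 0 < K%:R :> R by rewrite ltr0n.
have Kd : 1 <= K%:R * d0.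
  rewrite -ler_pdivrMr// mul1r; apply: ltW; apply: (@lt_le_trans _ _ (Num.bound (d0^-1))%:R).
    by apply: archi_boundP; rewrite invr_ge0 ltW.
  by rewrite ler_nat.
have [m hm] := spread_times K d00.
pose M := \sum_(0 <= j < K) (m j)%:R : R.
have M0 : 0 <= M by apply: sumr_ge0.
have bound n : \sum_(0 <= j < K) c (m j + n)%N <= K%:R * (e / 2).
  have S0 : 0 <= \sum_(0 <= j < K) c (m j + n)%N by apply: sumr_ge0 => j _; exact: normr_ge0.
  rewrite -ler_sqr ?nnegrE//; last by rewrite mulr_ge0//; lra.
  apply: (le_trans (blum_hanson_sum n (ltW d00) hm)).
  rewrite exprMn; have -> : (e / 2) ^+ 2 = 2 * d0 by rewrite /d0; field.
  by rewrite expr2; nra.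
(* The sum is replaced by the average of its K shifted copies, to which [bound] applies for each n;
   the shifts cost [M] in total, negligible against N. *)
have main N : K%:R * \sum_(1 <= n < N.+1) c n <= M + N%:R * (K%:R * (e / 2)).
  apply: (@le_trans _ _ (\sum_(0 <= j < K) ((m j)%:R + \sum_(1 <= n < N.+1) c (m j + n)%N))).
    have -> : K%:R * \sum_(1 <= n < N.+1) c n = \sum_(0 <= j < K) \sum_(1 <= n < N.+1) c n.
      by rewrite sumr_const_nat subn0 mulr_natl.
    by apply: ler_sum => j _; exact: shift_sum.
  rewrite big_split/= lerD2l exchange_big/=.
  apply: (@le_trans _ _ (\sum_(1 <= n < N.+1) K%:R * (e / 2))).
    by apply: ler_sum => n _; exact: bound.
  by rewrite sumr_const_nat subn1 /= [leRHS]mulr_natl.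
pose N0 := (Num.bound (2 * M / e)).+1.
exists N0 => // N /= hN; rewrite sub0r normrN ger0_norm; last first.
  by rewrite mulr_ge0 ?invr_ge0// sumr_ge0// => n _; exact: normr_ge0.
have N_gt0 : 0 < N%:R :> R by rewrite ltr0n; apply: leq_trans hN.
have NM : 2 * M / e <= N%:R.
  apply: ltW; apply: (@lt_le_trans _ _ (Num.bound (2 * M / e))%:R).
    by apply: archi_boundP; rewrite divr_ge0 ?mulr_ge0 ?(ltW e0).
  by rewrite ler_nat ltnW.
rewrite ler_pdivrMl//; rewrite ler_pdivrMr// in NM.
rewrite -(ler_pM2l K0); apply: (le_trans (main N)).
have K1 : 1 <= K%:R :> R by rewrite ler1n.
have e2 : 0 <= e / 2 by lra.
have : N%:R * e / 2 <= K%:R * (N%:R * e / 2) by rewrite ler_peMl// divr_ge0// mulr_ge0// ltW.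
by move: NM; set k := K%:R; set x := N%:R; lra.
Qed.

End BlumHanson.

(** * Extending a limit from a generating family to all measurable sets *)

Section DynkinLimit.
Context d (T : measurableType d) (R : realType) (P : probability T R).
Implicit Types (A B : set T).
Local Notation p A := (fine (P A)).

Lemma probU A B : measurable A -> measurable B -> A `&` B = set0 -> p (A `|` B) = p A + p B.
Proof.
move=> mA mB AB; rewrite measureU// fineD ?fin_num_measure//.
Qed.

Lemma prob_bigcup_cvg (F : (set T)^nat) (e : R) : (forall n, measurable (F n)) -> 0 < e ->
  exists K, p (\bigcup_k F k) - p (\big[setU/set0]_(k < K) F k) <= e.
Proof.
move=> mF e0; pose U K := \big[setU/set0]_(k < K) F k.
have mU K : measurable (U K) by exact: bigsetU_measurable.
have UE : \bigcup_K U K = \bigcup_k F k.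
  apply/seteqP; split=> [x [K _]|x [k _ Fx]].
    by rewrite /U -bigcup_mkord => -[k _ Fx]; exists k.
  by exists k.+1 => //; rewrite /U -bigcup_mkord; exists k => //=.
have mb : measurable (\bigcup_K U K) by exact: bigcupT_measurable.
have nd : nondecreasing_seq U.
  move=> i j ij; apply/subsetPset; rewrite /U -!bigcup_mkord => x [k /= ki Fx].
  by exists k => //=; exact: leq_trans ij.
have h := @nondecreasing_cvg_mu _ _ _ P U mU mb nd.
rewrite UE in h mb.
have /cvgrPdist_le/(_ _ e0)[K _ hK] : p (U n) @[n --> \oo] --> p (\bigcup_k F k).
  by apply: fine_cvg; rewrite fineK ?fin_num_measure.
exists K; have := hK K (leqnn _); apply: le_trans; exact: ler_norm.
Qed.

Variables (G : set (set T)) (nu : nat -> set T -> R) (c : R).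
Hypotheses (mG : @measurable _ T = <<s G >>) (GI : setI_closed G) (GT : G setT).
Hypothesis c01 : 0 <= c <= 1.
Hypothesis nuU : forall n A B, measurable A -> measurable B -> A `&` B = set0 ->
  nu n (A `|` B) = nu n A + nu n B.
Hypothesis nu_le : forall n A, measurable A -> 0 <= nu n A <= p A.

Let tends A := forall e, 0 < e -> exists n0, forall n, (n0 <= n)%N -> `|nu n A - c * p A| <= e.
Hypothesis nuG : forall A, G A -> tends A.

Let tendsU A B : measurable A -> measurable B -> A `&` B = set0 ->
  tends A -> tends B -> tends (A `|` B).
Proof.
move=> mA mB AB tA tB e e0; have e2 : 0 < e / 2 by lra.
have [nA hA] := tA _ e2; have [nB hB] := tB _ e2; exists (maxn nA nB) => n.
rewrite geq_max => /andP[/hA {}hA /hB {}hB]; rewrite nuU// probU//.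
have -> : nu n A + nu n B - c * (p A + p B) = (nu n A - c * p A) + (nu n B - c * p B) by ring.
by apply: (le_trans (ler_normD _ _)); lra.
Qed.

(** The sets along which the limit holds form a Dynkin system. For a countable disjoint union, the
    domination [nu n <= p] makes the tail small uniformly in n, so that finite unions decide. *)
Lemma dynkin_limit A : measurable A ->
  forall e, 0 < e -> exists n0, forall n, (n0 <= n)%N -> `|nu n A - c * p A| <= e.
Proof.
rewrite mG; apply: (@dynkin_induction _ T G tends) => //; first exact: nuG.
  move=> {}A mA tA e e0; have e2 : 0 < e / 2 by lra.
  have [nT hT] := nuG GT e2; have [nA hA] := tA _ e2.
  exists (maxn nT nA) => n; rewrite geq_max => /andP[/hT {}hT /hA {}hA].
  have mC := measurableC mA.
  have := nuU n mA mC (setICr A); have := probU mA mC (setICr A).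
  rewrite setUCr => pE nE.
  have -> : nu n (~` A) - c * p (~` A) = (nu n setT - c * p setT) - (nu n A - c * p A).
    by rewrite nE pE; ring.
  by apply: (le_trans (ler_normB _ _)); lra.
move=> F mF tF hF e e0; have e2 : 0 < e / 2 by lra.
have [K hK] := prob_bigcup_cvg mF e2; set U := \big[setU/set0]_(k < K) F k in hK.
have mU : measurable U by exact: bigsetU_measurable.
have mb : measurable (\bigcup_k F k) by exact: bigcupT_measurable.
have tU : tends U.
  rewrite /U; elim: (K) => [|k ih].
    rewrite big_ord0 => e' e'0; exists 0%N => n _.
    have := nu_le n (@measurable0 _ T); rewrite measure0/= mulr0 subr0 => /andP[n1 n2].
    by rewrite ger0_norm//; lra.
  rewrite big_ord_recr/=; apply: tendsU => //; first exact: bigsetU_measurable.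
  rewrite -bigcup_mkord setI_bigcupl bigcup0// => i /= ik.
  by move/trivIsetP: tF; apply => //; rewrite neq_ltn ik.
have UF : U `<=` \bigcup_k F k by rewrite /U -bigcup_mkord => x [k _ Fx]; exists k.
have mD := measurableD mb mU.
have DU : U `&` (\bigcup_k F k `\` U) = set0.
  by apply/seteqP; split=> // x [Ux [_ nUx]].
have E : \bigcup_k F k = U `|` (\bigcup_k F k `\` U) by rewrite setDUK.
have [n0 h0] := tU _ e2; exists n0 => n /h0 {}h0.
have pE := probU mU mD DU; have nE := nuU n mU mD DU; rewrite -E in pE nE.
have /andP[d0 d1] := nu_le n mD.
rewrite nE pE; rewrite pE in hK; set D := _ `\` U in d0 d1 pE nE hK *.
have /andP[c0 c1] := c01.
have cD : 0 <= c * p D <= p D by rewrite mulr_ge0 ?prob_ge0//= ler_piMl ?prob_ge0.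
have -> : nu n U + nu n D - c * (p U + p D) = (nu n U - c * p U) + (nu n D - c * p D) by ring.
apply: (le_trans (ler_normD _ _)).
have : `|nu n D - c * p D| <= p D.
  by move/andP: cD => [x1 x2]; rewrite ler_norml; apply/andP; split; lra.
by lra.
Qed.

End DynkinLimit.

Section MixingExtension.
Context d (T : measurableType d) (R : realType) (P : probability T R).
Implicit Types (A B : set T).
Local Notation p A := (fine (P A)).
Variables (G : set (set T)) (th : nat -> T -> T).
Hypotheses (mG : @measurable _ T = <<s G >>) (GI : setI_closed G) (GT : G setT).
Hypothesis th_pres : forall n A, measurable A ->
  measurable (th n @^-1` A) /\ P (th n @^-1` A) = P A.

(** The extension is made one argument at a time: in [A] for a fixed [B] of the generating family,
    then in [B] for a fixed measurable [A]. *)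
Lemma mixing_extension :
  (forall A B, G A -> G B -> forall e, 0 < e -> exists n0, forall n, (n0 <= n)%N ->
    `|p (th n @^-1` A `&` B) - p A * p B| <= e) ->
  forall A B, measurable A -> measurable B -> forall e, 0 < e -> exists n0, forall n, (n0 <= n)%N ->
    `|p (th n @^-1` A `&` B) - p A * p B| <= e.
Proof.
move=> H.
have mP n A : measurable A -> measurable (th n @^-1` A) by move=> /(th_pres n)[].
have Gm A : G A -> measurable A by rewrite mG; exact: sub_sigma_algebra.
have p01 A : measurable A -> 0 <= p A <= 1 by move=> mA; rewrite prob_ge0 prob_le1.
have step A B : measurable A -> G B -> forall e, 0 < e -> exists n0, forall n, (n0 <= n)%N ->
    `|p (th n @^-1` A `&` B) - p A * p B| <= e.
  move=> mA GB e e0; have mB := Gm _ GB.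
  suff [n0 h0] : exists n0, forall n, (n0 <= n)%N ->
      `|p (th n @^-1` A `&` B) - p B * p A| <= e by exists n0 => n /h0; rewrite mulrC.
  apply: (@dynkin_limit _ T R P G (fun n A => p (th n @^-1` A `&` B)) (p B)
    mG GI GT (p01 _ mB) _ _ _ A mA e e0).
  - move=> n A1 A2 m1 m2 A12; rewrite preimage_setU setIUl probU//.
    + by apply: measurableI => //; exact: mP.
    + by apply: measurableI => //; exact: mP.
    + by rewrite setIACA -preimage_setI A12 preimage_set0 set0I.
  - move=> n A1 m1; rewrite prob_ge0/= -(th_pres n m1).2.
    by apply: prob_le => //; [apply: measurableI => //|]; exact: mP.
  - by move=> A1 G1 e' e'0; have [n0 h0] := H _ _ G1 GB _ e'0; exists n0 => n /h0; rewrite mulrC.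
move=> A B mA mB e e0.
apply: (@dynkin_limit _ T R P G (fun n B => p (th n @^-1` A `&` B)) (p A)
  mG GI GT (p01 _ mA) _ _ _ B mB e e0).
- move=> n B1 B2 m1 m2 B12; rewrite setIUr probU//.
  + by apply: measurableI => //; exact: mP.
  + by apply: measurableI => //; exact: mP.
  + by rewrite setIACA B12 setI0.
- move=> n B1 m1; rewrite prob_ge0/=.
  by apply: prob_le => //; apply: measurableI => //; exact: mP.
- by move=> B1 G1; exact: step.
Qed.

End MixingExtension.

Local Notation torT R := (g_sigma_algebraType (@open (torus R))).

(** * Haar measure on the torus *)

Section Haar.
Variable R : realType.
Implicit Types (A B : set (torus R)) (U u v : R * R -> R).
Local Notation mu2 := ((@lebesgue_measure R \x @lebesgue_measure R)%E).
Local Notation Sq := (@unit_square R).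
Local Notation toT := (@toT R).

Lemma toT_measurable : measurable_fun setT (toT : R * R -> torT R).
Proof.
apply: (@measurability _ _ _ (torT R) _ _ (@open (torus R))); first by [].
move=> _ [V oV <-]; rewrite setTI; apply: open_measurable2.
by apply: (proj1 (continuousP _) (@toT_continuous R)).
Qed.

Lemma toT_measurable_preimage A : torus_measurable A -> measurable (toT @^-1` A).
Proof. by move=> mA; rewrite -[X in measurable X]setTI; exact: toT_measurable. Qed.

(** A copy of [torus_mu] typed on the Borel space, so that it can carry the structure of a
    probability measure. *)
Definition haar_mu : set (torT R) -> \bar R := @torus_mu R.

Lemma haar_mu0 : haar_mu set0 = 0%E.
Proof. by rewrite /haar_mu /torus_mu preimage_set0 setI0 measure0. Qed.

Lemma haar_mu_ge0 A : (0 <= haar_mu A)%E.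
Proof. exact: measure_ge0. Qed.

Lemma haar_mu_sigma_additive : semi_sigma_additive haar_mu.
Proof.
move=> F mF tF mU; have mS := @unit_square_measurable R.
have mF' n : measurable (toT @^-1` F n) by exact: (toT_measurable_preimage (mF n)).
have -> : haar_mu (\bigcup_n F n) = mu2 (\bigcup_n (Sq `&` toT @^-1` F n)).
  by rewrite /haar_mu /torus_mu preimage_bigcup setI_bigcupr.
apply: (@measure_semi_sigma_additive _ _ _ mu2 (fun n => Sq `&` toT @^-1` F n)).
- by move=> n; exact: (measurableI _ _ mS (mF' n)).
- apply/trivIsetP => i j _ _ ij; rewrite setIACA -preimage_setI.
  by move/trivIsetP : tF => /(_ i j Logic.I Logic.I ij) ->; rewrite preimage_set0 setI0.
- by apply: bigcupT_measurable => n; exact: (measurableI _ _ mS (mF' n)).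
Qed.

Lemma haar_muT : haar_mu setT = 1%E.
Proof. by rewrite /haar_mu /torus_mu preimage_setT setIT unit_square_mu. Qed.

HB.instance Definition _ := isMeasure.Build _ (torT R) R haar_mu
  haar_mu0 haar_mu_ge0 haar_mu_sigma_additive.

HB.instance Definition _ := Measure_isProbability.Build _ (torT R) R haar_mu haar_muT.

Definition haar : probability (torT R) R := haar_mu.
Local Notation p A := (fine (haar A)).

Definition ind A (z : R * R) : R := \1_(toT @^-1` A) z.

Lemma ind01 A z : 0 <= ind A z <= 1.
Proof. by rewrite /ind indicE; case: (_ \in _); rewrite ?lexx ler01. Qed.

Lemma ind_integrable A : torus_measurable A -> mu2.-integrable Sq (EFin \o ind A).
Proof.
move=> mA; apply: (@le_integrable _ _ _ mu2 Sq (@unit_square_measurable R) _ (EFin \o cst 1)).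
- apply/measurable_EFinP; apply: measurable_funTS; apply: measurable_indic.
  exact: toT_measurable_preimage.
- move=> z _ /=; rewrite lee_fin normr1; have /andP[h0 h1] := ind01 A z.
  by rewrite ger0_norm.
- apply: (@bounded_integrable2 R (cst 1) 1); first by move=> x; exact: cvg_cst.
  by move=> x /=; rewrite normr1.
Qed.

Lemma ind_integral A : torus_measurable A -> \int[mu2]_(z in Sq) ind A z = p A.
Proof.
move=> mA; rewrite /Rintegral integral_indic//; first by rewrite setIC.
  exact: unit_square_measurable.
exact: toT_measurable_preimage.
Qed.

Lemma unit_fun_integrable U : unit_fun U -> mu2.-integrable Sq (EFin \o U).
Proof.
move=> [cU _ U01]; apply: (@bounded_integrable2 R U 1) => // x.
by have /andP[h0 h1] := U01 x; rewrite ger0_norm.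
Qed.

Lemma mean2_le_mu u A : unit_fun u -> torus_measurable A -> (forall z, u z <= ind A z) ->
  mean2 u <= p A.
Proof.
move=> uu mA h; rewrite -ind_integral//; apply: le_Rintegral => //.
- exact: unit_square_measurable.
- exact: unit_fun_integrable.
- exact: ind_integrable.
Qed.

(** The upper bound integrates 1_A 1_B <= u v + (1_A - u) + (1_B - v), valid pointwise for 0 <= u <=
    1_A and 0 <= v <= 1_B. *)
Lemma mu_setI_le u v A B : unit_fun u -> unit_fun v -> torus_measurable A -> torus_measurable B ->
  (forall z, u z <= ind A z) -> (forall z, v z <= ind B z) ->
  mean2 (fun z => u z * v z) <= p (A `&` B) <=
  mean2 (fun z => u z * v z) + (p A - mean2 u) + (p B - mean2 v).
Proof.
move=> uu uv mA mB hu hv.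
have mAB : torus_measurable (A `&` B) by exact: (@measurableI _ (torT R)).
have uuv := unit_funM uu uv.
have iE z : ind (A `&` B) z = ind A z * ind B z by rewrite /ind preimage_setI indicI.
apply/andP; split.
  apply: mean2_le_mu => // z; rewrite iE.
  have [_ _ /(_ z)/andP[u0 _]] := uu; have [_ _ /(_ z)/andP[v0 _]] := uv.
  exact: ler_pM.
have mS := @unit_square_measurable R.
have IA := ind_integrable mA; have IB := ind_integrable mB.
have Iu := unit_fun_integrable uu; have Iv := unit_fun_integrable uv.
have Iuv := unit_fun_integrable uuv.
have IAu : mu2.-integrable Sq (EFin \o (fun z => ind A z - u z)) by have := @integrableB _ _ _ mu2 Sq mS _ _ IA Iu; apply: eq_integrable => // z _; rewrite /= EFinB.
have IBv : mu2.-integrable Sq (EFin \o (fun z => ind B z - v z)) by have := @integrableB _ _ _ mu2 Sq mS _ _ IB Iv; apply: eq_integrable => // z _; rewrite /= EFinB.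
have Is : mu2.-integrable Sq (EFin \o (fun z => u z * v z + (ind A z - u z))) by have := @integrableD _ _ _ mu2 Sq mS _ _ Iuv IAu; apply: eq_integrable => // z _; rewrite /= EFinD.
rewrite -!ind_integral// /mean2 -!RintegralB// -!RintegralD//.
apply: le_Rintegral => //.
- exact: ind_integrable.
- by have := @integrableD _ _ _ mu2 Sq mS _ _ Is IBv; apply: eq_integrable => // z _; rewrite /= EFinD.
move=> z _; rewrite iE; have := hu z; have := hv z.
have [_ _ /(_ z)/andP[u0 u1]] := uu; have [_ _ /(_ z)/andP[v0 v1]] := uv.
have : (ind A z = 0 \/ ind A z = 1) /\ (ind B z = 0 \/ ind B z = 1).
  by rewrite /ind !indicE; split; case: (_ \in _); (try by left); right.
by case=> -[] -> [] ->; nra.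
Qed.

End Haar.

(** * Approximation of open sets from below by Lipschitz functions *)

Section OpenApproximation.
Variables (R : realType) (V : set (torus R)).
Hypothesis oV : open V.
Implicit Types (x y : R * R).
Local Notation mu2 := ((@lebesgue_measure R \x @lebesgue_measure R)%E).
Local Notation Sq := (@unit_square R).
Local Notation toT := (@toT R).
Local Notation p A := (fine (haar R A)).

(* The 1 in the set makes bump total when V is the whole torus. *)
Let D n x : set R := [set s | s = 1 \/ exists2 y, ~ V (toT y) & s = n%:R * distR x y].
(** The minimum of 1 and n times the distance from x to the complement of the lift of [V]; it tends
    to the indicator of [V] because [V] is open. *)
Definition bump n x : R := inf (D n x).

Let D_ge0 n x : lbound (D n x) 0.
Proof.
by move=> s [->|[y _ ->]]; rewrite ?mulr_ge0 ?distR_ge0.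
Qed.

Let D_inf n x : has_inf (D n x).
Proof. by split; [exists 1; left|exists 0; exact: D_ge0]. Qed.

Let bump01 n x : 0 <= bump n x <= 1.
Proof.
apply/andP; split; first by apply: lb_le_inf; [exists 1; left|exact: D_ge0].
by apply: ge_inf; [exists 0; exact: D_ge0|left].
Qed.

Let bump_le n x y : bump n x <= bump n y + n%:R * distR x y.
Proof.
rewrite -lerBlDr; apply: lb_le_inf; first by exists 1; left.
move=> s [->|[z nz ->]].
  have /andP[_ h] := bump01 n x; have : 0 <= n%:R * distR x y by rewrite mulr_ge0 ?distR_ge0.
  by lra.
rewrite lerBlDr; apply: (@le_trans _ _ (n%:R * distR x z)).
  by apply: ge_inf; [exists 0; exact: D_ge0|right; exists z].
by rewrite -mulrDr ler_wpM2l// addrC distR_tri.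
Qed.

Lemma bump_lip n : lip_fun n%:R (bump n).
Proof.
move=> x y; have h1 := bump_le n x y; have h2 := bump_le n y x; rewrite distRC in h2.
by rewrite ler_norml; apply/andP; split; lra.
Qed.

Lemma lip_fun_continuous (L : R) (U : R * R -> R) : lip_fun L U -> continuous U.
Proof.
move=> lU x; apply/cvgrPdist_le => e e0.
have L0 : 0 <= L.
  have := lU (1, 0) 0; rewrite /distR/= !subr0 normr1 normr0 addr0 mulr1.
  exact: le_trans.
have d0 : 0 < e / (2 * (L + 1)) by rewrite divr_gt0//; lra.
have nx : nbhs (x : R * R) (ball (x : R * R) (e / (2 * (L + 1)))) by exact: nbhsx_ballx.
suff : nbhs x [set y | `|U x - U y| <= e] by [].
apply: filterS nx => y /= [y1 y2]; apply: (le_trans (lU x y)).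
apply: (@le_trans _ _ (L * (2 * (e / (2 * (L + 1)))))).
  by rewrite ler_wpM2l// mulr_natl mulr2n lerD// ltW.
have -> : L * (2 * (e / (2 * (L + 1)))) = L / (L + 1) * e by field; lra.
by rewrite ler_piMl ?(ltW e0)// ler_pdivrMr; lra.
Qed.

Lemma bump_unit n : unit_fun (bump n).
Proof.
split; [exact: lip_fun_continuous (@bump_lip n)| |exact: bump01].
move=> x k l; rewrite /bump; congr inf; apply/seteqP; split=> s [->|[y nV ->]]; try by left.
  right; exists (y.1 + (- k)%:~R, y.2 + (- l)%:~R); first by rewrite toT_Z2.
  congr (_ * _); rewrite -(distR_shift _ _ (- k)%:~R (- l)%:~R) /= !intrN !addrK.
  by case: (x).
right; exists (y.1 + k%:~R, y.2 + l%:~R); first by rewrite toT_Z2.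
by rewrite distR_shift.
Qed.

Lemma bump_le_ind n x : bump n x <= ind V x.
Proof.
rewrite /ind indicE; have [|/negP h] := boolP (x \in _) => //=.
  by move=> _; have /andP[] := bump01 n x.
apply: ge_inf; first by exists 0; exact: D_ge0.
right; exists x; first by move=> Vx; apply: h; rewrite inE.
by rewrite /distR !subrr normr0 addr0 mulr0.
Qed.

Lemma bump_cvg x : (fun n => bump n x) @ \oo --> ind V x.
Proof.
rewrite /ind indicE; have [|h] := boolP (x \in _) => /=; last first.
  apply: cvg_near_cst; near=> n; apply/eqP; rewrite eq_le.
  have := bump_le_ind n x; rewrite /ind indicE (negbTE h) => -> /=.
  by have /andP[] := bump01 n x.
rewrite inE /= => Vx.
have /nbhs_ballP[e /= e0 he] : nbhs x (toT @^-1` V).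
  by apply: open_nbhs_nbhs; split=> //; apply: (proj1 (continuousP _) (@toT_continuous R)).
apply: cvg_near_cst; near=> n; apply/eqP; rewrite eq_le; apply/andP; split.
  by have /andP[] := bump01 n x.
apply: lb_le_inf; first by exists 1; left.
move=> s [->//|[y nV ->]].
have dy : e <= distR x y.
  rewrite leNgt; apply/negP => xy; apply: nV; apply: he.
  rewrite -ball_normE /=; apply: le_lt_trans xy; exact: norm_distR.
have n0 : e^-1 <= n%:R.
  by near: n; exact: nbhs_infty_ger.
apply: (@le_trans _ _ (n%:R * e)); last by rewrite ler_wpM2l.
by rewrite -ler_pdivrMr// mul1r.
Unshelve. all: by end_near. Qed.

Lemma open_approx (e : R) : 0 < e -> exists u (L : R),
  [/\ unit_fun u, lip_fun L u, 0 <= L, (forall z, u z <= ind V z) & p V - e <= mean2 u].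
Proof.
move=> e0; have mV : torus_measurable V by exact: sub_sigma_algebra.
have mS := @unit_square_measurable R.
have h : (\int[mu2]_(z in Sq) (bump n z)%:E @[n --> \oo] --> \int[mu2]_(z in Sq) (ind V z)%:E)%E.
  apply: (@dominated_cvg _ _ _ mu2 Sq mS (fun n z => (bump n z)%:E) (fun z => (ind V z)%:E) (fun=> 1%E)).
  - by move=> n; have /integrableP[] := unit_fun_integrable (bump_unit n).
  - by move=> z _; apply/fine_cvgP; split; [exact: nearW|exact: bump_cvg].
  - by [].
  - apply: (@bounded_integrable2 R (cst 1) 1); first by move=> x; exact: cvg_cst.
    by move=> x /=; rewrite normr1.
  - move=> n z _; rewrite /= lee_fin; have /andP[b0 b1] := bump01 n z.
    by rewrite ger0_norm.
have /cvgrPdist_le/(_ _ e0)[n _ hn] : (fun n => mean2 (bump n)) @ \oo --> p V.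
  rewrite -ind_integral//; apply: fine_cvg; rewrite fineK//.
  by apply: integrable_fin_num => //; exact: ind_integrable.
exists (bump n), n%:R; split=> //; [exact: bump_unit|exact: bump_lip|exact: bump_le_ind|].
by have := hn n (leqnn n); rewrite ler_norml => /andP[_]; lra.
Qed.

End OpenApproximation.

(** * Weak mixing and uniform rigidity *)

Section TorusDist.
Variable R : realType.
Implicit Types (x y : R * R) (P Q : torus R).
Local Notation toT := (@toT R).

Lemma euclid_dist_le x y : euclid_dist x y <= distR x y.
Proof.
rewrite /euclid_dist /distR -[leRHS]ger0_norm ?addr_ge0//.
rewrite -sqrtr_sqr ler_sqrt ?sqr_ge0//.
rewrite -(real_normK (num_real (x.1 - y.1))) -(real_normK (num_real (x.2 - y.2))).
have ab : 0 <= `|x.1 - y.1| * `|x.2 - y.2| by rewrite mulr_ge0.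
by rewrite sqrrD mulr2n; lra.
Qed.

Lemma torus_dist_ge0 P Q : 0 <= torus_dist P Q.
Proof.
apply: lb_le_inf; last by move=> _ [x [y [_ _ ->]]]; exact: sqrtr_ge0.
by exists (euclid_dist (repr P) (repr Q)), (repr P), (repr Q); rewrite !toT_repr.
Qed.

Lemma torus_dist_le x y : torus_dist (toT x) (toT y) <= distR x y.
Proof.
apply: le_trans (euclid_dist_le x y); apply: ge_inf; last by exists x, y.
by exists 0 => _ [x' [y' [_ _ ->]]]; exact: sqrtr_ge0.
Qed.

(** The displacement of the inverse at y is the displacement of [S] at [S' y], so both suprema obey
    the same bound. *)
Lemma dist_u_id (S S' : torus R -> torus R) (e : R) : cancel S S' -> cancel S' S ->
  (forall P, torus_dist (S P) P <= e) -> (forall P, torus_dist P (S P) <= e) ->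
  0 <= dist_u S id <= 2 * e.
Proof.
move=> SK S'K h1 h2.
have pS (y : torus R) : pinv setT S y = S' y.
  rewrite -[y in LHS]S'K pinvKV ?inE//.
  by move=> a b _ _; exact: (can_inj SK).
have pI (y : torus R) : pinv setT id y = y.
  by rewrite -[LHS]/(pinv setT id (id y)) pinvKV ?inE.
have sup_bound (f g : torus R -> torus R) : (forall P, torus_dist (f P) (g P) <= e) ->
    0 <= sup (range (fun P => torus_dist (f P) (g P))) <= e.
  move=> h; have ub : ubound (range (fun P => torus_dist (f P) (g P))) e.
    by move=> _ [y _ <-].
  apply/andP; split; last by apply: ge_sup => //; exists (torus_dist (f point) (g point)), point.
  apply: le_trans (torus_dist_ge0 (f point) (g point)) _.
  by apply: ub_le_sup; [exists e|exists point].
have /andP[a0 a1] := sup_bound S id h1.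
have h3 P : torus_dist (pinv setT S P) (pinv setT id P) <= e.
  by rewrite pS pI -[X in torus_dist _ X]S'K.
have /andP[b0 b1] := sup_bound (pinv setT S) (pinv setT id) h3.
by rewrite /dist_u; apply/andP; split; lra.
Qed.

End TorusDist.

(** * Mixing times, invariance of the measure and rigidity of the limit *)

Section MainProof.
Variables (R : realType) (q : nat -> nat).
Hypothesis q_gt1 : forall n, (0 < n)%N -> (1 < q n)%N.
Hypothesis q_growth : growth R q.
Implicit Types (A B V W : set (torus R)) (u v : R * R -> R).
Local Notation Q n := ((q n)%:R : R).
Local Notation al n := (alpha R q n).
Local Notation hbR := (hb (bR R q) (phiR q)).
Local Notation HfR := (Hf (bR R q) (phiR q)).
Local Notation cR := (conj (bR R q) (phiR q)).
Local Notation flim := (@flim R q).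
Local Notation F := (flim 1).
Local Notation toT := (@toT R).
Local Notation p A := (fine (haar R A)).
Local Notation T := (tmap (flim 1)).
Local Notation Ti := (tmap (flim (-1))).

(** Composed with H_n and then with the horizontal shear of slope q_(n+1), both of which preserve
    means, the integrand becomes that of [sheared_correlation]. The test functions become [u] and
    [v] composed with H_n, which multiplies their Lipschitz constants by [lipH n]. *)
Lemma conj_correlation n t u v (L e : R) : unit_fun u -> unit_fun v ->
  lip_fun L u -> lip_fun L v -> 0 <= L ->
  (forall f phi, continuous f -> per1 f -> (forall x, `|f x| <= 1) ->
    `|mean (fun x => f (- (2 * Q n.+1 * sin (pi * Q n.+1 * t)) *
        sin (2 * pi * x + phi))) - mean f| <= e) ->
  `|mean2 (fun z => u (cR n.+1 t z) * v z) - mean2 u * mean2 v|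
    <= 6 * (L * lipH R q n) / Q n.+1 + e.
Proof.
move=> uu uv lu lv L0 he.
have [uU eU] := unit_fun_Hf q n uu; have [uV eV] := unit_fun_Hf q n uv.
have lH (W : R * R -> R) : lip_fun L W -> lip_fun (L * lipH R q n) (W \o HfR n).
  move=> lW x y; apply: (le_trans (lW _ _)); rewrite -mulrA ler_wpM2l//.
  exact: HfR_lip.
have q0 : (0 < q n.+1)%N by rewrite ltnW// q_gt1.
have := @sheared_correlation R (q n.+1) q0 _ _ _ uU uV (lH _ lu) (lH _ lv) t e he.
rewrite eU eV; set G := fun z => _.
have [uc _] := unit_fun_conj q n.+1 t uu.
have [uw ew] := unit_fun_Hf q n (unit_funM uc uv).
have [_ eg] := unit_fun_hsh (Posz (q n.+1)) uw; rewrite ew in eg.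
pose G' : R * R -> R := ((fun z => (u \o cR n.+1 t) z * v z) \o HfR n) \o hsh (Posz (q n.+1))%:~R.
suff E : G = G' by rewrite E eg.
apply/funext => z; rewrite /G /G' /= /hsh /= -pmulrn /conj /= HfK.
have hbz : hbR n.+1 (z.1 + Q n.+1 * z.2, z.2) = (z.1, z.2 - phiR q n.+1 z.1).
  by rewrite /hb/= addrK.
rewrite hbz /tr /= /hf /=; congr (_ * _); congr (u (HfR n _)).
have -> : z.2 + - (2 * Q n.+1 * sin (pi * Q n.+1 * t)) *
    sin (2 * pi * (Q n.+1 * z.1) + pi * Q n.+1 * t) =
    z.2 - phiR q n.+1 z.1 + phiR q n.+1 (z.1 + t).
  by rewrite -osc_cos /phiR addrA [RHS]addrAC.
by [].
Qed.

(** The double angle lies in [pi/2, pi] modulo 2 pi, where the cosine is nonpositive, so the square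
    of the sine is at least 1/2. *)
Lemma sin_large (k : int) (x : R) : 1 / 4 <= x <= 1 / 2 -> 1 / 2 <= `|sin (pi * (k%:~R + x))|.
Proof.
move=> /andP[x1 x2].
have h : 1 / 2 <= sin (pi * (k%:~R + x)) ^+ 2.
  set y := pi * _.
  have : cos (y + y) <= 0.
    have -> : y + y = 2 * pi * k%:~R + (2 * pi * x) by rewrite /y; move: (pi) => p; ring.
    rewrite cosD (cos_sin_2piz _ _).1 (cos_sin_2piz _ _).2 mul1r mul0r subr0.
    have -> : 2 * pi * x = pi * (2 * x - 1) + pi by move: (pi) => p; ring.
    rewrite cosDpi oppr_le0 cos_ge0_pihalf//; have := pi_gt0 R.
    by move: (pi) => p p0; apply/andP; split; nra.
  by rewrite cosD -!expr2 cos2sin2; set s := _ ^+ 2; lra.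
have := normr_ge0 (sin (pi * (k%:~R + x))); move: h; rewrite -real_normK ?num_real//.
by set s := `|_|; rewrite expr2 => h s0; nra.
Qed.

(** Let x = q_(n+1) (alpha_(n+2) - alpha_(n+1)). Modulo integers the phase after m steps is m x, and
    m is the first integer with m x > 1/4. Since x <= 1/4, m x does not exceed 1/2; since x >= 1 /
    q_(n+2), m stays in the range where the iterates are controlled. *)
Lemma mixing_time n : exists m : nat, (0 < n)%N -> (m <= q n.+2)%N /\
  1 / 2 <= `|sin (pi * Q n.+1 * (al n.+2 *+ m))|.
Proof.
(* At index 0 the ratio bound would only give x <= 1/2; the value 0 there is a default. *)
case: n => [|n]; first by exists 0%N.
set k := n.+1; have q2 := @Q_ge2 R _ q_gt1 k.+1 isT.
have q2' := @Q_ge2 R _ q_gt1 k.+2 isT.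
have ratio := @Q_ratio R _ q_gt1 q_growth k.+1 isT.
pose x := Q k.+1 * (al k.+2 - al k.+1).
have /andP[d0 d1] := @alpha_step R _ q_gt1 k.+1.
have d2 := @alpha_step_lower R _ q_gt1 k.+1 isT.
have x0 : 0 < x by rewrite mulr_gt0//; lra.
have x4 : x <= 1 / 4.
  apply: (@le_trans _ _ (Q k.+1 / Q k.+2)); first by rewrite ler_wpM2l//; lra.
  rewrite ler_pdivrMr; last by lra.
  move: ratio; rewrite !exprS; have : 1 <= 2 ^+ n :> R by rewrite exprn_ege1// ler1n.
  by set a := 2 ^+ n; nra.
have xl : (Q k.+2)^-1 <= x.
  have : Q k.+1 * (Q k.+1 * Q k.+2)^-1 <= x by rewrite ler_wpM2l//; lra.
  by rewrite invfM mulrA divff ?mul1r//; lra.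
pose m := (Num.truncn (1 / (4 * x))).+1; exists m => _.
have x4x : 0 <= 1 / (4 * x) by rewrite divr_ge0//; lra.
have := truncn_itv x4x; set j := Num.truncn _ => /andP[j1 j2].
have jm : m%:R = j%:R + 1 :> R by rewrite /m natr1.
have mx1 : 1 / 4 <= m%:R * x.
  have : 1 / (4 * x) <= m%:R by rewrite ltW.
  by rewrite ler_pdivrMr; [lra|lra].
have mx2 : m%:R * x <= 1 / 2.
  have : j%:R * (4 * x) <= 1 by rewrite -ler_pdivlMr//; lra.
  by rewrite jm; lra.
split.
  rewrite -(ler_nat R) jm.
  have h1 : 1 / (4 * x) <= Q k.+2 / 4.
    rewrite ler_pdivrMr; last by lra.
    have : 1 <= Q k.+2 * x by rewrite -ler_pdivrMl ?mulr1//; lra.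
    by lra.
  by lra.
have [i hi] := @alpha_int R _ q_gt1 k.+1 isT.
have -> : pi * Q k.+1 * (al k.+2 *+ m) = pi * ((i * m)%:~R + m%:R * x).
  rewrite intrM -hi -pmulrn -[al k.+2 *+ m]mulr_natl /x.
  by move: (pi) (al k.+1) (al k.+2) => p a b; ring.
by apply: sin_large; rewrite mx1.
Qed.

Lemma unit_fun_iter m u : unit_fun u -> unit_fun (u \o iter m F).
Proof.
move=> uu; elim: m => [//|m [ci per i01]].
have j1 : `|1%:Z| <= 1 by [].
have -> : u \o iter m.+1 F = (u \o iter m F) \o F by apply/funext => x; rewrite /comp iterSr.
split; [|by move=> x k l; rewrite /= (flim_Z2eq q_gt1 q_growth j1); exact: per|by move=> x; exact: i01].
move=> x; apply: (@continuous_comp _ _ _ F); last exact: ci.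
exact: flim_cont.
Qed.

Lemma mixing_times : exists m_ : nat -> nat, forall u v (L : R),
  unit_fun u -> unit_fun v -> lip_fun L u -> lip_fun L v -> 0 <= L ->
  forall e, 0 < e -> exists n0, forall n, (n0 <= n)%N ->
  `|mean2 (fun z => u (iter (m_ n) F z) * v z) - mean2 u * mean2 v| <= e.
Proof.
have /choice[m_ hm] := mixing_time; exists m_ => u v L uu uv lu lv L0 e e0.
have e3 : 0 < e / 3 by lra.
have [C0 hC0] := sine_equidistribution e3.
pose L1 := L + 1; have L1_gt0 : 0 < 6 * L1 by rewrite /L1; lra.
have [N1 hN1] := half_smallM L1_gt0 e3.
have L2_gt0 : 0 < 2 * L1 by rewrite /L1; lra.
have [N2 hN2] := half_smallM L2_gt0 e3.
(* The amplitude is at least q_(n+2) because the sine is at least 1/2, and q_(n+2) >= n; so any n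
   beyond [N3] passes the threshold [C0]. *)
pose N3 := Num.bound `|C0|.
have mono i j : (i <= j)%N -> (1 / 2 : R) ^+ j <= (1 / 2) ^+ i.
  by move=> ij; rewrite ler_wiXn2l//; lra.
exists (maxn N1 (maxn N2 N3)).+1 => n; case: n => // n; rewrite ltnS !geq_max => /and3P[n1 n2 n3].
have [mq ms] := hm n.+1 isT.
set t := al n.+3 *+ m_ n.+1.
have q2 := @Q_ge2 R _ q_gt1 n.+2 isT.
have Qn : n.+2%:R <= Q n.+2.
  rewrite ler_nat; elim: (n.+1) => [|k ih]; first by rewrite ltnW// q_gt1.
  by apply: leq_ltn_trans ih _; apply: (q_lt q_gt1 q_growth).
have hC : C0 <= `|- (2 * Q n.+2 * sin (pi * Q n.+2 * t))|.
  rewrite normrN !normrM !normr_nat.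
  have b : `|C0| < N3%:R by apply: archi_boundP.
  have : N3%:R <= n%:R :> R by rewrite ler_nat.
  have : n%:R <= n.+2%:R :> R by rewrite ler_nat; exact: leqW (leqnSn n).
  have := ler_norm C0; move: ms; rewrite -/t; set s := `|sin _| => ms *.
  by nra.
have h1 := @conj_correlation n.+1 t u v L (e / 3) uu uv lu lv L0
  (fun f phi cf pf f1 => hC0 f _ phi cf pf f1 hC).
have h2 : 6 * (L * lipH R q n.+1) / Q n.+2 <= e / 3.
  apply: le_trans hN1.
  apply: (@le_trans _ _ (6 * L1 * (1 / 2) ^+ n.+1)); last first.
    by rewrite ler_wpM2l ?(ltW L1_gt0)// mono// leqW.
  have lh := lipH_half q_gt1 q_growth n.
  have q2' := @Q_ge2 R _ q_gt1 n.+1 isT.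
  have lh2 : lipH R q n.+1 / Q n.+2 <= (1 / 2) ^+ n.+1.
    apply: (le_trans lh); rewrite ler_pdivrMr; last by lra.
    by rewrite ler_peMr ?exprn_ge0//; lra.
  have -> : 6 * (L * lipH R q n.+1) / Q n.+2 = 6 * (L * (lipH R q n.+1 / Q n.+2)) by ring.
  have a0 : 0 <= lipH R q n.+1 / Q n.+2.
    by rewrite divr_ge0//; apply: le_trans (lipH_ge1 R q n.+1).
  by rewrite /L1; move: lh2 a0; set a := _ / _; set b := _ ^+ _; nra.
have close x : distR (cR n.+2 t x) (iter (m_ n.+1) F x) <= 2 * (1 / 2) ^+ n.+2.
  exact: iter_flim_close.
have h3 : `|mean2 (fun z => u (iter (m_ n.+1) F z) * v z) - mean2 (fun z => u (cR n.+2 t z) * v z)| <= e / 3.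
  apply: mean2_dist.
  - by apply: unit_funM => //; exact: unit_fun_iter.
  - by apply: unit_funM => //; exact: (unit_fun_conj q n.+2 t uu).1.
  move=> x; rewrite -mulrBl normrM.
  have [_ _ /(_ x)/andP[v0 v1]] := uv; rewrite (ger0_norm v0).
  apply: (@le_trans _ _ (L * (2 * (1 / 2) ^+ n.+2) * 1)).
    apply: ler_pM => //; apply: (le_trans (lu _ _)); rewrite ler_wpM2l//.
    by rewrite distRC.
  apply: le_trans hN2; have := mono N2 n.+2 (leqW (leqW n2)).
  have : 0 <= (1 / 2 : R) ^+ n.+2 by rewrite exprn_ge0//; lra.
  by rewrite /L1; set a := _ ^+ n.+2; set b := _ ^+ N2; nra.
set X := mean2 _ in h3 *; set Y := mean2 _ in h1 h3.
have := ler_normD (X - Y) (Y - mean2 u * mean2 v); rewrite subrKA.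
by lra.
Qed.

Let j1 : `|1%:Z| <= 1. Proof. by []. Qed.
Let jN1 : `|(-1 : int)| <= 1. Proof. by []. Qed.

Lemma mean2_ge0 u : unit_fun u -> 0 <= mean2 u.
Proof. by move=> [_ _ u01]; apply: Rintegral_ge0 => z _; have /andP[] := u01 z. Qed.

Lemma mixing_arith (a b x a' b' M e d : R) : M <= x -> x <= M + (a - a') + (b - b') ->
  `|M - a' * b'| <= d -> a - d <= a' -> b - d <= b' -> a' <= a -> b' <= b ->
  a <= 1 -> b <= 1 -> 0 <= a' -> 0 <= b' -> d <= e / 4 -> `|x - a * b| <= e.
Proof.
move=> x1 x2; rewrite ler_norml => /andP[m1 m2] ad bd aa bb a1 b1 a0 b0 de.
have h1 : (a - a') * b <= d * 1 by apply: ler_pM; lra.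
have h2 : a' * (b - b') <= 1 * d by apply: ler_pM; lra.
have h3 : a' * b' <= a * b by apply: ler_pM; lra.
by rewrite ler_norml; apply/andP; split; lra.
Qed.

Lemma unit_fun_flim j u : `|j| <= 1 -> unit_fun u -> unit_fun (u \o flim j).
Proof.
move=> hj [cu pu u01]; split.
- by move=> x; apply: (@continuous_comp _ _ _ (flim j)); [exact: flim_cont|exact: cu].
- by move=> x k l; rewrite /= flim_Z2eq// pu.
- by move=> x; exact: u01.
Qed.

Lemma mean2_flim j u (L : R) : `|j| <= 1 -> unit_fun u -> lip_fun L u -> 0 <= L ->
  mean2 (u \o flim j) = mean2 u.
Proof.
move=> hj uu lu L0; apply/eqP; rewrite -subr_eq0 -normr_le0; apply/ler_addgt0Pl => e e0.
rewrite addr0; have L8 : 0 < 8 * (L + 1) by lra.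
have [n hn] := half_smallM L8 e0.
have [uc <-] := unit_fun_conj q n (j%:~R * al n.+1) uu.
apply: mean2_dist => //; first exact: unit_fun_flim.
move=> x; apply: (le_trans (lu _ _)); apply: le_trans hn.
have h := flim_close q_gt1 q_growth n x hj; rewrite distRC.
apply: (le_trans (ler_wpM2l L0 h)).
by have := half_gt0 R n; set b := _ ^+ n => b0; nra.
Qed.

(** The composite of [u] with the limit map has no Lipschitz constant at hand, so [mean2_flim]
    cannot be iterated; the iterate is compared directly with a conjugated rotation, which preserves
    the mean. *)
Lemma mean2_iter_flim m u (L : R) : unit_fun u -> lip_fun L u -> 0 <= L ->
  mean2 (u \o iter m F) = mean2 u.
Proof.
move=> uu lu L0; apply/eqP; rewrite -subr_eq0 -normr_le0; apply/ler_addgt0Pl => e e0.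
rewrite addr0; have L2 : 0 < 2 * (L + 1) by lra.
(* [N >= m] ensures [m <= q N.+1], the range of [iter_flim_close], because q is strictly
   increasing. *)
have [n hn] := half_smallM L2 e0; pose N := (n + m)%N.
have mN : (m <= q N.+1)%N.
  apply: (@leq_trans N.+1); first by rewrite leqW// leq_addl.
  elim: (N) => [|k ih]; first by rewrite ltnW// q_gt1.
  by apply: leq_ltn_trans ih _; apply: (q_lt q_gt1 q_growth).
have [uc <-] := unit_fun_conj q N (al N.+1 *+ m) uu.
apply: mean2_dist => //; first exact: unit_fun_iter.
move=> x; apply: (le_trans (lu _ _)); apply: le_trans hn.
have h := iter_flim_close q_gt1 q_growth x mN; rewrite distRC.
apply: (le_trans (ler_wpM2l L0 h)).
have bb : (1 / 2 : R) ^+ N <= (1 / 2) ^+ n by rewrite ler_wiXn2l ?leq_addr//; lra.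
by have := half_gt0 R N; move: bb; set b := _ ^+ N; set b' := _ ^+ n => bb b0; nra.
Qed.

Lemma ind_tmap j V z : `|j| <= 1 -> ind (tmap (flim j) @^-1` V) z = ind V (flim j z).
Proof.
move=> hj; rewrite /ind !indicE; congr (nat_of_bool _)%:R.
by apply/idP/idP; rewrite !inE /= tmapE//; exact: flim_Z2eq.
Qed.

Lemma preimage_open j V : `|j| <= 1 -> open V -> open (tmap (flim j) @^-1` V).
Proof.
move=> hj oV; apply: (proj1 (continuousP _)) => //.
by apply: tmap_continuous; [exact: flim_Z2eq|exact: flim_cont].
Qed.

(** Approximation from below yields only an inequality; stated for [j = 1] and [j = -1], it gives
    equality in [open_preimage] by applying it to the inverse map. *)
Lemma open_le_preimage j V : `|j| <= 1 -> open V -> p V <= p (tmap (flim j) @^-1` V).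
Proof.
move=> hj oV; apply/ler_addgt0Pl => e e0.
have [u [L [uu lu L0 hu Vu]]] := open_approx oV e0.
rewrite -lerBlDl; apply: (le_trans Vu); rewrite -(mean2_flim hj uu lu L0).
apply: mean2_le_mu; first exact: unit_fun_flim.
  by apply: sub_sigma_algebra; exact: preimage_open.
by move=> z; rewrite ind_tmap//; exact: hu.
Qed.

Lemma TK : cancel T Ti. Proof. exact: tmap_flimK. Qed.
Lemma TiK : cancel Ti T. Proof. exact: (tmap_flimK q_gt1 q_growth jN1). Qed.

Lemma open_preimage V : open V -> p (T @^-1` V) = p V.
Proof.
move=> oV; apply/eqP; rewrite eq_le; apply/andP; split; last exact: open_le_preimage j1 oV.
have := open_le_preimage jN1 (preimage_open j1 oV).
by rewrite -comp_preimage (_ : T \o Ti = id)//; apply/funext => x /=; rewrite TiK.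
Qed.

Lemma tmap_measurable j A : `|j| <= 1 -> torus_measurable A ->
  torus_measurable (tmap (flim j) @^-1` A).
Proof.
move=> hj; have m : @measurable_fun _ _ (torT R) (torT R) setT (tmap (flim j)).
  apply: (@measurability _ _ _ (torT R) _ _ (@open (torus R))); first by [].
  move=> _ [V oV <-]; rewrite setTI; apply: sub_sigma_algebra; exact: preimage_open.
by move=> mA; have := m measurableT _ mA; rewrite setTI.
Qed.

Lemma T_measurable_fun : @measurable_fun _ _ (torT R) (torT R) setT T.
Proof. by move=> _ A mA; rewrite setTI; exact: tmap_measurable. Qed.

Let T_mfun : {mfun torT R >-> torT R} := HB.pack (T : torT R -> torT R)
  (isMeasurableFun.Build _ _ (torT R) (torT R) _ T_measurable_fun).

(** The Haar measure and its image under [T] agree on open sets, which are stable under intersection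
    and generate the Borel sets. *)
Lemma T_preserving : measure_preserving T.
Proof.
move=> A mA; split; first exact: tmap_measurable.
have := @measure_unique _ R (torT R) (@open (torus R)) (fun=> setT) erefl _ _ _
  (distribution (haar R) T_mfun) (haar R) _ _ A mA; apply => //.
- by move=> V W; exact: openI.
- by move=> _; exact: openT.
- by rewrite bigcup_const.
- move=> V oV; rewrite /distribution /pushforward /=.
  have mV : measurable (V : set (torT R)) by exact: sub_sigma_algebra.
  have mTV : measurable (T @^-1` V : set (torT R)) by exact: tmap_measurable.
  by rewrite -[LHS]fineK ?fin_num_measure// -[RHS]fineK ?fin_num_measure// open_preimage.
- by move=> _; rewrite -[X in (X < _)%E]/(haar R setT) probability_setT ltry.
Qed.

Lemma iter_TE m x : iter m T (toT x) = toT (iter m F x).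
Proof. by apply: iter_tmap; exact: flim_Z2eq. Qed.

Lemma open_mixing_times : exists m_ : nat -> nat, forall V W, open V -> open W ->
  forall e, 0 < e -> exists n0, forall n, (n0 <= n)%N ->
  `|p (iter (m_ n) T @^-1` V `&` W) - p V * p W| <= e.
Proof.
have [m_ hm] := mixing_times; exists m_ => V W oV oW e e0.
pose e4 := Num.min (e / 4) 1.
have e40 : 0 < e4 by rewrite lt_min ltr01 andbT; lra.
have e4e : e4 <= e / 4 by rewrite ge_min lexx.
have e41 : e4 <= 1 by rewrite ge_min lexx orbT.
have [u [Lu [uu lu Lu0 hu Vu]]] := open_approx oV e40.
have [v [Lv [uv lv Lv0 hv Wv]]] := open_approx oW e40.
have weak (f : R * R -> R) (L L' : R) : L <= L' -> lip_fun L f -> lip_fun L' f.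
  by move=> LL lf x y; apply: (le_trans (lf x y)); apply: ler_wpM2r => //; exact: distR_ge0.
have L1 : Lu <= Lu + Lv by rewrite lerDl.
have L2 : Lv <= Lu + Lv by rewrite lerDr.
have [n0 h0] := hm u v (Lu + Lv) uu uv (weak _ _ _ L1 lu) (weak _ _ _ L2 lv) (addr_ge0 Lu0 Lv0) e4 e40.
exists n0 => n /h0 {}h0; set m := m_ n in h0 *.
have mV : torus_measurable V by exact: sub_sigma_algebra.
have mW : torus_measurable W by exact: sub_sigma_algebra.
have [mTV eTV] := @iter_pres _ (torT R) R (haar R) T T_preserving m V mV.
have um := unit_fun_iter m uu.
have hum z : (u \o iter m F) z <= ind (iter m T @^-1` V) z.
  apply: (le_trans (hu _)); rewrite le_eqVlt; apply/orP; left; apply/eqP.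
  rewrite /ind !indicE; congr (nat_of_bool _)%:R.
  by apply/idP/idP; rewrite !inE /= iter_TE.
have := mu_setI_le um uv mTV mW hum hv.
rewrite eTV; set M := mean2 _ in h0 *.
rewrite (mean2_iter_flim m uu lu Lu0) => /andP[b1 b2].
have Vu1 : mean2 u <= p V by exact: mean2_le_mu.
have Wv1 : mean2 v <= p W by exact: mean2_le_mu.
have V1 : p V <= 1 by exact: prob_le1.
have W1 : p W <= 1 by exact: prob_le1.
have W0 := prob_ge0 (haar R) W; have V0 := prob_ge0 (haar R) V.
have u0 := mean2_ge0 uu; have v0 := mean2_ge0 uv.
exact: mixing_arith b1 b2 h0 Vu Wv Vu1 Wv1 V1 W1 u0 v0 e4e.
Qed.

Lemma iterTK n : cancel (iter n T) (iter n Ti).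
Proof.
by elim: n => // n ih x; rewrite iterSr /= TK ih.
Qed.

Lemma iterTiK n : cancel (iter n Ti) (iter n T).
Proof.
by elim: n => // n ih x; rewrite iterSr /= TiK ih.
Qed.

Lemma T_weak_mixing : weak_mixing T.
Proof.
have Tp := T_preserving; split=> // A B mA mB.
have [m_ hm] := open_mixing_times.
have mixing := @mixing_extension _ (torT R) R (haar R) (@open (torus R))
  (fun n => iter (m_ n) T) erefl (@openI _) (@openT _)
  (fun n A mA => @iter_pres _ (torT R) R (haar R) T Tp (m_ n) A mA) hm.
(* Weak mixing is defined with forward images. Pulling back by the n-th iterate, which preserves the
   measure, moves the dynamics onto [B]; hence [A] and [B] exchange roles in [blum_hanson]. *)
have E n : torus_mu ((iter n T @` A) `&` B) = haar R (iter n T @^-1` B `&` A).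
  have mI : torus_measurable ((iter n T @` A) `&` B).
    have -> : iter n T @` A = iter n Ti @^-1` A.
      apply/seteqP; split=> [_ [x Ax <-]|x Ax] /=; first by rewrite iterTK.
      by exists (iter n Ti x) => //; exact: iterTiK.
    apply: (@measurableI _ (torT R)) => //.
    elim: n A mA => //= n ih A mA.
    by apply: (ih (Ti @^-1` A)); exact: tmap_measurable.
  have [_ E] := @iter_pres _ (torT R) R (haar R) T Tp n _ mI.
  transitivity (haar R ((iter n T @` A) `&` B)); first by [].
  rewrite -E; congr (haar R _); apply/seteqP; split=> x /=; last by move=> [Bx Ax]; split=> //; exists x.
  by move=> [[y Ay /(can_inj (iterTK n)) <-] By].
have bh := @blum_hanson _ (torT R) R (haar R) T Tp B A mB mA m_
  (fun A' mA' => mixing B A' mB mA').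
have E2 (N : nat) : N%:R^-1 * \sum_(1 <= n < N.+1)
       `| fine (torus_mu ((iter n T @` A) `&` B)) - fine (torus_mu A) * fine (torus_mu B) | =
    N%:R^-1 * \sum_(1 <= n < N.+1) `|p (iter n T @^-1` B `&` A) - p B * p A|.
  by congr (_ * _); apply: eq_bigr => n _; rewrite E [in RHS]mulrC.
by rewrite (funext E2); exact: bh.
Qed.

(** Horizontal integer translations commute with every shear, so conjugation leaves them
    unchanged. *)
Lemma conj_int n (k : int) x : cR n k%:~R x = (x.1 + k%:~R, x.2).
Proof.
rewrite /conj -[RHS]/(tr k%:~R x) -[x in RHS](HbK (bR R q) (phiR q) n).
elim: n (Hb _ _ n x) => //= n ih z.
by rewrite hf_tr ?ih// => y; exact: phiR_int.
Qed.

Lemma T_rigid_bound n x :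
  torus_dist (iter (q n.+1) T (toT x)) (toT x) <= 2 * (1 / 2) ^+ n /\
  torus_dist (toT x) (iter (q n.+1) T (toT x)) <= 2 * (1 / 2) ^+ n.
Proof.
have [k hk] := @alpha_int R _ q_gt1 n.+1 isT.
have := @iter_flim_close R q q_gt1 q_growth (q n.+1) n x (leqnn _).
have -> : al n.+1 *+ q n.+1 = k%:~R by rewrite -hk mulr_natl.
rewrite conj_int (iter_TE) => h.
have -> : toT x = toT (x.1 + k%:~R, x.2) by rewrite -[RHS](toT_Z2 _ (- k) 0) /= addr0 intrN addrK; case: (x).
by split; apply: (le_trans (torus_dist_le _ _)) => //; rewrite distRC.
Qed.

Lemma T_rigid : uniformly_rigid T q.
Proof.
split; first exact: T_preserving.
  by move=> m m0; split; [rewrite ltnW// q_gt1|exact: (q_lt q_gt1 q_growth)].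
apply/cvgrPdist_le => e e0; have [n hn] := half_smallM (ltr0Sn R 3) e0.
exists n.+1 => // m /=; case: m => // m; rewrite ltnS => nm.
have /andP[d0 d1] := @dist_u_id R (iter (q m.+1) T) (iter (q m.+1) Ti) (2 * (1 / 2) ^+ m)
  (@iterTK _) (@iterTiK _)
  (fun P => ltac:(by rewrite -[P]toT_repr; exact: (T_rigid_bound m _).1))
  (fun P => ltac:(by rewrite -[P]toT_repr; exact: (T_rigid_bound m _).2)).
rewrite sub0r normrN ger0_norm//; apply: (le_trans d1); apply: le_trans hn.
have : (1 / 2 : R) ^+ m <= (1 / 2) ^+ n by rewrite ler_wiXn2l//; lra.
by set a := _ ^+ m; set b := _ ^+ n; lra.
Qed.

End MainProof.

Theorem theorem2 (R : realType) (rho : R) (q : nat -> nat)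
  (rho_gt0 : 0 < rho)
  (q_gt0 : forall n : nat, (0 < n)%N -> (0 < q n)%N)
  (q1 : rho + 1 <= (q 1%N)%:R)
  (q_growth : forall n : nat, (0 < n)%N ->
     2 ^+ n * 64 * trigo.pi ^+ 2 * n%:R ^+ 2 * (q n)%:R ^+ 14 *
       expR (4 * trigo.pi * n%:R * (q n)%:R ^+ 6 *
         expR (2 * trigo.pi * (q n)%:R ^+ 4 * (1 + n%:R * (q n)%:R)))
     <= (q n.+1)%:R :> R) :
  exists f : torus R -> torus R,
    [/\ Diff_omega rho f, weak_mixing f & uniformly_rigid f q].
Proof.
(* [q 1] exceeds 1 because [rho] is positive; the later values are at least 64, all other factors of
   the growth bound being at least 1. *)
have q_gt1 n : (0 < n)%N -> (1 < q n)%N.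
  case: n => // -[_|n _]; rewrite -(ltr_nat R); first by apply: lt_le_trans q1; lra.
  apply: lt_le_trans (q_growth n.+1 isT).
  have Q1 : 1 <= (q n.+1)%:R :> R by rewrite ler1n q_gt0.
  have n1 : 1 <= n.+1%:R :> R by rewrite ler1n.
  have p1 : 1 <= pi :> R by have := pi_ge2 R; lra.
  set E := expR _; have E1 : 1 <= E.
    rewrite -expR0 ler_expR !mulr_ge0 ?expR_ge0 ?exprn_ge0//; exact: pi_ge0.
  apply: (@lt_le_trans _ _ (64 * 1)); first by lra.
  have h : 1 <= 2 ^+ n.+1 * pi ^+ 2 * n.+1%:R ^+ 2 * (q n.+1)%:R ^+ 14 * E.
    by rewrite !mulr_ege1 ?exprn_ege1// ler1n.
  rewrite (_ : _ * E = 64 * (2 ^+ n.+1 * pi ^+ 2 * n.+1%:R ^+ 2 * (q n.+1)%:R ^+ 14 * E)).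
    by rewrite ler_wpM2l.
  by move: (pi) => c; ring.
exists (tmap (flim q 1)); split.
- exact: flim_Diff_omega.
- exact: T_weak_mixing.
- exact: T_rigid.
Qed.
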